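(* Let $u$ be the solution of the problem $(\mathcal{AK})$ described in the context, let $u_h^0\in S_h$, and let $(U_h^n)_{n=0}^N\subset S_h$ be the Crank–Nicolson fully discrete approximations, i.e. $U_h^0=u_h^0$ and, for $n=1,\dots,N$ and all $\chi\in S_h$, $$\Big(\tfrac{U_h^n-U_h^{n-1}}{k_n},\chi\Big)=-\mathrm{i}\,a^{n-\frac12}\mathcal B(\mathcal AU_h^n,\chi)+\mathrm{i}\,(\beta^{n-\frac12}\mathcal AU_h^n,\chi)+(f^{n-\frac12},\chi).$$ (i) If $\max_{1\le n\le N}k_n$ is sufficiently small, then $$\max_{0\le n\le N}\|U_h^n-u(t^n,\cdot)\|\le C\big[\|u_h^0-R_hu_0\|+(k^2+h^{r+1})\,\Xi_{\mathcal{AK},0}(u)\big]\qquad\forall\,h\in(0,h_\star],$$ where $\Xi_{\mathcal{AK},0}(u):=\sum_{m=0}^1\max_{[0,T]}\|\partial_t^mu\|_{r+1}+\sum_{m=2}^3\max_{[0,T]}\|\partial_t^mu\|+\max_{[0,T]}\|\partial_t^2\partial_x^2u\|$. (ii) If, in addition, the inverse inequality $|\phi|_1\le C h^{-1}\|\phi\|$ for all $\phi\in S_h$, $h\in(0,h_\star]$ (with a constant independent of $h$) and the mesh condition $|k_{n+1}-k_n|\le C_\star\max\{k_n^2,k_{n+1}^2\}$, $n=1,\dots,N-1$ (for some constant $C_\star\ge0$) hold, and $\max_{1\le n\le N}k_n$ is sufficiently small, then $$\max_{0\le n\le N}\|U_h^n-u(t^n,\cdot)\|_1\le C\big[\|u_h^0-R_hu_0\|_1+(k^2+h^{r})\,\Xi_{\mathcal{AK},1}(u)\big]\qquad\forall\,h\in(0,h_\star],$$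 where $\Xi_{\mathcal{AK},1}(u):=\Xi_{\mathcal{AK},0}(u)+\max_{[0,T]}\|\partial_t^2u\|_{r+1}+\max_{[0,T]}\|\partial_t^4u\|+\max_{[0,T]}\|\partial_t^3\partial_x^2u\|$. Here the constants $C$ and the smallness thresholds for $\max_nk_n$ are independent of $h$ and of the partition of $[0,T]$ (in (ii), for fixed $C_\star$).
   Context: Function spaces: $D=(0,1)$; functions are complex-valued; $(f_1,f_2)=\int_D f_1\overline{f_2}\,dx$ and $\|\cdot\|$ is the $L^2(D)$ norm; $\|f\|_s=\big(\sum_{\ell=0}^s\|\partial_x^\ell f\|^2\big)^{1/2}$ is the norm of $H^s(D)$; $|v|_1=\|v'\|$; $\mathbb H^1(D)=\{v\in H^1(D):v(0)=0\}$, $\mathbb H^s(D)=H^s(D)\cap\mathbb H^1(D)$ for $s\ge2$; $\mathcal B(v,w)=(v',w')$. Finite elements: $r\in\mathbb N$, $h_\star>0$ are fixed. For each $h\in(0,h_\star]$, $S_h$ is a finite-dimensional subspace of $\mathbb H^1(D)$ consisting of complex-valued functions that are polynomials of degree at most $r$ on each interval of a (non-uniform) partition of $D$ with maximum length $h$. With a constant independent of $h$, one has the approximation property $\inf_{\chi\in S_h}\{\|v-\chi\|+h\|v-\chi\|_1\}\le C h^{s+1}\|v\|_{s+1}$ for $v\in\mathbb H^{s+1}(D)$, $s=0,\dots,r$. The elliptic projection $R_h:H^1(D)\to S_h$ is defined by $\mathcal B(R_hv,\phi)=\mathcal B(v,\phi)$ for all $\phi\in S_h$. Time partition: $0=t^0<t^1<\dots<t^N=T$,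 $k_n=t^n-t^{n-1}$, $k=\max_{1\le n\le N}k_n$, $t^{n-\frac12}=\frac12(t^{n-1}+t^n)$; $\mathcal AV^n=\frac12(V^n+V^{n-1})$; a superscript $n-\frac12$ on $a,\beta,f$ denotes evaluation at $t=t^{n-\frac12}$. Problem $(\mathcal{AK})$: given $T>0$, $a:[0,T]\to\mathbb R\setminus\{0\}$, $\beta,f:[0,T]\times\overline D\to\mathbb C$, $u_0:\overline D\to\mathbb C$, find $u:[0,T]\times\overline D\to\mathbb C$ with $u_t=\mathrm{i}\,a(t)u_{xx}+\mathrm{i}\,\beta(t,x)u+f(t,x)$ on $[0,T]\times\overline D$; $u(t,0)=0$ and $u_x(t,1)=0$ for $t\in[0,T]$; $u(0,x)=u_0(x)$ for $x\in\overline D$. It is assumed that $u$ exists uniquely and that the data and $u$ are sufficiently smooth for the stated estimates. *)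

(* Defs.v *)
From HB Require Import structures.
From mathcomp Require Import all_boot all_order all_algebra.
From mathcomp Require Import all_classical all_reals all_analysis.
From mathcomp Require Import complex.
Set Implicit Arguments.
Unset Strict Implicit.
Unset Printing Implicit Defensive.
Import Order.TTheory GRing.Theory Num.Theory.
Import numFieldNormedType.Exports.
Local Open Scope classical_set_scope.
Local Open Scope ring_scope.
Local Open Scope complex_scope.

(* Functions on [0, 1] or [0, T] are represented by total functions on R whose
   values outside the interval are irrelevant: every notion below only depends
   on the values on the closed interval. *)

(* Derivatives on the closed interval [0, b], one-sided at the end points. *)

Definition is_rderiv (R : realType) (b : R) (f : R -> R) (x l : R) : Prop :=
  (f y - f x) / (y - x) @[y --> within `[0, b] x^'] --> l.

Definition rderiv (R : realType) (b : R) (f : R -> R) (x : R) : R :=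
  lim ((f y - f x) / (y - x) @[y --> within `[0, b] x^']).

Definition is_cderiv (R : realType) (b : R) (f : R -> R[i]) (x : R)
    (l : R[i]) : Prop :=
  is_rderiv b (fun y => complex.Re (f y)) x (complex.Re l) /\
  is_rderiv b (fun y => complex.Im (f y)) x (complex.Im l).

Definition cderiv (R : realType) (b : R) (f : R -> R[i]) (x : R) : R[i] :=
  rderiv b (fun y => complex.Re (f y)) x +i*
  rderiv b (fun y => complex.Im (f y)) x.

Definition cderivn (R : realType) (b : R) (n : nat) (f : R -> R[i]) :
  R -> R[i] := iter n (cderiv b) f.

(* Lebesgue integrals of complex-valued functions, L^2(D) and H^s(D) for
   D = (0, 1). *)

Definition cint (R : realType) (A : set R) (f : R -> R[i]) : R[i] :=
  (\int[@lebesgue_measure R]_(x in A) complex.Re (f x)) +i*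
  (\int[@lebesgue_measure R]_(x in A) complex.Im (f x)).

Definition inner (R : realType) (f g : R -> R[i]) : R[i] :=
  cint `]0, 1[ (fun x => f x * (g x)^*%C).

Definition inL2 (R : realType) (f : R -> R[i]) : Prop :=
  [/\ measurable_fun (`]0, 1[ : set R) (fun x => complex.Re (f x)),
      measurable_fun (`]0, 1[ : set R) (fun x => complex.Im (f x)) &
      (@lebesgue_measure R).-integrable `]0, 1[
        (fun x => ((Normc.normc (f x)) ^+ 2)%:E)].

Definition L2norm (R : realType) (f : R -> R[i]) : R :=
  Num.sqrt (\int[@lebesgue_measure R]_(x in `]0, 1[) (Normc.normc (f x)) ^+ 2).

(* In one dimension v belongs to H^s(D) iff (its continuous representative, for
   s > 0) has absolutely continuous derivatives of order < s and a derivative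
   of order s in L^2(D). Absolute continuity of the derivative of order l is
   expressed by the fundamental theorem of calculus; the derivative of order s
   then exists almost everywhere and is the weak one. Where the difference
   quotients do not converge, [cderiv] takes an irrelevant default value. *)
Definition inH (R : realType) (s : nat) (v : R -> R[i]) : Prop :=
  (forall l, (l <= s)%N -> inL2 (cderivn 1 l v)) /\
  (forall l, (l < s)%N -> forall x, x \in `[0, 1] ->
     cderivn 1 l v x = cderivn 1 l v 0 + cint `[0, x] (cderivn 1 l.+1 v)).

(* The space of v in H^s(D) with v(0) = 0; meaningful for s > 0. *)
Definition inHH (R : realType) (s : nat) (v : R -> R[i]) : Prop :=
  inH s v /\ v 0 = 0.

Definition Hnorm (R : realType) (s : nat) (v : R -> R[i]) : R :=
  Num.sqrt (\sum_(l < s.+1) (L2norm (cderivn 1 l v)) ^+ 2).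

Definition H1semi (R : realType) (v : R -> R[i]) : R := L2norm (cderiv 1 v).

Definition Bform (R : realType) (v w : R -> R[i]) : R[i] :=
  inner (cderiv 1 v) (cderiv 1 w).

(* Partitions 0 = t 0 < ... < t N = L; only the first N + 1 terms of t count. *)

Definition is_partition (R : realType) (L : R) (N : nat) (t : nat -> R) : Prop :=
  [/\ t 0%N = 0, t N = L & forall n, (n < N)%N -> t n < t n.+1].

Definition step (R : realType) (t : nat -> R) (n : nat) : R := t n - t n.-1.

Definition max_step (R : realType) (N : nat) (t : nat -> R) : R :=
  \big[Num.max/0]_(1 <= n < N.+1) step t n.

Definition midpoint (R : realType) (t : nat -> R) (n : nat) : R :=
  (t n.-1 + t n) / 2.

(* Finite element spaces. *)

Definition finite_dim_subspace (R : realType) (Sh : set (R -> R[i])) : Prop :=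
  exists (d : nat) (phi : 'I_d -> R -> R[i]),
    Sh = [set v | exists c : 'I_d -> R[i],
                   v = (fun x => \sum_(i < d) c i * phi i x)].

Definition fe_space (R : realType) (r : nat) (h : R) (Sh : set (R -> R[i])) :
    Prop :=
  [/\ finite_dim_subspace Sh,
      (forall v, Sh v -> inHH 1 v) &
      exists (M : nat) (y : nat -> R),
        [/\ is_partition 1 M y, max_step M y = h &
            forall v, Sh v -> forall j, (j < M)%N ->
              exists p : {poly R[i]}, (size p <= r.+1)%N /\
                forall x, x \in `[y j, y j.+1] -> v x = p.[x%:C]]].

Definition approximation_property (R : realType) (r : nat) (hstar : R)
    (Sh : R -> set (R -> R[i])) : Prop :=
  exists C : R, forall h, 0 < h <= hstar ->
    forall s, (s <= r)%N -> forall v, inHH s.+1 v ->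
      inf [set L2norm (fun x => v x - chi x)
               + h * Hnorm 1 (fun x => v x - chi x) | chi in Sh h]
        <= C * h ^+ s.+1 * Hnorm s.+1 v.

Definition inverse_inequality (R : realType) (hstar : R)
    (Sh : R -> set (R -> R[i])) : Prop :=
  exists C : R, forall h, 0 < h <= hstar ->
    forall phi, Sh h phi -> H1semi phi <= C * h^-1 * L2norm phi.

Definition elliptic_projection (R : realType) (Sh : set (R -> R[i]))
    (v : R -> R[i]) : R -> R[i] :=
  xget (fun=> 0)
    [set w | Sh w /\ forall phi, Sh phi -> Bform w phi = Bform v phi].

(* Classical smoothness on [0, T] and on [0, T] x [0, 1]. *)

Definition ccontinuous2 (R : realType) (T : R) (g : R -> R -> R[i]) : Prop :=
  {within (`[0, T] `*` `[0, 1] : set (R * R)),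
     continuous (fun p : R * R => complex.Re (g p.1 p.2))} /\
  {within (`[0, T] `*` `[0, 1] : set (R * R)),
     continuous (fun p : R * R => complex.Im (g p.1 p.2))}.

(* For a set I of pairs of orders which contains (0, 0) and is closed under
   decreasing either order: the partial derivatives of g of order m in t and l
   in x, for I m l, exist and are continuous on [0, T] x [0, 1]; D m l is that
   derivative, the differentiations being performed in any order. *)
Definition smooth2 (R : realType) (T : R) (I : nat -> nat -> bool)
    (g : R -> R -> R[i]) : Prop :=
  exists D : nat -> nat -> R -> R -> R[i],
    [/\ forall t x, t \in `[0, T] -> x \in `[0, 1] -> D 0%N 0%N t x = g t x,
        forall m l, I m l -> ccontinuous2 T (D m l),
        forall m l, I m.+1 l -> forall t x, t \in `[0, T] -> x \in `[0, 1] ->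
          is_cderiv T (fun s => D m l s x) t (D m.+1 l t x) &
        forall m l, I m l.+1 -> forall t x, t \in `[0, T] -> x \in `[0, 1] ->
          is_cderiv 1 (D m l t) x (D m l.+1 t x)].

Definition C1_time (R : realType) (T : R) (a : R -> R) : Prop :=
  exists a' : R -> R,
    {within `[0, T], continuous a'} /\
    forall t, t \in `[0, T] -> is_rderiv T a t (a' t).

(* The derivatives which occur in Xi0 and Xi1, and the lower ones. *)
Definition orders0 (r m l : nat) : bool :=
  [|| (m <= 1)%N && (l <= r.+1)%N, (m <= 3)%N && (l == 0)%N
    | (m <= 2)%N && (l <= 2)%N].

Definition orders1 (r m l : nat) : bool :=
  [|| orders0 r m l, (m <= 2)%N && (l <= r.+1)%N, (m <= 4)%N && (l == 0)%N
    | (m <= 3)%N && (l <= 2)%N].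

Definition dt (R : realType) (T : R) (m : nat) (u : R -> R -> R[i]) :
    R -> R -> R[i] :=
  fun t x => cderivn T m (fun s => u s x) t.

Definition dx (R : realType) (l : nat) (u : R -> R -> R[i]) : R -> R -> R[i] :=
  fun t => cderivn 1 l (u t).

(* Supremum over [0, T], which is a maximum for continuous g. *)
Definition max_time (R : realType) (T : R) (g : R -> R) : R :=
  sup [set g t | t in `[0, T]].

Definition Xi0 (R : realType) (T : R) (r : nat) (u : R -> R -> R[i]) : R :=
  \sum_(0 <= m < 2) max_time T (fun t => Hnorm r.+1 (dt T m u t))
  + \sum_(2 <= m < 4) max_time T (fun t => L2norm (dt T m u t))
  + max_time T (fun t => L2norm (dt T 2 (dx 2 u) t)).

Definition Xi1 (R : realType) (T : R) (r : nat) (u : R -> R -> R[i]) : R :=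
  Xi0 T r u
  + max_time T (fun t => Hnorm r.+1 (dt T 2 u t))
  + max_time T (fun t => L2norm (dt T 4 u t))
  + max_time T (fun t => L2norm (dt T 3 (dx 2 u) t)).

Definition AK_solution (R : realType) (T : R) (a : R -> R)
    (beta f : R -> R -> R[i]) (u0 : R -> R[i]) (u : R -> R -> R[i]) : Prop :=
  [/\ forall t x, t \in `[0, T] -> x \in `[0, 1] ->
        dt T 1 u t x
        = 'i%C * (a t)%:C * dx 2 u t x + 'i%C * beta t x * u t x + f t x,
      forall t, t \in `[0, T] -> u t 0 = 0,
      forall t, t \in `[0, T] -> dx 1 u t 1 = 0 &
      forall x, x \in `[0, 1] -> u 0 x = u0 x].

Definition crank_nicolson (R : realType) (a : R -> R) (beta f : R -> R -> R[i])
    (N : nat) (t : nat -> R) (Sh : set (R -> R[i])) (uh0 : R -> R[i])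
    (U : nat -> R -> R[i]) : Prop :=
  [/\ forall n, (n <= N)%N -> Sh (U n),
      U 0%N = uh0 &
      forall n, (1 <= n <= N)%N -> forall chi, Sh chi ->
        let AU := fun x => (U n x + U n.-1 x) / 2 in
        let tm := midpoint t n in
        inner (fun x => (U n x - U n.-1 x) / (step t n)%:C) chi
        = - 'i%C * (a tm)%:C * Bform AU chi
          + 'i%C * inner (fun x => beta tm x * AU x) chi
          + inner (f tm) chi].

Definition time_mesh_condition (R : realType) (Cstar : R) (N : nat)
    (t : nat -> R) : Prop :=
  forall n, (1 <= n < N)%N ->
    `|step t n.+1 - step t n|
      <= Cstar * Num.max (step t n ^+ 2) (step t n.+1 ^+ 2).

(* Main.v *)
Require Import Defs.
From HB Require Import structures.
From mathcomp Require Import all_boot all_order all_algebra.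
From mathcomp Require Import all_classical all_reals all_analysis.
From mathcomp Require Import measurable_realfun.
From mathcomp Require Import complex.
From mathcomp Require Import ring lra.
Set Implicit Arguments.
Unset Strict Implicit.
Unset Printing Implicit Defensive.
Import Order.TTheory GRing.Theory Num.Theory.
Import numFieldNormedType.Exports.
Local Open Scope classical_set_scope.
Local Open Scope ring_scope.
Local Open Scope complex_scope.

(** Let [W n] be the elliptic projection of the solution at [t n]. The error is
    split as [U n - u (t n) = theta n + rho n] with [theta n = U n - W n] in the
    finite element space and [rho n = W n - u (t n)].

    The projection error [rho n] is of order [h ^ r] in H^1 because the elliptic
    projection is the best approximation in the seminorm, and of order
    [h ^ r.+1] in L^2 by duality ([ritz_error_H1], [ritz_error_L2]). The
    projection is linear, so the same bounds hold for the difference quotients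
    of [rho].

    The error [theta] satisfies the scheme itself, with the source
    [omega1 + i a tau] ([error_step]). Here [tau] compares the average of
    [u_xx] over the end points of a step with its value at the midpoint, and
    [omega1] consists of [rho], of its difference quotient and of the analogous
    differences for [u] and [u_t]. Both are estimated by Taylor's formula in
    time, applied to the real functions of time obtained by pairing with a fixed
    function of L^2 ([average_midpoint], [central_difference]).

    In L^2, the scheme is tested with the average of [theta] over the step. The
    second order term is purely imaginary and drops out, and the discrete
    Gronwall inequality concludes ([step_L2_stable], [L2_error]).

    In H^1, the scheme is tested with [i de], where [de] is the difference
    quotient of [theta]. With [g = beta A theta - i omega1], where [A theta] is
    the average, the result is that [a] times the difference quotient of
    [|theta|_1 ^ 2 / 2] is the real part of the scalar product of [g + a tau]
    with [de] ([step_H1_energy]). The two terms are treated differently.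
    - [g] belongs to H^1 and vanishes at 0. It may be replaced by its L^2
      projection [p] on the finite element space, and the scheme tested with [p]
      eliminates [de], at the cost of [|p|_1], which is bounded by [|g|_1] thanks
      to the inverse inequality ([L2proj_H1_stable]).
    - [tau] satisfies no boundary condition, so this is not available. After the
      division by [a], its contribution is
      [2 Re (tau, theta n.+1 - theta n)], which is summed by parts in time: the
      scalar product of [tau] with [theta] enters a modified energy [Fn], and
      the differences of [tau] between consecutive steps remain. By the mesh
      condition they are of order [k ^ 2] times the length of the two steps
      ([average_midpoint_diff], [tau_diff], [energy_rec]).

    Functions of H^1 are handled as pairs [wd v g]: [g] is in L^2 and [v] is a
    primitive of [g]. The product rule [wdrM] gives integration by parts, and
    Lebesgue's differentiation theorem shows that the pointwise derivative
    [cderiv 1 v] agrees with [g] almost everywhere ([wd_ae]), so that the norms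
    and forms of the statement can be computed with [g]. *)

(** * Square integrable functions and the real scalar product *)

Section RealL2.
Context {R : realType}.
Notation mu := (@lebesgue_measure R).
Notation D := (`]0, 1[%classic : set R).
Implicit Types g k b : R -> R.

Definition intg (A : set (measurableTypeR R)) g := mu.-integrable A (EFin \o g).

Definition sqint g :=
  measurable_fun D g /\ intg D (fun x => g x ^+ 2).

Lemma muD_lty : (mu D < +oo)%E.
Proof. by rewrite lebesgue_measure_itv/= lte_fin ltr01 oppr0 adde0 ltry. Qed.

Lemma Rint_unit (c : R) : \int[mu]_(x in D) c = c.
Proof.
rewrite Rintegral_cst//.
have mE : mu D = 1%E by rewrite lebesgue_measure_itv/= lte_fin ltr01 sube0.
by transitivity (c * fine 1%E); [congr (_ * fine _)|rewrite mulr1].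
Qed.

Lemma intg_le g k : measurable_fun D g -> intg D k ->
  (forall x, D x -> `|g x| <= k x) -> intg D g.
Proof.
move=> mg ik gk; apply: (le_integrable _ _ _ ik) => //.
  exact/measurable_EFinP.
by move=> x Dx /=; rewrite lee_fin (le_trans (gk x Dx))// ler_norm.
Qed.

Lemma intgD (A : set (measurableTypeR R)) g k : measurable A -> intg A g -> intg A k ->
  intg A (fun x => g x + k x).
Proof. by move=> mA ig ik; have := integrableD mA ig ik; apply: eq_integrable. Qed.

Lemma intgZ (A : set (measurableTypeR R)) (c : R) g : measurable A -> intg A g ->
  intg A (fun x => c * g x).
Proof. by move=> mA ig; have := integrableZl mA c ig; apply: eq_integrable. Qed.

Lemma intgB (A : set (measurableTypeR R)) g k : measurable A -> intg A g -> intg A k ->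
  intg A (fun x => g x - k x).
Proof. by move=> mA ig ik; have := integrableB mA ig ik; apply: eq_integrable. Qed.

Lemma sqintM g k : sqint g -> sqint k -> intg D (fun x => g x * k x).
Proof.
move=> [mg ig] [mk ik].
apply: (@intg_le _ (fun x => g x ^+ 2 + k x ^+ 2)).
- exact: measurable_funM.
- exact: intgD.
- move=> x _; rewrite normrM -(real_normK (num_real (g x))) -(real_normK (num_real (k x))).
  have := sqr_ge0 (`|g x| - `|k x|); have := normr_ge0 (g x); have := normr_ge0 (k x).
  nra.
Qed.

Lemma sqintD g k : sqint g -> sqint k -> sqint (fun x => g x + k x).
Proof.
move=> sg sk; have igk := sqintM sg sk; move: sg sk => [mg ig] [mk ik].
split; first exact: measurable_funD.
suff -> : (fun x => (g x + k x) ^+ 2) =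
  (fun x => (g x ^+ 2 + k x ^+ 2) + 2 * (g x * k x)).
  by apply: intgD => //; [exact: intgD | exact: intgZ].
by apply/funext => x; ring.
Qed.

Lemma sqintZ c g : sqint g -> sqint (fun x => c * g x).
Proof.
move=> [mg ig]; split.
  by apply: measurable_funM => //; exact: measurable_cst.
suff -> : (fun x => (c * g x) ^+ 2) = (fun x => c ^+ 2 * g x ^+ 2) by exact: intgZ.
by apply/funext => x; ring.
Qed.

Lemma sqint_bnd b g M : measurable_fun D b -> (forall x, D x -> `|b x| <= M) ->
  sqint g -> sqint (fun x => b x * g x).
Proof.
move=> mb bM [mg ig]; split; first exact: measurable_funM.
apply: (@intg_le _ (fun x => M ^+ 2 * g x ^+ 2)) => //.
- by apply: measurable_funX; exact: measurable_funM.
- exact: intgZ.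
- move=> x Dx; rewrite normrX normrM exprMn -(real_normK (num_real (g x))).
  by rewrite ler_wpM2r ?sqr_ge0// lerXn2r ?nnegrE ?(le_trans _ (bM x Dx)) ?bM.
Qed.

Lemma sqint_cst c : sqint (fun=> c).
Proof.
split; first exact: measurable_cst.
apply: measurable_bounded_integrable => //; [exact: muD_lty|].
exists (`|c| ^+ 2); split; rewrite ?num_real// => M cM x _ /=; by rewrite normrX ltW.
Qed.

Lemma sqint_of_bnd b M : measurable_fun D b -> (forall x, D x -> `|b x| <= M) ->
  sqint b.
Proof.
move=> mb bM; have := sqint_bnd mb bM (sqint_cst 1).
by congr sqint; apply/funext => x; rewrite mulr1.
Qed.

Lemma sqint_intg g : sqint g -> intg D g.
Proof.
move=> sg; have := sqintM sg (sqint_cst 1).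
by congr intg; apply/funext => x; rewrite mulr1.
Qed.

Lemma sqintN g : sqint g -> sqint (fun x => - g x).
Proof.
move=> /(sqintZ (-1)); congr sqint.
by apply/funext => x; rewrite mulN1r.
Qed.

Lemma sqintB g k : sqint g -> sqint k -> sqint (fun x => g x - k x).
Proof. by move=> sg sk; apply: sqintD => //; exact: sqintN. Qed.

End RealL2.

Section InnerProduct.
Context {R : realType}.
Notation mu := (@lebesgue_measure R).
Notation D := (`]0, 1[%classic : set R).
Notation V := (R -> R[i]).
Implicit Types f g w : V.

(** The real part of the complex scalar product. It is bilinear over R, which is
    all that energy arguments use; the complex equations of the scheme are
    recovered by testing with [phi] and with [J * phi]. *)
Definition ip f g : R :=
  \int[mu]_(x in D) (complex.Re (f x) * complex.Re (g x)
                     + complex.Im (f x) * complex.Im (g x)).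

(** Scalars act on functions through pointwise multiplication by [K c] and by
    [J], so that vector identities are identities of the ring of functions. *)
Definition K (c : R) : V := fun=> c%:C.
Definition J : V := fun=> 'i%C.

Lemma normc_sq (z : R[i]) :
  Normc.normc z ^+ 2 = complex.Re z * complex.Re z + complex.Im z * complex.Im z.
Proof. by case: z => a b /=; rewrite sqr_sqrtr ?addr_ge0 ?sqr_ge0// !expr2. Qed.

Lemma normc_ge0 (z : R[i]) : 0 <= Normc.normc z.
Proof. by case: z => a b; apply: sqrtr_ge0. Qed.

Lemma ReD (x y : R[i]) : complex.Re (x + y) = complex.Re x + complex.Re y.
Proof. by case: x y => ? ? []. Qed.

Lemma ImD (x y : R[i]) : complex.Im (x + y) = complex.Im x + complex.Im y.
Proof. by case: x y => ? ? []. Qed.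

Lemma ReN (x : R[i]) : complex.Re (- x) = - complex.Re x. Proof. by case: x. Qed.

Lemma ImN (x : R[i]) : complex.Im (- x) = - complex.Im x. Proof. by case: x. Qed.

Lemma ReK (c : R) (x : R[i]) : complex.Re (c%:C * x) = c * complex.Re x.
Proof. by case: x => ? ? /=; ring. Qed.

Lemma ImK (c : R) (x : R[i]) : complex.Im (c%:C * x) = c * complex.Im x.
Proof. by case: x => ? ? /=; ring. Qed.

Lemma inL2P f : inL2 f <->
  sqint (fun x => complex.Re (f x)) /\ sqint (fun x => complex.Im (f x)).
Proof.
split=> [[mr mi ifx]|[[mr ir] [mi ii]]].
  split; split=> //; apply: (intg_le _ ifx) => //;
    (try exact: measurable_funX) => x _;
    by rewrite normc_sq -!expr2 normrX real_normK ?num_real// ?lerDl ?lerDr sqr_ge0.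
split=> //.
have -> : (fun x => (Normc.normc (f x) ^+ 2)%:E) =
   EFin \o (fun x => complex.Re (f x) ^+ 2 + complex.Im (f x) ^+ 2).
  by apply/funext => x /=; rewrite normc_sq !expr2.
exact: intgD.
Qed.

Lemma ip_intg f g : inL2 f -> inL2 g ->
  intg D (fun x => complex.Re (f x) * complex.Re (g x)
                   + complex.Im (f x) * complex.Im (g x)).
Proof.
move=> /inL2P[fr fi] /inL2P[gr gi].
by apply: intgD => //; exact: sqintM.
Qed.

Lemma L2D f g : inL2 f -> inL2 g -> inL2 (f + g).
Proof.
move=> /inL2P[fr fi] /inL2P[gr gi]; apply/inL2P.
split; [have := sqintD fr gr|have := sqintD fi gi]; congr sqint;
  apply/funext => x; rewrite !fctE; by case: (f x) (g x) => a b [].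
Qed.

Lemma L2_bndM f (b : V) M : measurable_fun D (fun x => complex.Re (b x)) ->
  measurable_fun D (fun x => complex.Im (b x)) ->
  (forall x, D x -> Normc.normc (b x) <= M) ->
  inL2 f -> inL2 (b * f).
Proof.
move=> mbr mbi bM /inL2P[fr fi].
have brM x : D x -> `|complex.Re (b x)| <= M.
  move=> Dx; apply: le_trans (bM x Dx); case: (b x) => a c /=.
  by rewrite -sqrtr_sqr ler_wsqrtr// lerDl sqr_ge0.
have biM x : D x -> `|complex.Im (b x)| <= M.
  move=> Dx; apply: le_trans (bM x Dx); case: (b x) => a c /=.
  by rewrite -[`|c|]sqrtr_sqr ler_wsqrtr// lerDr sqr_ge0.
apply/inL2P; split.
  have := sqintB (sqint_bnd mbr brM fr) (sqint_bnd mbi biM fi).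
  congr sqint; apply/funext => x; rewrite !fctE.
  by case: (b x) (f x) => a c [].
have := sqintD (sqint_bnd mbr brM fi) (sqint_bnd mbi biM fr).
congr sqint; apply/funext => x; rewrite !fctE.
by case: (b x) (f x) => a c [].
Qed.

Lemma L2_cstM (c : R[i]) f : inL2 f -> inL2 ((fun=> c) * f).
Proof.
move=> lf; apply: (@L2_bndM _ _ (Normc.normc c)) => //; exact: measurable_cst.
Qed.

Lemma L2K c f : inL2 f -> inL2 (K c * f). Proof. exact: L2_cstM. Qed.
Lemma L2J f : inL2 f -> inL2 (J * f). Proof. exact: L2_cstM. Qed.

Lemma L2N f : inL2 f -> inL2 (- f).
Proof.
move=> /(L2_cstM (-1)); congr inL2; apply/funext => x; rewrite !fctE; ring.
Qed.

Lemma L2B f g : inL2 f -> inL2 g -> inL2 (f - g).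
Proof. by move=> lf lg; apply: L2D => //; exact: L2N. Qed.

Lemma L20 : inL2 (0 : V).
Proof. by apply/inL2P; split; exact: sqint_cst. Qed.

Lemma ip_sym f g : ip f g = ip g f.
Proof. by apply: eq_Rintegral => x _; ring. Qed.

Lemma ipDl f g w : inL2 f -> inL2 g -> inL2 w -> ip (f + g) w = ip f w + ip g w.
Proof.
move=> lf lg lw; rewrite /ip -RintegralD//; try exact: ip_intg.
apply: eq_Rintegral => x _; rewrite !fctE; case: (f x) (g x) (w x) => a b [c d] [e k] /=.
ring.
Qed.

Lemma ipZl c f w : inL2 f -> inL2 w -> ip (K c * f) w = c * ip f w.
Proof.
move=> lf lw; rewrite /ip -RintegralZl//; try exact: ip_intg.
apply: eq_Rintegral => x _; rewrite !fctE /K; case: (f x) (w x) => a b [e k] /=.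
ring.
Qed.

Lemma KN1 f : - f = K (-1) * f.
Proof. by apply/funext => x; rewrite !fctE /K rmorphN1; ring. Qed.

Lemma ipNl f w : inL2 f -> inL2 w -> ip (- f) w = - ip f w.
Proof. by move=> lf lw; rewrite KN1 ipZl// mulN1r. Qed.

Lemma ipBl f g w : inL2 f -> inL2 g -> inL2 w -> ip (f - g) w = ip f w - ip g w.
Proof. by move=> lf lg lw; rewrite ipDl ?ipNl//; exact: L2N. Qed.

Lemma ipDr f g w : inL2 f -> inL2 g -> inL2 w -> ip w (f + g) = ip w f + ip w g.
Proof. by move=> *; rewrite ip_sym ipDl// ![ip _ w]ip_sym. Qed.

Lemma ipBr f g w : inL2 f -> inL2 g -> inL2 w -> ip w (f - g) = ip w f - ip w g.
Proof. by move=> *; rewrite ip_sym ipBl// ![ip _ w]ip_sym. Qed.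

Lemma ipNr f w : inL2 f -> inL2 w -> ip w (- f) = - ip w f.
Proof. by move=> *; rewrite ip_sym ipNl// ip_sym. Qed.

Lemma ipZr c f w : inL2 f -> inL2 w -> ip w (K c * f) = c * ip w f.
Proof. by move=> *; rewrite ip_sym ipZl// ip_sym. Qed.

Lemma ipJJ f g : ip (J * f) (J * g) = ip f g.
Proof.
apply: eq_Rintegral => x _; rewrite !fctE /J; case: (f x) (g x) => a b [c d] /=.
ring.
Qed.

Lemma ipJl f g : ip (J * f) g = ip f (- (J * g)).
Proof.
apply: eq_Rintegral => x _; rewrite !fctE /J; case: (f x) (g x) => a b [c d] /=.
ring.
Qed.

(** Multiplication by the imaginary unit is skew-symmetric for [ip]: this is
    the conservation law behind both stability estimates. *)
Lemma ipJ0 f : inL2 f -> ip (J * f) f = 0.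
Proof.
move=> lf; have := ipJl f f; rewrite ipNr//; last exact: L2J.
by rewrite (ip_sym f) => h; lra.
Qed.

Lemma ip_ge0 f : 0 <= ip f f.
Proof. by apply: Rintegral_ge0 => x _; rewrite -!expr2 addr_ge0 ?sqr_ge0. Qed.

Lemma L2norm_sq f : L2norm f ^+ 2 = ip f f.
Proof.
rewrite /L2norm sqr_sqrtr; last by apply: Rintegral_ge0 => x _; rewrite sqr_ge0.
by apply: eq_Rintegral => x _; rewrite normc_sq.
Qed.

Lemma L2norm_ge0 f : 0 <= L2norm f.
Proof. exact: sqrtr_ge0. Qed.

Lemma ip_CS f g : inL2 f -> inL2 g -> ip f g <= L2norm f * L2norm g.
Proof.
move=> lf lg.
have key s t : 0 <= s ^+ 2 * ip f f - 2 * s * t * ip f g + t ^+ 2 * ip g g.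
  have := ip_ge0 (K s * f - K t * g).
  have lsf : inL2 (K s * f) by exact: L2K.
  have ltg : inL2 (K t * g) by exact: L2K.
  rewrite ipBl ?ipBr ?ipZl ?ipZr//; try exact: L2B.
  by rewrite (ip_sym g f) => h; lra.
have := key (L2norm g) (L2norm f).
rewrite -!L2norm_sq.
have [f0|f0] := eqVneq (L2norm f) 0.
  move=> _; rewrite f0 mul0r leNgt; apply/negP => c0.
  (* with f of norm 0 the form is affine in s; this s makes it equal to -1 *)
  have := key ((ip g g + 1) / (2 * ip f g)) 1.
  rewrite -(L2norm_sq f) f0 expr0n/= mulr0 add0r expr1n mul1r.
  rewrite [X in X + _](_ : _ = - (ip g g + 1)); last by field; rewrite gt_eqF.
  by lra.
have [g0|g0] := eqVneq (L2norm g) 0.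
  move=> _; rewrite g0 mulr0 leNgt; apply/negP => c0.
  (* the same with the roles of f and g exchanged *)
  have := key 1 ((ip f f + 1) / (2 * ip f g)).
  rewrite -(L2norm_sq g) g0 expr0n/= mulr0 addr0 expr1n mul1r.
  rewrite [X in _ - X](_ : _ = ip f f + 1); last by field; rewrite gt_eqF.
  by lra.
have f1 : 0 < L2norm f by rewrite lt_def f0 L2norm_ge0.
have g1 : 0 < L2norm g by rewrite lt_def g0 L2norm_ge0.
have p : 0 < L2norm f * L2norm g by exact: mulr_gt0.
set a := L2norm f in f1 p *; set b := L2norm g in g1 p *.
move=> h; have : 0 <= (a * b) * (a * b - ip f g) by nra.
by rewrite pmulr_rge0// subr_ge0.
Qed.

Lemma L2normK c f : inL2 f -> L2norm (K c * f) = `|c| * L2norm f.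
Proof.
move=> lf; apply/eqP; rewrite -(@eqrXn2 _ 2%N) ?mulr_ge0 ?L2norm_ge0//.
rewrite exprMn !L2norm_sq ipZl ?ipZr ?real_normK ?num_real//; try exact: L2K.
by apply/eqP; ring.
Qed.

Lemma L2normN f : inL2 f -> L2norm (- f) = L2norm f.
Proof. by move=> lf; rewrite KN1 L2normK// normrN1 mul1r. Qed.

Lemma L2normJ f : inL2 f -> L2norm (J * f) = L2norm f.
Proof.
move=> lf; apply/eqP; rewrite -(@eqrXn2 _ 2%N) ?L2norm_ge0//.
by rewrite !L2norm_sq ipJJ.
Qed.

Lemma ip_CSn f g : inL2 f -> inL2 g -> `|ip f g| <= L2norm f * L2norm g.
Proof.
move=> lf lg; rewrite ler_norml ip_CS// andbT lerNl -ipNl//.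
by rewrite -(L2normN lf) ip_CS//; exact: L2N.
Qed.

Lemma L2normD f g : inL2 f -> inL2 g -> L2norm (f + g) <= L2norm f + L2norm g.
Proof.
move=> lf lg; rewrite -(@ler_pXn2r _ 2%N) ?nnegrE ?addr_ge0 ?L2norm_ge0//.
rewrite L2norm_sq ipDl ?ipDr//; try exact: L2D.
rewrite (ip_sym g f) -!L2norm_sq; have := ip_CS lf lg; lra.
Qed.

Lemma L2normB f g : inL2 f -> inL2 g -> L2norm (f - g) <= L2norm f + L2norm g.
Proof. by move=> lf lg; rewrite -(L2normN lg) L2normD//; exact: L2N. Qed.

(** Reduces a bound in L^2 to bounds on real numbers, so that Taylor's formula
    is only needed for real functions of time. *)
Lemma L2norm_le_dual f M : inL2 f -> 0 <= M ->
  (forall w, inL2 w -> ip f w <= M * L2norm w) -> L2norm f <= M.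
Proof.
move=> lf M0 /(_ f lf); rewrite -L2norm_sq expr2.
have [->//|f0] := eqVneq (L2norm f) 0.
by rewrite ler_pM2r// lt_def f0 L2norm_ge0.
Qed.

Lemma L2norm_le_ip f g : inL2 f -> inL2 g -> ip f f = ip f g ->
  L2norm f <= L2norm g.
Proof.
move=> lf lg E; have := ip_CS lf lg; rewrite -E -L2norm_sq expr2.
have [->|f0] := eqVneq (L2norm f) 0; first by rewrite L2norm_ge0.
by rewrite ler_pM2l// lt_def f0 L2norm_ge0.
Qed.

Lemma L2norm_bndM f (b : V) M : measurable_fun D (fun x => complex.Re (b x)) ->
  measurable_fun D (fun x => complex.Im (b x)) -> 0 <= M ->
  (forall x, D x -> Normc.normc (b x) <= M) ->
  inL2 f -> L2norm (b * f) <= M * L2norm f.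
Proof.
move=> mbr mbi M0 bM lf.
have lbf : inL2 (b * f) by exact: (L2_bndM mbr mbi bM lf).
rewrite -(@ler_pXn2r _ 2%N) ?nnegrE ?mulr_ge0 ?L2norm_ge0//.
rewrite exprMn !L2norm_sq /ip -RintegralZl//; last exact: ip_intg.
apply: le_Rintegral => //; first exact: ip_intg.
  by apply: intgZ => //; exact: ip_intg.
move=> x Dx; rewrite -!normc_sq !fctE Normc.normcM exprMn ler_wpM2r ?sqr_ge0//.
by rewrite lerXn2r ?nnegrE ?normc_ge0 ?bM//.
Qed.

Lemma eq_ip f f' g g' : (forall x, D x -> f x = f' x) ->
  (forall x, D x -> g x = g' x) -> ip f g = ip f' g'.
Proof. by move=> ff gg; apply: eq_Rintegral => x /set_mem Dx; rewrite ff ?gg. Qed.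

Lemma eq_L2norm f f' : (forall x, D x -> f x = f' x) -> L2norm f = L2norm f'.
Proof. by move=> ff; congr Num.sqrt; apply: eq_Rintegral => x /set_mem Dx; rewrite ff. Qed.

Lemma eq_inL2 f f' : (forall x, D x -> f x = f' x) -> inL2 f -> inL2 f'.
Proof.
move=> ff [m1 m2 i]; split.
- by apply: eq_measurable_fun m1 => x /set_mem Dx; rewrite ff.
- by apply: eq_measurable_fun m2 => x /set_mem Dx; rewrite ff.
- by move: i; apply: eq_integrable => // x /set_mem Dx; rewrite ff.
Qed.

End InnerProduct.

(** * Integrals of functions that agree almost everywhere *)

Section AlmostEverywhere.
Context {R : realType}.
Notation mu := (@lebesgue_measure R).
Local Open Scope ereal_scope.
Import HBNNSimple.

(** Holds for arbitrary functions because a simple function below [f], set to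
    zero on the null set, lies below [g] and has the same integral. *)
Let ge0_integral_ae_le (N : set (measurableTypeR R)) (f g : R -> \bar R) :
  measurable N -> mu N = 0 -> (forall x, 0 <= f x) -> (forall x, 0 <= g x) ->
  (forall x, ~ N x -> f x = g x) ->
  \int[mu]_x f x <= \int[mu]_x g x.
Proof.
move=> mN N0 f0 g0 fg; rewrite ge0_integralTE// ge0_integralTE//.
apply: ge_ereal_sup => _ [h /= hf <-].
have mCN : measurable (~` N) by exact: measurableC.
pose h' := proj_nnsfun h mCN.
apply: ereal_sup_ubound; exists h'.
  move=> x /=; rewrite mindicE; have [xN|xN] := boolP (x \in ~` N).
    by rewrite /= mulr1 -fg ?hf//; move: xN; rewrite inE.
  by rewrite /= mulr0.
rewrite -!integralT_nnsfun; apply: ge0_ae_eq_integral => //.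
- exact/measurable_EFinP.
- exact/measurable_EFinP.
- by move=> x _; rewrite lee_fin.
- by move=> x _; rewrite lee_fin.
- exists N; split=> // x /= /not_implyP[_ hx]; apply: contrapT => xN; apply: hx.
  by rewrite /h' /= mindicE mem_set// mulr1.
Qed.

(** Used for the pointwise derivative [cderiv], which has a default value on a
    null set and hence no evident measurability. *)
Lemma integral_ae (A : set (measurableTypeR R)) (f g : R -> \bar R) :
  {ae mu, forall x, A x -> f x = g x} ->
  \int[mu]_(x in A) f x = \int[mu]_(x in A) g x.
Proof.
move=> [N [mN N0 fgN]]; rewrite integral_mkcond [RHS]integral_mkcond.
have fg x : ~ N x -> (f \_ A) x = (g \_ A) x.
  move=> Nx; rewrite !patchE; case: ifPn => // /set_mem Ax.
  by apply: contrapT => ne; apply: Nx; apply: fgN => /= /(_ Ax).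
rewrite integralE [RHS]integralE; congr (_ - _); apply/eqP; rewrite eq_le;
  apply/andP; split; apply: (ge0_integral_ae_le mN N0) => // x Nx;
  by rewrite ?funeposE ?funenegE fg.
Qed.

Lemma Rintegral_ae (A : set (measurableTypeR R)) (f g : R -> R) :
  {ae mu, forall x, A x -> f x = g x} ->
  (\int[mu]_(x in A) f x = \int[mu]_(x in A) g x)%R.
Proof.
by move=> fg; congr fine; apply: integral_ae; apply: filterS fg => x fg Ax; rewrite fg.
Qed.

End AlmostEverywhere.

(** * Derivatives relative to a closed interval *)

Section OneSidedDerivative.
Context {R : realType}.
Implicit Types f g v : R -> R.

(** The form without division also allows [y = x], so that sums and products
    with constants need no case distinction. *)
Lemma rderivP (b : R) f x l : is_rderiv b f x l <->
  forall e, 0 < e -> exists2 d, 0 < d & forall y, y \in `[0, b] -> `|y - x| < d ->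
    `|f y - f x - l * (y - x)| <= e * `|y - x|.
Proof.
have E y : y != x ->
    f y - f x - l * (y - x) = ((f y - f x) / (y - x) - l) * (y - x).
  by move=> yx; field; rewrite subr_eq0.
rewrite /is_rderiv; split=> [/cvgrPdist_le fl e e0|fl].
  have /= [d /= d0 H] := fl _ e0.
  exists d => // y yb yxd; have [->|yx] := eqVneq y x.
    by rewrite !subrr mulr0 subr0 normr0 mulr0.
  rewrite E// normrM ler_pM2r ?normr_gt0 ?subr_eq0// distrC.
  by apply: H => //; rewrite /ball_/= distrC.
apply/cvgrPdist_le => e e0; have [d d0 H] := fl _ e0.
exists d => //= y; rewrite /ball_/= distrC => yxd yx yb.
have := H y yb yxd.
by rewrite E// normrM ler_pM2r ?normr_gt0 ?subr_eq0// distrC.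
Qed.

Lemma near_itv_proper (b x : R) : 0 < b -> x \in `[0, b] ->
  ProperFilter (within `[0, b] x^').
Proof.
move=> b0; rewrite in_itv/= => /andP[x0 xb].
apply: Build_ProperFilter_ex => P [d /= d0 H].
have [xb'|xb'] := ltP x b.
  pose y := x + Num.min (d / 2) (b - x).
  have m0 : 0 < Num.min (d / 2) (b - x) by rewrite lt_min divr_gt0//= subr_gt0.
  exists y; apply: H; rewrite /y ?/ball_/=.
  - rewrite opprD addrA subrr sub0r normrN gtr0_norm//.
    by rewrite gt_min (_ : d / 2 < d)//; lra.
  - by rewrite -subr_eq0 addrC addKr gt_eqF.
  - rewrite in_itv/= addr_ge0 ?(ltW m0)//= -lerBrDl ge_min lexx orbT//.
have xE : x = b by apply/eqP; rewrite eq_le xb xb'.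
rewrite {}xE {xb xb' x0} in H.
have m0 : 0 < Num.min (d / 2) b by rewrite lt_min divr_gt0.
exists (b - Num.min (d / 2) b); apply: H; rewrite ?/ball_/=.
- by rewrite subKr gtr0_norm// gt_min (_ : d / 2 < d)//; lra.
- by rewrite -subr_eq0 addrAC subrr sub0r oppr_eq0 gt_eqF.
- by rewrite in_itv/= subr_ge0 ge_min lexx orbT /= gerBl ltW.
Qed.

Lemma rderiv_unique (b x : R) f l l' : 0 < b -> x \in `[0, b] ->
  is_rderiv b f x l -> is_rderiv b f x l' -> l = l'.
Proof.
move=> b0 xb; have PF := near_itv_proper b0 xb.
by apply: cvg_unique; exact: Rhausdorff.
Qed.

Lemma rderivE (b x : R) f l : 0 < b -> x \in `[0, b] ->
  is_rderiv b f x l -> rderiv b f x = l.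
Proof.
move=> b0 xb fl; have PF := near_itv_proper b0 xb.
by apply/cvg_lim => //; exact: Rhausdorff.
Qed.

Lemma is_rderiv_ext (b x : R) f g l : x \in `[0, b] ->
  (forall y, y \in `[0, b] -> f y = g y) -> is_rderiv b f x l -> is_rderiv b g x l.
Proof.
move=> xb fg /rderivP fl; apply/rderivP => e e0.
have [d d0 H] := fl _ e0; exists d => // y yb.
by rewrite -!fg//; exact: H.
Qed.

Lemma rderiv_ext (b x : R) f g : x \in `[0, b] ->
  (forall y, y \in `[0, b] -> f y = g y) -> rderiv b f x = rderiv b g x.
Proof.
move=> xb fg; rewrite /rderiv; congr (lim _); apply/seteqP; split=> P;
  rewrite /= /nbhs/= => -[d /= d0 H]; exists d => // y yd yx yb;
  have := H y yd yx yb; by rewrite /= !fg.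
Qed.

Lemma is_rderivD (b x : R) f g l m : is_rderiv b f x l -> is_rderiv b g x m ->
  is_rderiv b (fun y => f y + g y) x (l + m).
Proof.
move=> /rderivP fl /rderivP gm; apply/rderivP => e e0.
have e20 : 0 < e / 2 by rewrite divr_gt0.
have [d d0 H] := fl _ e20; have [d' d'0 H'] := gm _ e20.
exists (Num.min d d'); first by rewrite lt_min d0.
move=> y yb; rewrite lt_min => /andP[yd yd'].
rewrite [X in `|X|](_ : _ = (f y - f x - l * (y - x)) + (g y - g x - m * (y - x)));
  last by ring.
by rewrite (le_trans (ler_normD _ _))// [e]splitr mulrDl lerD ?H ?H'.
Qed.

Lemma is_rderivZ (b x c : R) f l : is_rderiv b f x l ->
  is_rderiv b (fun y => c * f y) x (c * l).
Proof.
move=> /rderivP fl; apply/rderivP => e e0.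
have c0 : 0 < `|c| + 1 by rewrite ltr_wpDl.
have ec0 : 0 < e / (`|c| + 1) by rewrite divr_gt0.
have [d d0 H] := fl _ ec0; exists d => // y yb yd.
rewrite [X in `|X|](_ : _ = c * (f y - f x - l * (y - x))); last by ring.
rewrite normrM (le_trans (ler_wpM2l _ (H y yb yd)))// mulrA ler_wpM2r//.
by rewrite mulrCA ger_pMr// ler_pdivrMr// mul1r lerDl.
Qed.

Lemma is_rderiv_cst (b x c : R) : is_rderiv b (fun=> c) x 0.
Proof.
apply/rderivP => e e0; exists 1 => // y _ _.
by rewrite subrr mul0r subr0 normr0 mulr_ge0// ltW.
Qed.

Lemma rderiv_cont (b x : R) f l : is_rderiv b f x l ->
  forall e, 0 < e -> exists2 d, 0 < d & forall y, y \in `[0, b] -> `|y - x| < d ->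
    `|f y - f x| <= e.
Proof.
move=> /rderivP fl e e0; have [d d0 H] := fl _ ltr01.
have k0 : 0 < `|l| + 1 by rewrite ltr_wpDl.
exists (Num.min d (e / (`|l| + 1))); first by rewrite lt_min d0 divr_gt0.
move=> y yb; rewrite lt_min => /andP[yd yl].
have := H y yb yd; rewrite mul1r => h.
rewrite -[f y - f x](subrK (l * (y - x))) (le_trans (ler_normD _ _))//.
rewrite normrM; move: yl; rewrite ltr_pdivlMr//; lra.
Qed.

Lemma within_itvP (a b : R) f :
  {within `[a, b], continuous f} <->
  (forall x, x \in `[a, b] -> forall e, 0 < e ->
    exists2 d, 0 < d & forall y, y \in `[a, b] -> `|y - x| < d -> `|f y - f x| <= e).
Proof.
split=> [/subspace_continuousP fc x xab e e0|fc].
  have /cvgrPdist_le /(_ e e0) [d /= d0 H] := fc x xab.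
  exists d => // y yab yx; rewrite distrC; apply: H => //.
  by rewrite /ball_/= distrC.
apply/subspace_continuousP => x xab; apply/cvgrPdist_le => e e0.
have [d d0 H] := fc x xab e e0; exists d => // y /=; rewrite distrC => yx yab.
by rewrite distrC H.
Qed.

Lemma rderiv_within (b c d : R) f f' : 0 <= c -> d <= b ->
  (forall x, x \in `[0, b] -> is_rderiv b f x (f' x)) ->
  {within `[c, d], continuous f}.
Proof.
move=> c0 db fd; apply/within_itvP => x.
have sub z : z \in `[c, d] -> z \in `[0, b].
  by rewrite !in_itv/= => /andP[? ?]; apply/andP; split; lra.
move=> /sub xb e e0; have [r r0 H] := rderiv_cont (fd x xb) e0.
by exists r => // y /sub yb; exact: H.
Qed.

Lemma rderiv_derive (b x : R) f l : x \in `]0, b[ ->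
  is_rderiv b f x l <-> is_derive x 1 f l.
Proof.
rewrite in_itv/= => /andP[x0 xb].
have r0 : 0 < Num.min x (b - x) by rewrite lt_min x0 subr_gt0.
have inb y : `|y - x| < Num.min x (b - x) -> y \in `[0, b].
  by rewrite lt_min ltr_norml in_itv/= => /andP[/andP[? ?]]; rewrite ltr_norml => /andP[? ?]; apply/andP; split; lra.
split=> [/rderivP fl|fl].
  have H : (fun h : R => h^-1 *: (f (h *: (1 : R) + x) - f x)) @ 0^' --> l.
    apply/cvgrPdist_le => e e0; have [d d0 H] := fl _ e0.
    exists (Num.min d (Num.min x (b - x))) => /=; first by rewrite lt_min d0.
    move=> h; rewrite /ball_/= sub0r normrN lt_min => /andP[hd hx] h0.
    have hK : h + x - x = h by rewrite addrK.
    have := H (h + x); rewrite hK => /(_ _ hd)/=.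
    rewrite inb ?hK// => /(_ isT).
    rewrite -ler_pdivrMr ?normr_gt0// -normfV -normrM distrC /GRing.scale/= mulr1.
    by congr (`|_| <= _); field.
  split; first by apply/cvg_ex; exists l.
  by apply/cvg_lim => //; exact: Rhausdorff.
apply/rderivP => e e0.
have [/cvg_ex[/= l' hl'] hl] := fl.
have ll : l' = l by rewrite -hl; apply/esym/cvg_lim => //; exact: Rhausdorff.
move: hl'; rewrite ll => /cvgrPdist_le /(_ e e0)[d /= d0 H].
exists d => // y _ yx; have [->|yx0] := eqVneq y x.
  by rewrite !subrr mulr0 subr0 normr0 mulr0.
have := H (y - x); rewrite /ball_/= sub0r normrN subr_eq0 => /(_ yx yx0).
rewrite /GRing.scale/= mulr1 subrK -(@ler_pM2r _ `|y - x|) ?normr_gt0 ?subr_eq0//.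
rewrite -normrM -normrN; congr (`|_| <= _).
by field; rewrite subr_eq0.
Qed.

Lemma rderiv_MVT (b : R) f f' x y : 0 <= x -> x < y -> y <= b ->
  (forall x, x \in `[0, b] -> is_rderiv b f x (f' x)) ->
  exists2 c, c \in `]x, y[ & f y - f x = f' c * (y - x).
Proof.
move=> x0 xy yb fd; apply: MVT => //; last exact: (rderiv_within x0 yb fd).
move=> z; rewrite in_itv/= => /andP[xz zy].
apply/(@rderiv_derive b).
  by rewrite in_itv/=; apply/andP; split; lra.
by apply: fd; rewrite in_itv/=; apply/andP; split; lra.
Qed.

Lemma rderiv0_cst (b : R) f : (forall x, x \in `[0, b] -> is_rderiv b f x 0) ->
  forall x, x \in `[0, b] -> f x = f 0.
Proof.
move=> fd x; rewrite in_itv/= => /andP[].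
rewrite le_eqVlt => /predU1P[<-//|x0 xb].
have [c _] := rderiv_MVT (lexx 0) x0 xb fd.
by rewrite mul0r => /eqP; rewrite subr_eq0 => /eqP.
Qed.

End OneSidedDerivative.

(** * Absolutely continuous real functions *)

Section WeakDerivativeReal.
Context {R : realType}.
Notation mu := (@lebesgue_measure R).
Notation D := (`]0, 1[%classic : set R).
Implicit Types (f g v w k : R -> R).

Lemma intg_sub (A B : set (measurableTypeR R)) g : measurable A -> measurable B ->
  A `<=` B -> intg B g -> intg A g.
Proof. by move=> mA mB AB; apply: integrableS. Qed.

Lemma Rint_subset (A B : set (measurableTypeR R)) g : measurable A -> measurable B ->
  A `<=` B -> intg B g -> (forall x, B x -> 0 <= g x) ->
  \int[mu]_(x in A) g x <= \int[mu]_(x in B) g x.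
Proof.
move=> mA mB AB ig g0; have ig' := intg_sub mA mB AB ig.
rewrite /Rintegral fine_le//.
- exact: integrable_fin_num.
- exact: integrable_fin_num.
- apply: ge0_subset_integral => //; first by case/integrableP: ig.
Qed.

Lemma intg_cc g : intg D g -> intg `[0, 1] g.
Proof.
move=> ig; have [/measurable_EFinP mg _] := integrableP _ _ _ ig.
have mg' : measurable_fun (`[0, 1]%classic : set R) g.
  exact: measurable_fun_itv_cc mg.
apply/integrableP; split; first exact/measurable_EFinP.
move/integrableP: ig => [_]; congr (_ < _)%E.
rewrite -integral_itv_bndo_bndc; last first.
  apply: measurableT_comp => //; apply/measurable_EFinP.
  exact: measurable_fun_itv_co mg.
by rewrite -integral_itv_obnd_cbnd//; apply: measurableT_comp => //; exact/measurable_EFinP.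
Qed.

Lemma intg_oc g x y : 0 <= x -> y <= 1 -> intg D g -> intg `]x, y] g.
Proof.
move=> x0 y1 /intg_cc; apply: intg_sub => // z /=.
by rewrite !in_itv/= => /andP[? ?]; apply/andP; split; lra.
Qed.

Lemma intg_c0 g y : y <= 1 -> intg D g -> intg `[0, y] g.
Proof.
move=> y1 /intg_cc; apply: intg_sub => // z /=.
by rewrite !in_itv/= => /andP[? ?]; apply/andP; split; lra.
Qed.

Lemma itv_oc_sub (x y s e : R) : x <= s -> e <= y -> `]s, e] `<=` `]x, y].
Proof.
move=> xs ey z /=; rewrite !in_itv/= => /andP[sz ze].
by rewrite (le_lt_trans xs sz) (le_trans ze ey).
Qed.

Lemma Rint_incr g x y : intg D g -> 0 <= x -> x <= y -> y <= 1 ->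
  \int[mu]_(t in `[0, y]) g t - \int[mu]_(t in `[0, x]) g t
  = \int[mu]_(t in `]x, y]) g t.
Proof.
move=> ig x0 xy y1; by rewrite Rintegral_itvB ?bnd_simp//; exact: intg_c0.
Qed.

Lemma Rint_cc g : intg D g ->
  \int[mu]_(t in `[0, 1]) g t = \int[mu]_(t in `]0, 1[) g t.
Proof.
move=> ig; have icc := intg_cc ig.
rewrite -Rintegral_itv_obnd_cbnd; last first.
  apply: intg_sub icc => // z /=.
  by rewrite !in_itv/= => /andP[? ?]; apply/andP; split; lra.
by rewrite Rintegral_itv_bndo_bndc.
Qed.

Lemma Rint_len (x y c : R) : x <= y -> \int[mu]_(t in `]x, y]) c = c * (y - x).
Proof.
move=> xy; rewrite Rintegral_cst//; congr (_ * _).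
have mE : mu `]x, y] = (if x < y then (y - x)%:E else 0%E).
  by rewrite lebesgue_measure_itv/= lte_fin.
transitivity (fine (if x < y then (y - x)%:E else 0%E)); first by congr fine.
by move: xy; rewrite le_eqVlt => /predU1P[->|->] //=; rewrite ltxx subrr.
Qed.

Lemma intg_cst (x y c : R) : intg (`]x, y]%classic : set (measurableTypeR R)) (fun=> c).
Proof.
have mE : (mu `]x, y] < +oo)%E.
  by rewrite lebesgue_measure_itv/=; case: ifP => _; rewrite ?ltry.
apply: measurable_bounded_integrable => //.
by exists `|c|; split; rewrite ?num_real// => M cM z _ /=; rewrite ltW.
Qed.

Lemma Rint_bnd g M x y : intg D g -> 0 <= x -> x <= y -> y <= 1 ->
  (forall t, t \in `]x, y] -> `|g t| <= M) ->
  `|\int[mu]_(t in `]x, y]) g t| <= M * (y - x).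
Proof.
move=> ig x0 xy y1 gM; have igxy := intg_oc x0 y1 ig.
apply: le_trans (le_normr_Rintegral _ igxy) _ => //.
rewrite -Rint_len//; apply: le_Rintegral => //.
- exact: integrable_norm.
- exact: intg_cst.
Qed.

(** Cauchy-Schwarz against the constant 1 on a subinterval: the variance of
    [|g|] with respect to its mean [c] is nonnegative. *)
Lemma Rint_CS g x y : sqint g -> 0 <= x -> x <= y -> y <= 1 ->
  (\int[mu]_(t in `]x, y]) `|g t|) ^+ 2 <=
  (y - x) * \int[mu]_(t in `]x, y]) (g t ^+ 2).
Proof.
move=> sg x0; rewrite le_eqVlt => /predU1P[->|xy] y1.
  rewrite subrr mul0r (_ : `]y, y]%classic = set0) ?Rintegral_set0 ?expr0n//.
  by apply/seteqP; split=> z //=; rewrite in_itv/=; lra.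
have ig := intg_oc x0 y1 (sqint_intg sg); have ig2 := intg_oc x0 y1 sg.2.
have iag : intg `]x, y] (fun t => `|g t|) by exact: integrable_norm.
set A := Rintegral _ _ _; set B := Rintegral _ _ _.
pose c := A / (y - x).
have yx : y - x != 0 by rewrite subr_eq0 gt_eqF.
have : 0 <= \int[mu]_(t in `]x, y]) (`|g t| - c) ^+ 2.
  by apply: Rintegral_ge0 => t _; exact: sqr_ge0.
have -> : \int[mu]_(t in `]x, y]) (`|g t| - c) ^+ 2 =
   B + (- (2 * c)) * A + c ^+ 2 * (y - x).
  rewrite -(Rint_len (c ^+ 2) (ltW xy)) -RintegralZl// -!RintegralD//.
  - apply: eq_Rintegral => t _; rewrite sqrrB real_normK ?num_real//; ring.
  - by apply: intgD => //; exact: intgZ.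
  - exact: intg_cst.
  - exact: intgZ.
have -> : B + - (2 * c) * A + c ^+ 2 * (y - x) = B - A ^+ 2 / (y - x).
  by rewrite /c; field.
by rewrite subr_ge0 ler_pdivrMr ?subr_gt0// mulrC.
Qed.

Lemma within_bounded (a b : R) f : a <= b -> {within `[a, b], continuous f} ->
  exists2 M, 0 <= M & forall x, x \in `[a, b] -> `|f x| <= M.
Proof.
move=> ab fc; have [c _ cM] := EVT_max ab fc; have [d _ dm] := EVT_min ab fc.
exists (`|f c| + `|f d|); first by rewrite addr_ge0.
move=> x xb; have := cM x xb; have := dm x xb; rewrite ler_norml.
have := ler_norm (f c); have := ler_norm (- f d); rewrite normrN.
have := normr_ge0 (f c); have := normr_ge0 (f d).
by move=> ? ? ? ? ? ?; apply/andP; split; lra.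
Qed.

Lemma sub_oo_cc x : D x -> x \in `[0, 1].
Proof. by rewrite /= !in_itv/= => /andP[? ?]; apply/andP; split; lra. Qed.

Lemma within_meas f : {within `[0, 1], continuous f} -> measurable_fun D f.
Proof.
move=> fc.
have mf : measurable_fun (`[0, 1]%classic : set R) f.
  exact: subspace_continuous_measurable_fun.
by apply: measurable_funS mf => // x /sub_oo_cc.
Qed.

Lemma within_sqint f : {within `[0, 1], continuous f} -> sqint f.
Proof.
move=> fc; have [M _ fM] := within_bounded ler01 fc.
by apply: (sqint_of_bnd (within_meas fc)) => x /sub_oo_cc; exact: fM.
Qed.

(** [v] belongs to H^1(0, 1) and [g] is a version of its derivative. Keeping [g]
    as an argument makes linear combinations and products explicit. *)
Definition wdr v g := sqint g /\
  forall x, x \in `[0, 1] -> v x = v 0 + \int[mu]_(t in `[0, x]) g t.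

Lemma wdr_incr v g x y : wdr v g -> 0 <= x -> x <= y -> y <= 1 ->
  v y - v x = \int[mu]_(t in `]x, y]) g t.
Proof.
move=> [sg vg] x0 xy y1; rewrite vg; last by rewrite in_itv/=; apply/andP; split; lra.
rewrite (vg x); last by rewrite in_itv/=; apply/andP; split; lra.
rewrite -Rint_incr//; first by ring.
exact: sqint_intg.
Qed.

Lemma wdr_cont v g : wdr v g -> {within `[0, 1], continuous v}.
Proof.
move=> [sg vg].
have := parameterized_integral_continuous ler01 (intg_cc (sqint_intg sg)).
move=> /within_itvP H; apply/within_itvP => x xb e e0.
have [d d0 {}H] := H x xb e e0; exists d => // y yb yx.
have := H y yb yx; rewrite /parameterized_integral vg// (vg x)//.
by congr (`|_| <= _); ring.
Qed.

Lemma wdr_ext v g v' g' : wdr v g -> (forall x, x \in `[0, 1] -> v x = v' x) ->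
  (forall x, x \in `[0, 1] -> g x = g' x) -> wdr v' g'.
Proof.
move=> [sg vg] vv gg; split.
  case: sg => mg ig; split.
    by apply: eq_measurable_fun mg => x /set_mem /sub_oo_cc /gg.
  move: ig; apply: eq_integrable => // x /set_mem /sub_oo_cc /gg.
  by move=> /= ->.
have b0 : (0 : R) \in `[0, 1] by rewrite in_itv/= lexx ler01.
move=> x xb; rewrite -!vv// vg//; congr (_ + _).
apply: eq_Rintegral => y; rewrite inE/= => yx; apply: gg.
by move: xb yx; rewrite !in_itv/= => /andP[? ?] /andP[? ?]; apply/andP; split; lra.
Qed.

Lemma wdrD v g w k : wdr v g -> wdr w k ->
  wdr (fun x => v x + w x) (fun x => g x + k x).
Proof.
move=> [sg vg] [sk wk]; split; first exact: sqintD.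
move=> x xb; rewrite vg// wk//.
have x1 : x <= 1 by move: xb; rewrite in_itv/= => /andP[].
rewrite RintegralD//; first by ring.
  by apply: intg_c0 => //; exact: sqint_intg.
by apply: intg_c0 => //; exact: sqint_intg.
Qed.

Lemma wdrZ v g c : wdr v g -> wdr (fun x => c * v x) (fun x => c * g x).
Proof.
move=> [sg vg]; split; first exact: sqintZ.
move=> x xb; rewrite vg//.
have x1 : x <= 1 by move: xb; rewrite in_itv/= => /andP[].
rewrite RintegralZl//; first by ring.
by apply: intg_c0 => //; exact: sqint_intg.
Qed.

Lemma wdr_classical v g : {within `[0, 1], continuous g} ->
  (forall x, x \in `[0, 1] -> is_rderiv 1 v x (g x)) -> wdr v g.
Proof.
move=> gc vd; split; first exact: within_sqint.
move=> x; rewrite in_itv/= => /andP[]; rewrite le_eqVlt => /predU1P[<- _|x0 x1].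
  by rewrite set_itv1 Rintegral_set1 addr0.
rewrite /Rintegral (@continuous_FTC2 _ _ v)//=; first by ring.
- by apply: continuous_subspaceW gc => z /=; rewrite !in_itv/= => /andP[? ?]; apply/andP; split; lra.
- have vc := rderiv_within (lexx 0) x1 vd.
  have [H1 H2 H3] := (continuous_within_itvP _ x0).1 vc.
  split=> // z; rewrite in_itv/= => /andP[z0 zx].
  have zb : z \in `]0, 1[ by rewrite in_itv/=; apply/andP; split; lra.
  have /(rderiv_derive _ _ zb)[] := vd z (sub_oo_cc zb); by [].
- move=> z; rewrite in_itv/= => /andP[z0 zx].
  have zb : z \in `]0, 1[ by rewrite in_itv/=; apply/andP; split; lra.
  have /(rderiv_derive _ _ zb)[_ <-] := vd z (sub_oo_cc zb).
  by rewrite derive1E.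
Qed.

(** Continuity of [g] at [x] bounds [g - g x] on a short interval, hence the
    difference quotient of [v] by the integral. *)
Lemma wdr_rderiv v g : wdr v g -> {within `[0, 1], continuous g} ->
  forall x, x \in `[0, 1] -> is_rderiv 1 v x (g x).
Proof.
move=> vg gc x xb; apply/rderivP => e e0.
have [d d0 H] := (within_itvP _ _ _).1 gc x xb e e0.
exists d => // y yb yx.
have key a b : a \in `[0, 1] -> b \in `[0, 1] -> a <= b ->
    (forall t, t \in `]a, b] -> `|g t - g x| <= e) ->
    `|v b - v a - g x * (b - a)| <= e * (b - a).
  rewrite !in_itv/= => /andP[a0 a1] /andP[b0 b1] ab Ht.
  have ig := sqint_intg vg.1.
  rewrite (wdr_incr vg)// -Rint_len// -RintegralB//; last 2 first.
  - exact: intg_oc.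
  - exact: intg_cst.
  apply: (@Rint_bnd (fun t => g t - g x)) => //.
  by apply: intgB => //; exact: sqint_intg (sqint_cst _).
have [xy|yx'] := leP x y.
  rewrite (ger0_norm (_ : 0 <= y - x)) ?subr_ge0//; apply: key => // t.
  rewrite in_itv/= => /andP[xt ty]; apply: H.
    by move: xb yb; rewrite !in_itv/= => /andP[? ?] /andP[? ?]; apply/andP; split; lra.
  by move: yx; rewrite !ger0_norm ?subr_ge0//; lra.
rewrite (distrC y) (ger0_norm (_ : 0 <= x - y)); last by rewrite subr_ge0 ltW.
rewrite (_ : v y - v x - g x * (y - x) = - (v x - v y - g x * (x - y))); last by ring.
rewrite normrN.
apply: key => //; first exact: ltW.
move=> t; rewrite in_itv/= => /andP[xt ty]; apply: H.
  by move: xb yb; rewrite !in_itv/= => /andP[? ?] /andP[? ?]; apply/andP; split; lra.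
by move: yx; rewrite distrC gtr0_norm ?subr_gt0// distrC ger0_norm ?subr_ge0//; lra.
Qed.

(** The defect [P] of the product rule satisfies
    [|P y - P x| <= (y - x) * (H y - H x)] with [H] the primitive of
    [g ^ 2 + k ^ 2]; as [H] is continuous, [P] has derivative 0 everywhere and
    is constant. This avoids an exchange of integrals. *)
Lemma wdrM v g w k : wdr v g -> wdr w k ->
  wdr (fun x => v x * w x) (fun x => g x * w x + v x * k x).
Proof.
move=> vg wk; have vc := wdr_cont vg; have wc := wdr_cont wk.
have [sg _] := vg; have [sk _] := wk.
have [Mv _ vM] := within_bounded ler01 vc; have [Mw _ wM] := within_bounded ler01 wc.
have s1 : sqint (fun x => g x * w x).
  have := sqint_bnd (within_meas wc) (fun x Dx => wM x (sub_oo_cc Dx)) sg.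
  by congr sqint; apply/funext => x; ring.
have s2 : sqint (fun x => v x * k x).
  exact: (sqint_bnd (within_meas vc) (fun x Dx => vM x (sub_oo_cc Dx)) sk).
have s12 := sqintD s1 s2; split=> //.
pose Q x := g x ^+ 2 + k x ^+ 2.
have iQ : intg D Q by apply: intgD => //; [exact: sg.2|exact: sk.2].
pose P x := v x * w x - \int[mu]_(t in `[0, x]) (g t * w t + v t * k t).
pose H x := \int[mu]_(t in `[0, x]) Q t.
have key x y : 0 <= x -> x <= y -> y <= 1 ->
    `|P y - P x| <= (y - x) * (H y - H x).
  move=> x0 xy y1.
  have icc A : intg D A -> intg `]x, y] A by exact: intg_oc.
  set a := \int[mu]_(t in `]x, y]) `|g t|; set b := \int[mu]_(t in `]x, y]) `|k t|.
  have a0 : 0 <= a by apply: Rintegral_ge0.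
  have b0 : 0 <= b by apply: Rintegral_ge0.
  have ia : intg `]x, y] (fun t => `|g t|) by exact/integrable_norm/icc/sqint_intg.
  have ib : intg `]x, y] (fun t => `|k t|) by exact/integrable_norm/icc/sqint_intg.
  have wst s : s \in `]x, y] -> `|w y - w s| <= b.
    rewrite in_itv/= => /andP[xs sy]; have s0 : 0 <= s := le_trans x0 (ltW xs).
    rewrite (wdr_incr wk s0 sy y1).
    have is' : intg `]s, y] k by apply: intg_oc => //; exact: sqint_intg.
    apply: le_trans (le_normr_Rintegral _ is') _ => //.
    by apply: Rint_subset => //; exact: itv_oc_sub (ltW xs) (lexx y).
  have vst s : s \in `]x, y] -> `|v x - v s| <= a.
    rewrite in_itv/= => /andP[xs sy]; have sle1 : s <= 1 := le_trans sy y1.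
    rewrite distrC (wdr_incr vg x0 (ltW xs) sle1).
    have is' : intg `]x, s] g by apply: intg_oc => //; exact: sqint_intg.
    apply: le_trans (le_normr_Rintegral _ is') _ => //.
    by apply: Rint_subset => //; exact: itv_oc_sub (lexx x) sy.
  have ig := icc _ (sqint_intg sg); have ik := icc _ (sqint_intg sk).
  have -> : P y - P x = \int[mu]_(t in `]x, y])
      (g t * (w y - w t) + (v x - v t) * k t).
    (* the increments of v and w are taken at opposite end points, which leaves
       exactly one difference in each term under the integral *)
    have -> : P y - P x = (v y - v x) * w y + v x * (w y - w x)
       - \int[mu]_(t in `]x, y]) (g t * w t + v t * k t).
      rewrite -Rint_incr//; first by rewrite /P; ring.
      exact: sqint_intg.
    rewrite (wdr_incr vg)// (wdr_incr wk)// -RintegralZr// -RintegralZl//.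
    have igw : intg `]x, y] (fun t => g t * w y).
      by have := intgZ (w y) (measurable_itv _) ig; congr intg; apply/funext => t; ring.
    have ivk : intg `]x, y] (fun t => v x * k t) by exact: intgZ.
    rewrite -RintegralD// -RintegralB//.
    - by apply: eq_Rintegral => t _; ring.
    - exact: intgD.
    - exact/icc/sqint_intg.
  have ii : intg `]x, y] (fun t => g t * (w y - w t) + (v x - v t) * k t).
    have i1 := icc _ (sqint_intg s12).
    have i2 := intgZ (w y) (measurable_itv _) ig; have i3 := intgZ (v x) (measurable_itv _) ik.
    have := intgB (measurable_itv _) (intgD (measurable_itv _) i2 i3) i1.
    by congr intg; apply/funext => t; ring.
  apply: le_trans (le_normr_Rintegral _ ii) _ => //.
  apply: (@le_trans _ _ (2 * (a * b))).
    have -> : 2 * (a * b) = \int[mu]_(t in `]x, y]) (`|g t| * b + a * `|k t|).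
      rewrite RintegralD//; last 2 first.
      - by have := intgZ b (measurable_itv _) ia; congr intg; apply/funext => t; ring.
      - exact: intgZ.
      by rewrite RintegralZr// RintegralZl// -/a -/b; ring.
    apply: le_Rintegral => //.
    - exact: integrable_norm.
    - apply: intgD => //; last exact: intgZ.
      by have := intgZ b (measurable_itv _) ia; congr intg; apply/funext => t; ring.
    - move=> t txy; rewrite (le_trans (ler_normD _ _))// !normrM lerD//.
        by rewrite ler_wpM2l// wst.
      by rewrite ler_wpM2r// vst.
  rewrite /H Rint_incr// RintegralD//; last 2 first.
  - exact: icc sg.2.
  - exact: icc sk.2.
  have := Rint_CS sg x0 xy y1; have := Rint_CS sk x0 xy y1; rewrite -/a -/b.
  have := sqr_ge0 (a - b); rewrite mulrDr; nra.
have Hc : {within `[0, 1], continuous H}.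
  exact: (parameterized_integral_continuous ler01 (intg_cc iQ)).
have dP x : x \in `[0, 1] -> is_rderiv 1 P x 0.
  move=> xb; apply/rderivP => e e0.
  have [d d0 Hd] := (within_itvP _ _ _).1 Hc x xb e e0.
  exists d => // y yb yx; rewrite mul0r subr0.
  have Hxy := Hd y yb yx.
  move: xb yb; rewrite !in_itv/= => /andP[x0 x1] /andP[y0 y1].
  have [xy|/ltW xy] := leP x y.
    apply: (le_trans (key _ _ x0 xy y1)).
    rewrite (ger0_norm (_ : 0 <= y - x)) ?subr_ge0// mulrC ler_wpM2r ?subr_ge0//.
    exact: le_trans (ler_norm _) Hxy.
  rewrite distrC; apply: (le_trans (key _ _ y0 xy x1)).
  rewrite distrC (ger0_norm (_ : 0 <= x - y)) ?subr_ge0// mulrC ler_wpM2r ?subr_ge0//.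
  by rewrite (le_trans (ler_norm _))// distrC.
move=> x xb; have := rderiv0_cst dP xb; rewrite /P set_itv1 Rintegral_set1 subr0 => <-.
by ring.
Qed.

(** Lebesgue's differentiation theorem. *)
Lemma wdr_ae v g : wdr v g ->
  {ae mu, forall x, D x -> is_rderiv 1 v x (g x)}.
Proof.
move=> vg; have ig := intg_cc (sqint_intg vg.1).
have [N [mN N0 HN]] := lebesgue_differentiation (integrable_locally (measurable_itv `[0, 1]) ig).
exists N; split=> // x /= /not_implyP[Dx nx]; apply: HN => /= lx; apply: nx.
move: (Dx); rewrite /= in_itv/= => /andP[x0 x1].
pose G := g \_ `[0, 1].
have iG : mu.-integrable `[0, 1] (EFin \o G).
  move: ig; apply: eq_integrable => // z zb /=; by rewrite /G patchE zb.
have bx : (0%:E < x%:E)%E by rewrite lte_fin.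
have [dF FE] := FTC1_lebesgue_pt x1 iG bx lx.
have GE : G x = g x by rewrite /G patchE mem_set//; exact: sub_oo_cc.
pose F y := \int[mu]_(t in `[0, y]) G t.
have FD : is_derive x 1 F (G x).
  by split; [exact: dF|rewrite -FE derive1E].
have xb := sub_oo_cc Dx.
have := is_rderivD (is_rderiv_cst 1 x (v 0)) ((rderiv_derive _ _ Dx).2 FD).
rewrite add0r GE; apply: is_rderiv_ext => // y yb.
rewrite (vg.2 y yb)/=; congr (_ + _); apply: eq_Rintegral => z; rewrite inE/= => zy.
rewrite /G patchE mem_set//=.
by move: yb zy; rewrite !in_itv/= => /andP[? ?] /andP[? ?]; apply/andP; split; lra.
Qed.

End WeakDerivativeReal.

(** * The Sobolev spaces of complex functions *)

Section WeakDerivative.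
Context {R : realType}.
Notation mu := (@lebesgue_measure R).
Notation D := (`]0, 1[%classic : set R).
Notation V := (R -> R[i]).
Implicit Types (f g v w k : V).

Definition wd v g := inL2 g /\
  forall x, x \in `[0, 1] -> v x = v 0 + cint `[0, x] g.

Lemma wdP v g : wd v g <->
  wdr (fun x => complex.Re (v x)) (fun x => complex.Re (g x)) /\
  wdr (fun x => complex.Im (v x)) (fun x => complex.Im (g x)).
Proof.
split=> [[/inL2P[gr gi] vg]|[[gr vr] [gi vi]]].
  by split; split=> // x xb; rewrite {1}(vg x xb); case: (v 0).
split; first exact/inL2P.
move=> x xb; have := vr x xb; have := vi x xb; rewrite /cint.
by case: (v x) (v 0) => a b [c d] /= -> ->.
Qed.

Lemma inHH_wd v : inHH 1 v -> wd v (cderiv 1 v).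
Proof. by move=> [[H1 H2] _]; split; [exact: (H1 1%N)|exact: (H2 0%N)]. Qed.

Lemma wd_ext v g v' g' : wd v g -> (forall x, x \in `[0, 1] -> v x = v' x) ->
  (forall x, x \in `[0, 1] -> g x = g' x) -> wd v' g'.
Proof.
move=> /wdP[vr vi] vv gg; apply/wdP; split;
  [apply: wdr_ext vr _ _|apply: wdr_ext vi _ _] => x xb; by rewrite ?vv ?gg.
Qed.

Lemma wdD v g w k : wd v g -> wd w k -> wd (v + w) (g + k).
Proof.
move=> /wdP[vr vi] /wdP[wr wi]; apply/wdP; split;
 [have := wdrD vr wr|have := wdrD vi wi]; congr wdr; apply/funext => x;
 rewrite !fctE; by [case: (v x) (w x) => ? ? []|case: (g x) (k x) => ? ? []].
Qed.

Lemma wd_cstM (c : R[i]) v g : wd v g -> wd ((fun=> c) * v) ((fun=> c) * g).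
Proof.
move=> /wdP[vr vi]; case: c => a b; apply/wdP; split.
  have := wdrD (wdrZ a vr) (wdrZ (- b) vi); congr wdr; apply/funext => x;
  rewrite !fctE; [case: (v x)|case: (g x)] => s t /=; ring.
have := wdrD (wdrZ a vi) (wdrZ b vr); congr wdr; apply/funext => x;
  rewrite !fctE; [case: (v x)|case: (g x)] => s t /=; ring.
Qed.

Lemma wdK c v g : wd v g -> wd (K c * v) (K c * g). Proof. exact: wd_cstM. Qed.
Lemma wdJ v g : wd v g -> wd (J * v) (J * g). Proof. exact: wd_cstM. Qed.

Lemma wdN v g : wd v g -> wd (- v) (- g).
Proof. by rewrite !KN1; exact: wdK. Qed.

Lemma wdB v g w k : wd v g -> wd w k -> wd (v - w) (g - k).
Proof. by move=> vg wk; apply: wdD => //; exact: wdN. Qed.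

Lemma wdM v g w k : wd v g -> wd w k -> wd (v * w) (g * w + v * k).
Proof.
move=> /wdP[vr vi] /wdP[wr wi]; apply/wdP; split.
  have := wdrD (wdrM vr wr) (wdrZ (-1) (wdrM vi wi)).
  congr wdr; apply/funext => x; rewrite !fctE.
    by case: (v x) (w x) => a b [c d] /=; ring.
  by case: (v x) (w x) (g x) (k x) => a b [c d] [a' b'] [c' d'] /=; ring.
have := wdrD (wdrM vr wi) (wdrM vi wr).
congr wdr; apply/funext => x; rewrite !fctE.
  by case: (v x) (w x) => a b [c d] /=; ring.
by case: (v x) (w x) (g x) (k x) => a b [c d] [a' b'] [c' d'] /=; ring.
Qed.

Lemma within_L2 v : {within `[0, 1], continuous (fun x => complex.Re (v x))} ->
  {within `[0, 1], continuous (fun x => complex.Im (v x))} -> inL2 v.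
Proof. by move=> vr vi; apply/inL2P; split; exact: within_sqint. Qed.

Lemma wd_L2 v g : wd v g -> inL2 v.
Proof. by move=> /wdP[vr vi]; apply: within_L2; [exact: wdr_cont vr|exact: wdr_cont vi]. Qed.

Lemma wd_classical v g : {within `[0, 1], continuous (fun x => complex.Re (g x))} ->
  {within `[0, 1], continuous (fun x => complex.Im (g x))} ->
  (forall x, x \in `[0, 1] -> is_cderiv 1 v x (g x)) -> wd v g.
Proof.
by move=> gr gi vg; apply/wdP; split; apply: wdr_classical => // x /vg[].
Qed.

Lemma is_cderivE (b x : R) v l : 0 < b -> x \in `[0, b] -> is_cderiv b v x l ->
  cderiv b v x = l.
Proof.
by move=> b0 xb [vr vi]; rewrite /cderiv (rderivE b0 xb vr) (rderivE b0 xb vi); case: l vr vi.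
Qed.

Lemma cderiv_ext (b x : R) v w : x \in `[0, b] ->
  (forall y, y \in `[0, b] -> v y = w y) -> cderiv b v x = cderiv b w x.
Proof.
move=> xb vw; rewrite /cderiv; congr (_ +i* _); apply: rderiv_ext => // y yb;
  by rewrite vw.
Qed.

Lemma is_cderivD (b x : R) v w l m : is_cderiv b v x l -> is_cderiv b w x m ->
  is_cderiv b (v + w) x (l + m).
Proof.
move=> [vr vi] [wr wi]; split.
  have := is_rderivD vr wr; congr is_rderiv; last by case: l m {vr vi wr wi} => ? ? [].
  by apply/funext => y; rewrite !fctE; case: (v y) (w y) => ? ? [].
have := is_rderivD vi wi; congr is_rderiv; last by case: l m {vr vi wr wi} => ? ? [].
by apply/funext => y; rewrite !fctE; case: (v y) (w y) => ? ? [].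
Qed.

Lemma is_cderivK (b x c : R) v l : is_cderiv b v x l ->
  is_cderiv b (K c * v) x (c%:C * l).
Proof.
move=> [vr vi]; split.
  have := is_rderivZ (c := c) vr; congr is_rderiv; last by case: l {vr vi} => ? ? /=; ring.
  by apply/funext => y; rewrite !fctE; case: (v y) => ? ? /=; ring.
have := is_rderivZ (c := c) vi; congr is_rderiv; last by case: l {vr vi} => ? ? /=; ring.
by apply/funext => y; rewrite !fctE; case: (v y) => ? ? /=; ring.
Qed.

(** The pointwise derivative of a function of H^1 agrees almost everywhere with
    any version of its derivative. Scalar products of derivatives can therefore
    be computed with the version at hand. *)
Lemma wd_ae v g : wd v g -> {ae mu, forall x, D x -> cderiv 1 v x = g x}.
Proof.
move=> /wdP[/wdr_ae vr /wdr_ae vi].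
have FF := ae_filter_ringOfSetsType (@lebesgue_measure R).
apply: filterS2 vr vi => x vr vi Dx.
by apply: (is_cderivE ltr01 (sub_oo_cc Dx)); split; [exact: vr|exact: vi].
Qed.

Lemma wd_ip v g w : wd v g -> ip (cderiv 1 v) w = ip g w.
Proof.
move=> /wd_ae vg; apply: Rintegral_ae;
  have FF := ae_filter_ringOfSetsType (@lebesgue_measure R); apply: filterS vg => x vg Dx.
by rewrite vg.
Qed.

Lemma wd_L2norm v g : wd v g -> L2norm (cderiv 1 v) = L2norm g.
Proof.
move=> /wd_ae vg; congr Num.sqrt; apply: Rintegral_ae;
  have FF := ae_filter_ringOfSetsType (@lebesgue_measure R); apply: filterS vg => x vg Dx.
by rewrite vg.
Qed.

Lemma wd_ibp v g w k : wd v g -> wd w k -> v 0 = 0 -> w 1 = 0 ->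
  ip g w = - ip v k.
Proof.
move=> vg wk v0 w1; have lg := vg.1; have lk := wk.1.
have lv := wd_L2 vg; have lw := wd_L2 wk.
move/wdP: (vg) => [vr vi]; move/wdP: (wk) => [wr wi].
have b1 : (1 : R) \in `[0, 1] by rewrite in_itv/= lexx ler01.
have := (wdrM vr wr).2 1 b1; have := (wdrM vi wi).2 1 b1.
rewrite v0 w1 /= !mulr0 !mul0r !add0r.
rewrite !Rint_cc; [|exact: sqint_intg (wdrM vr wr).1|exact: sqint_intg (wdrM vi wi).1].
move=> h1 h2; apply/eqP; rewrite -addr_eq0 /ip -RintegralD//; try exact: ip_intg.
rewrite [X in X == _](_ : _ = \int[mu]_(x in D) (complex.Re (g x) * complex.Re (w x) +
          complex.Re (v x) * complex.Re (k x)) +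
     \int[mu]_(x in D) (complex.Im (g x) * complex.Im (w x) +
          complex.Im (v x) * complex.Im (k x))); first by rewrite -h1 -h2 addr0.
rewrite -RintegralD//; first by apply: eq_Rintegral => x _; ring.
- exact: sqint_intg (wdrM vr wr).1.
- exact: sqint_intg (wdrM vi wi).1.
Qed.

(** Cauchy-Schwarz between [x] and [y], whose distance is at most 1. *)
Lemma wdr_dist (v g : R -> R) x y : wdr v g -> x \in `[0, 1] -> y \in `[0, 1] ->
  (v y - v x) ^+ 2 <= \int[mu]_(t in D) (g t ^+ 2).
Proof.
move=> vg; wlog xy : x y / x <= y.
  move=> H xb yb; have [xy|/ltW yx] := leP x y; first exact: H.
  by rewrite -opprB sqrrN; exact: H.
rewrite !in_itv/= => /andP[x0 x1] /andP[y0 y1].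
rewrite (wdr_incr vg)//.
have ig := sqint_intg vg.1.
have igxy : intg `]x, y] g by exact: intg_oc.
have ig2 : intg `]x, y] (fun t => g t ^+ 2) by apply: intg_oc => //; exact: vg.1.2.
rewrite -real_normK ?num_real//.
apply: (@le_trans _ _ ((\int[mu]_(t in `]x, y]) `|g t|) ^+ 2)).
  rewrite lerXn2r ?nnegrE//; first by apply: Rintegral_ge0.
  exact: le_normr_Rintegral.
apply: le_trans (Rint_CS vg.1 x0 xy y1) _.
have B0 : 0 <= \int[mu]_(t in `]x, y]) (g t ^+ 2).
  by apply: Rintegral_ge0 => t _; exact: sqr_ge0.
apply: (@le_trans _ _ (\int[mu]_(t in `]x, y]) (g t ^+ 2))).
  by rewrite ler_piMl//; lra.
rewrite -Rint_cc; last exact: vg.1.2.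
apply: Rint_subset => //.
- by move=> z /=; rewrite !in_itv/= => /andP[? ?]; apply/andP; split; lra.
- exact: intg_cc vg.1.2.
- by move=> t _; exact: sqr_ge0.
Qed.

(** The zero may be anywhere in the interval: it is at 0 for the functions of
    the finite element space, and at 1 for the first space derivative of the
    solution and for the derivative of the dual solution. *)
Lemma wd_poincare v g c : wd v g -> c \in `[0, 1] -> v c = 0 ->
  L2norm v <= L2norm g.
Proof.
move=> vg cb vc; have lv := wd_L2 vg; have lg := vg.1.
rewrite -(@ler_pXn2r _ 2%N) ?nnegrE ?L2norm_ge0// !L2norm_sq.
have E (a : R -> R) : \int[mu]_(t in D) (a t * a t) = \int[mu]_(t in D) (a t ^+ 2).
  by apply: eq_Rintegral => t _; rewrite expr2.
have sup x : x \in `[0, 1] ->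
    complex.Re (v x) * complex.Re (v x) + complex.Im (v x) * complex.Im (v x) <= ip g g.
  move=> xb; move/wdP: (vg) => [vr vi].
  have := wdr_dist vr cb xb; have := wdr_dist vi cb xb; rewrite vc !subr0 => h1 h2.
  rewrite /ip RintegralD//.
  - by rewrite -!expr2 (E (fun t => complex.Re (g t))) (E (fun t => complex.Im (g t))) lerD.
  - by apply: sqintM; case: vr.
  - by apply: sqintM; case: vi.
rewrite -[leRHS]Rint_unit.
apply: le_Rintegral => //.
- exact: ip_intg.
- exact: (sqint_intg (sqint_cst (ip g g))).
- by move=> x /sub_oo_cc; exact: sup.
Qed.

End WeakDerivative.

Section SobolevNorm.
Context {R : realType}.
Notation V := (R -> R[i]).

Lemma cderivn_chain (b : R) (F : nat -> V) (s : nat) (v : V) : 0 < b ->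
  (forall l, (l < s)%N -> forall x, x \in `[0, b] -> is_cderiv b (F l) x (F l.+1 x)) ->
  (forall x, x \in `[0, b] -> v x = F 0%N x) ->
  forall l, (l <= s)%N -> forall x, x \in `[0, b] -> cderivn b l v x = F l x.
Proof.
move=> b0 FF vF; elim=> [_ x xb|l IH ls x xb]; first exact: vF.
rewrite /cderivn iterS -/(cderivn b l v) (cderiv_ext xb (IH (ltnW ls))).
exact: (is_cderivE b0 xb (FF l ls x xb)).
Qed.

(** Membership in H^s is obtained from any explicit chain [F] of classical
    derivatives, without computing limits of difference quotients. *)
Lemma chain_inH (F : nat -> V) (s : nat) (v : V) :
  (forall l, (l <= s)%N -> {within `[0, 1], continuous (fun x => complex.Re (F l x))} /\
     {within `[0, 1], continuous (fun x => complex.Im (F l x))}) ->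
  (forall l, (l < s)%N -> forall x, x \in `[0, 1] -> is_cderiv 1 (F l) x (F l.+1 x)) ->
  (forall x, x \in `[0, 1] -> v x = F 0%N x) ->
  inH s v /\ forall l, (l <= s)%N -> forall x, x \in `[0, 1] -> cderivn 1 l v x = F l x.
Proof.
move=> Fc FF vF.
have E := cderivn_chain ltr01 FF vF.
split=> //; split=> l ls.
  apply: (@eq_inL2 _ (F l)); first by move=> x /sub_oo_cc xb; rewrite E.
  by have [? ?] := Fc l ls; exact: within_L2.
have [c1 c2] := Fc _ ls.
have wF := wd_classical c1 c2 (FF l ls).
suff [_ ] : wd (cderivn 1 l v) (cderivn 1 l.+1 v) by [].
by apply: wd_ext wF _ _ => x xb; rewrite E// ltnW.
Qed.

Lemma Hnorm_ge0 s (v : V) : 0 <= Hnorm s v.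
Proof. exact: sqrtr_ge0. Qed.

Lemma L2norm_le_Hnorm s l (v : V) : (l <= s)%N -> L2norm (cderivn 1 l v) <= Hnorm s v.
Proof.
move=> ls; rewrite -[leLHS]ger0_norm ?L2norm_ge0// -sqrtr_sqr ler_wsqrtr//.
have ls' : (l < s.+1)%N by [].
rewrite (bigD1 (Ordinal ls'))//= lerDl sumr_ge0// => i _; exact: sqr_ge0.
Qed.

Lemma Hnorm_le s (v : V) M : 0 <= M ->
  (forall l, (l <= s)%N -> L2norm (cderivn 1 l v) <= M) -> Hnorm s v <= s.+1%:R * M.
Proof.
move=> M0 H; rewrite -[leRHS]ger0_norm ?mulr_ge0// -sqrtr_sqr ler_wsqrtr//.
apply: (@le_trans _ _ (\sum_(l < s.+1) M ^+ 2)).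
  by apply: ler_sum => i _; rewrite lerXn2r ?nnegrE ?L2norm_ge0// H// -ltnS.
rewrite sumr_const card_ord -[leLHS]mulr_natl exprMn ler_wpM2r ?sqr_ge0//.
by rewrite -natrX ler_nat expnS expn1 leq_pmull.
Qed.

Lemma Hnorm1_le (v g : V) : wd v g -> Hnorm 1 v <= L2norm v + L2norm g.
Proof.
move=> vg; rewrite /Hnorm big_ord_recl big_ord1 /=.
rewrite /bump/= (wd_L2norm vg).
rewrite -[leRHS]ger0_norm ?addr_ge0 ?L2norm_ge0// -sqrtr_sqr ler_wsqrtr//.
rewrite sqrrD addrAC lerDl mulrn_wge0// mulr_ge0 ?L2norm_ge0//.
Qed.

Lemma Hnorm1_ge (v g : V) : wd v g -> L2norm v <= Hnorm 1 v /\ L2norm g <= Hnorm 1 v.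
Proof.
move=> vg; split; first exact: (@L2norm_le_Hnorm 1 0).
by rewrite -(wd_L2norm vg); exact: (@L2norm_le_Hnorm 1 1).
Qed.

End SobolevNorm.

(** * Projections onto finite dimensional subspaces *)

Section OrthogonalProjection.
Context {R : realType}.
Notation V := (R -> R[i]).
Variables (H : V -> Prop) (b : V -> V -> R).
Hypothesis HD : forall f g, H f -> H g -> H (f + g).
Hypothesis HK : forall c f, H f -> H (K c * f).
Hypothesis bDl : forall f g w, H f -> H g -> H w -> b (f + g) w = b f w + b g w.
Hypothesis bKl : forall c f w, H f -> H w -> b (K c * f) w = c * b f w.
Hypothesis b_sym : forall f g, b f g = b g f.
Hypothesis b_ge0 : forall f, H f -> 0 <= b f f.

Let HB f g : H f -> H g -> H (f - g).
Proof. by move=> hf hg; rewrite KN1; apply: HD => //; exact: HK. Qed.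

Let bBl f g w : H f -> H g -> H w -> b (f - g) w = b f w - b g w.
Proof. by move=> hf hg hw; rewrite KN1 bDl ?bKl ?mulN1r//; exact: HK. Qed.

(** The form is only assumed to be semi-definite. When [b f f = 0], the quantity
    [b (g + c f) (g + c f)] is affine in [c] and nonnegative, so its slope
    vanishes. *)
Lemma form_null f g : H f -> H g -> b f f = 0 -> b g f = 0.
Proof.
move=> hf hg f0; apply/eqP/negPn/negP => n0.
(* with this c the form takes the value -1 at g + c f *)
pose c := - (b g g + 1) / (2 * b g f).
have := b_ge0 (HD hg (HK c hf)).
have hc : H (K c * f) by exact: HK.
rewrite bDl ?(b_sym _ (g + _)) ?bDl ?bKl ?(b_sym _ (K c * f)) ?bKl//; try exact: HD.
rewrite f0 (b_sym f g) !mulr0 addr0.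
have -> : c * b g f = - (b g g + 1) / 2 by rewrite /c; field.
lra.
Qed.

Definition linear_set (S : set V) := [/\ S 0, forall f, S f -> H f &
  forall c f g, S f -> S g -> S (f + K c * g)].

Definition projectable (S : set V) := linear_set S /\
  forall v, H v -> exists2 w, S w & forall phi, S phi -> b (v - w) phi = 0.

Definition adjoin (S : set V) (e : V) : set V :=
  [set v | exists2 w, S w & exists c, v = w + K c * e].

(** One step of Gram-Schmidt with the residual [psi] of [e]. If [b psi psi = 0]
    then [psi] is orthogonal to everything and the old projection still serves,
    so that linearly dependent generators do no harm. *)
Lemma adjoin_projectable S e : H e -> projectable S -> projectable (adjoin S e).
Proof.
move=> he [[S0 SH Slin] Sproj].
have lin : linear_set (adjoin S e).
  split.
  - exists 0 => //; exists 0; apply/funext => x; rewrite !fctE /K; ring.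
  - by move=> f [w Sw [c ->]]; apply: HD; [exact: SH|exact: HK].
  - move=> c f g [w Sw [d ->]] [z Sz [k ->]].
    exists (w + K c * z); first exact: Slin.
    exists (d + c * k); apply/funext => x; rewrite !fctE /K rmorphD rmorphM /=; ring.
split=> // v hv.
have [p Sp pE] := Sproj v hv; have [q Sq qE] := Sproj e he.
have hp := SH _ Sp; have hq := SH _ Sq.
pose psi := e - q; have hpsi : H psi by exact: HB.
have hvp : H (v - p) by exact: HB.
have bpe : b (v - p) e = b (v - p) psi.
  by rewrite (b_sym _ e) (b_sym _ psi) /psi bBl// (b_sym q) pE// subr0.
have [z0|z0] := eqVneq (b psi psi) 0.
  exists p; first by exists p => //; exists 0; apply/funext => x; rewrite !fctE /K; ring.
  move=> _ [s Ss [c ->]]; have hs := SH _ Ss.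
  rewrite (b_sym _ (s + _)) bDl ?bKl//; last exact: HK.
  by rewrite (b_sym s) (b_sym e) pE// bpe (form_null hpsi hvp z0) mulr0 addr0.
pose c0 := b v psi / b psi psi.
exists (p + K c0 * psi).
  exists (p + K (- c0) * q); first exact: Slin.
  by exists c0; apply/funext => x; rewrite !fctE /K /psi !fctE rmorphN /=; ring.
have hc : H (K c0 * psi) by exact: HK.
have hw : H (p + K c0 * psi) by exact: HD.
have ort s : S s -> b (v - (p + K c0 * psi)) s = 0.
  move=> Ss; have hs := SH _ Ss.
  by rewrite bBl// bDl// bKl// /psi qE// mulr0 addr0 -bBl// pE.
move=> _ [s Ss [c ->]]; have hs := SH _ Ss.
have hvw : H (v - (p + K c0 * psi)) by exact: HB.
rewrite (b_sym _ (s + _)) bDl ?bKl//; last exact: HK.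
rewrite (b_sym s) ort// add0r.
have {1}-> : e = psi + q by apply/funext => x; rewrite /psi !fctE; ring.
rewrite bDl// (b_sym q) ort// addr0 (b_sym psi) bBl// bDl// bKl//.
have -> : b p psi = 0 by rewrite b_sym qE.
by rewrite add0r /c0 divfK// subrr mulr0.
Qed.

Definition cspan d (phi : 'I_d -> V) : set V :=
  [set v | exists c : 'I_d -> R[i], v = (fun x => \sum_(i < d) c i * phi i x)].

Hypothesis H0 : H 0.
Hypothesis HJ : forall f, H f -> H (J * f).

(** A complex generator is adjoined as the two real generators [e] and
    [J * e]. *)
Lemma cspan_projectable d (phi : 'I_d -> V) : (forall i, H (phi i)) ->
  projectable (cspan phi).
Proof.
elim: d phi => [phi _|d IH phi hphi].
  have -> : cspan phi = [set 0].
    apply/seteqP; split=> [v [c ->]|v ->] /=.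
      by apply/funext => x; rewrite big_ord0.
    by exists (fun=> 0); apply/funext => x; rewrite big_ord0.
  split; first split=> // [f ->//|c f g -> ->].
    by rewrite mulr0 addr0.
  move=> v hv; exists 0 => // _ ->.
  have K00 : K 0 * (0 : V) = 0 by apply/funext => x; rewrite !fctE mulr0.
  by have := bKl 0 H0 (HB hv H0); rewrite K00 mul0r b_sym.
pose psi i := phi (widen_ord (leqnSn d) i); pose e := phi ord_max.
have he : H e by exact: hphi.
suff -> : cspan phi = adjoin (adjoin (cspan psi) e) (J * e).
  apply: adjoin_projectable; first exact: HJ.
  by apply: adjoin_projectable => //; apply: IH => i; exact: hphi.
apply/seteqP; split=> [v [c ->]|v [w [z [c ->] [k ->]] [l ->]]] /=.
  exists ((fun x => \sum_(i < d) c (widen_ord (leqnSn d) i) * psi i x)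
      + K (complex.Re (c ord_max)) * e).
    eexists; first by exists (fun i => c (widen_ord (leqnSn d) i)); reflexivity.
    by exists (complex.Re (c ord_max)).
  exists (complex.Im (c ord_max)); apply/funext => x.
  rewrite big_ord_recr !fctE /= -[RHS]addrA; congr (_ + _).
  rewrite /K /J -/e; case: (c ord_max) (e x) => a a' [t t'] /=.
  by apply/eqP; rewrite eq_complex /=; apply/andP; split; apply/eqP; ring.
exists (fun i => if unlift ord_max i is Some j then c j else k +i* l).
apply/funext => x; rewrite big_ord_recr /= unlift_none !fctE /= -[LHS]addrA.
congr (_ + _).
  apply: eq_bigr => i _; rewrite /psi.
  have -> : widen_ord (leqnSn d) i = lift ord_max i.
    by apply/val_inj => /=; rewrite /bump leqNgt ltn_ord.
  by rewrite liftK.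
rewrite /K /J -/e; case: (e x) => t t' /=.
by apply/eqP; rewrite eq_complex /=; apply/andP; split; apply/eqP; ring.
Qed.

End OrthogonalProjection.

(** * The finite element space: elliptic and L^2 projections *)

Lemma le_of_eq (R : realType) (x y : R) : x = y -> x <= y.
Proof. by move=> ->. Qed.

Section FiniteElementSpace.
Context {R : realType}.
Notation V := (R -> R[i]).
Notation D := (`]0, 1[%classic : set R).
Notation dx := (cderiv 1).
Implicit Types (f g v w : V).

Definition bip v w : R := ip (dx v) (dx w).

Definition H1 v := exists g, wd v g.

Lemma bip_wd v g w k : wd v g -> wd w k -> bip v w = ip g k.
Proof. by move=> vg wk; rewrite /bip (wd_ip _ vg) ip_sym (wd_ip _ wk) ip_sym. Qed.

Lemma wd0 : wd (0 : V) 0.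
Proof.
split; first exact: L20.
have E (A : set (measurableTypeR R)) : \int[@lebesgue_measure R]_(x in A) (0 : R) = 0.
  by rewrite /Rintegral integral0.
move=> x _; transitivity ((0 : V) 0 + (0 +i* 0)); first by rewrite addr0.
by congr (_ + (_ +i* _)); exact/esym/E.
Qed.

Lemma Im_inner f g : complex.Im (inner f g) = ip f (J * g).
Proof.
by rewrite /inner /cint /=; apply: eq_Rintegral => x _; rewrite !fctE /J;
  case: (f x) (g x) => a b [c d] /=; ring.
Qed.

Lemma Re_inner_ip f g : complex.Re (inner f g) = ip f g.
Proof.
by rewrite /inner /cint /=; apply: eq_Rintegral => x _; case: (f x) (g x) => a b [c d] /=; ring.
Qed.

(** How complex variational equations are read as pairs of real ones. *)
Lemma eq_innerP f g f' g' : inner f g = inner f' g' <->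
  ip f g = ip f' g' /\ ip f (J * g) = ip f' (J * g').
Proof.
split=> [E|[E1 E2]].
  have := congr1 (@complex.Re R) E; have := congr1 (@complex.Im R) E.
  rewrite (Re_inner_ip f g) (Re_inner_ip f' g') (Im_inner f g) (Im_inner f' g').
  by [].
apply/eqP; rewrite eq_complex.
rewrite (Re_inner_ip f g) (Re_inner_ip f' g') (Im_inner f g) (Im_inner f' g').
by rewrite E1 E2 !eqxx.
Qed.

Section Subspace.
Variable S : set V.
Hypothesis Sfin : finite_dim_subspace S.
Hypothesis SH : forall v, S v -> inHH 1 v.

Lemma S_wd v : S v -> wd v (dx v).
Proof. by move=> /SH /inHH_wd. Qed.

Lemma S_0 v : S v -> v 0 = 0.
Proof. by move=> /SH[]. Qed.

Lemma S_lin c f g : S f -> S g -> S (f + (fun=> c) * g).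
Proof.
have [d [phi ->]] := Sfin => -[cf ->] [cg ->].
exists (fun i => cf i + c * cg i); apply/funext => x; rewrite !fctE.
by rewrite mulr_sumr -big_split /=; apply: eq_bigr => i _; ring.
Qed.

Lemma S_zero : S 0.
Proof.
have [d [phi ->]] := Sfin; exists (fun=> 0).
by apply/funext => x; rewrite big1// => i _; rewrite mul0r.
Qed.

Lemma S_K c f : S f -> S (K c * f).
Proof. by move=> Sf; have := S_lin c%:C S_zero Sf; rewrite add0r. Qed.

Lemma S_J f : S f -> S (J * f).
Proof. by move=> Sf; have := S_lin 'i%C S_zero Sf; rewrite add0r. Qed.

Lemma S_D f g : S f -> S g -> S (f + g).
Proof.
move=> Sf Sg; have := S_lin 1 Sf Sg; congr S.
by apply/funext => x; rewrite !fctE mul1r.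
Qed.

Lemma S_B f g : S f -> S g -> S (f - g).
Proof.
move=> Sf Sg; have := S_lin (-1) Sf Sg; congr S.
by apply/funext => x; rewrite !fctE mulN1r.
Qed.

Let S_projectable (H : V -> Prop) (b : V -> V -> R) :
  (forall f g, H f -> H g -> H (f + g)) ->
  (forall c f, H f -> H (K c * f)) ->
  (forall f g w, H f -> H g -> H w -> b (f + g) w = b f w + b g w) ->
  (forall c f w, H f -> H w -> b (K c * f) w = c * b f w) ->
  (forall f g, b f g = b g f) -> (forall f, H f -> 0 <= b f f) ->
  H 0 -> (forall f, H f -> H (J * f)) ->
  (forall v, S v -> H v) -> projectable H b S.
Proof.
move=> HD HK bD bK bs b0 H0 HJ SHH; have [d [phi SE]] := Sfin; rewrite SE.
apply: cspan_projectable => // i; apply: SHH; rewrite SE.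
exists (fun j => (j == i)%:R); apply/funext => x.
by rewrite (bigD1 i)//= eqxx mul1r big1 ?addr0// => j /negPf ->; rewrite mul0r.
Qed.

Definition L2proj g p := S p /\ forall phi, S phi -> ip p phi = ip g phi.

Lemma L2proj_exists g : inL2 g -> exists p, L2proj g p.
Proof.
move=> lg.
have [[_ SL _] /(_ g lg)[p Sp pE]] : projectable (@inL2 R) (@ip R) S.
  apply: S_projectable.
  - exact: L2D.
  - exact: L2K.
  - exact: ipDl.
  - exact: ipZl.
  - exact: ip_sym.
  - by move=> f _; exact: ip_ge0.
  - exact: L20.
  - exact: L2J.
  - by move=> v /S_wd /wd_L2.
exists p; split=> // phi Sphi; have := pE phi Sphi.
by rewrite (ipBl lg (SL _ Sp) (SL _ Sphi)) => /eqP; rewrite subr_eq0 => /eqP.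
Qed.

(** The real form of the equations of the elliptic projection. Since [S] is
    stable under [J], it is equivalent to the complex one. *)
Definition ritz v w := S w /\ forall phi, S phi -> bip w phi = bip v phi.

Lemma ritz_exists v : H1 v -> exists w, ritz v w.
Proof.
move=> hv.
have [[_ SL _] /(_ v hv)[w Sw wE]] : projectable H1 bip S.
  apply: S_projectable.
  - by move=> f g [f' ff] [g' gg]; exists (f' + g'); exact: wdD.
  - by move=> c f [f' ff]; exists (K c * f'); exact: wdK.
  - move=> f g w [f' ff] [g' gg] [w' ww].
    rewrite (bip_wd (wdD ff gg) ww) (bip_wd ff ww) (bip_wd gg ww).
    exact: (ipDl ff.1 gg.1 ww.1).
  - move=> c f w [f' ff] [w' ww].
    rewrite (bip_wd (wdK c ff) ww) (bip_wd ff ww); exact: (ipZl c ff.1 ww.1).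
  - by move=> f g; exact: ip_sym.
  - by move=> f _; exact: ip_ge0.
  - by exists 0; exact: wd0.
  - by move=> f [f' ff]; exists (J * f'); exact: wdJ.
  - by move=> w /S_wd ww; eexists; exact: ww.
exists w; split; first exact: Sw.
move=> phi Sphi; have := wE phi Sphi.
have [v' vv] := hv; have ww := S_wd Sw; have pp := S_wd Sphi.
rewrite (bip_wd (wdB vv ww) pp) (bip_wd ww pp) (bip_wd vv pp).
rewrite (ipBl vv.1 ww.1 pp.1) => /eqP; rewrite subr_eq0 => /eqP h; exact: (esym h).
Qed.

Lemma elliptic_projection_ritz v : H1 v -> ritz v (elliptic_projection S v).
Proof.
move=> hv; have [w [Sw wE]] := ritz_exists hv; have [v' vv] := hv.
have ww := S_wd Sw.
have exC : S w /\ forall phi, S phi -> Bform w phi = Bform v phi.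
  split; first exact: Sw.
  move=> phi Sphi; have pp := S_wd Sphi.
  have h1 := wE _ Sphi; have h2 := wE _ (S_J Sphi).
  rewrite (bip_wd ww pp) (bip_wd vv pp) in h1.
  rewrite (bip_wd ww (wdJ pp)) (bip_wd vv (wdJ pp)) in h2.
  by apply/eq_innerP; split; rewrite (wd_ip _ vv).
rewrite /elliptic_projection; case: xgetP => [z _ [Sz zE]|no]; last by case: (no w exC).
split; first exact: Sz.
by move=> phi Sphi; have [] := (eq_innerP _ _ _ _).1 (zE _ Sphi).
Qed.

Lemma ritz_ort v v' w phi : wd v v' -> ritz v w -> S phi -> ip (dx w - v') (dx phi) = 0.
Proof.
move=> vv [Sw wE] Sphi; have ww := S_wd Sw; have pp := S_wd Sphi.
have := wE _ Sphi; rewrite (bip_wd ww pp) (bip_wd vv pp) (ipBl ww.1 vv.1 pp.1) => ->.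
exact: subrr.
Qed.

Lemma ritz_best v v' w chi : wd v v' -> ritz v w -> S chi ->
  L2norm (dx w - v') <= L2norm (dx chi - v').
Proof.
move=> vv rw Schi; have Sw := rw.1; have ww := S_wd Sw; have cc := S_wd Schi.
have lw := ww.1; have lc := cc.1; have lv := vv.1.
have lwv : inL2 (dx w - v') := L2B lw lv.
have lcv : inL2 (dx chi - v') := L2B lc lv.
apply: (L2norm_le_ip lwv lcv).
rewrite (_ : dx chi - v' = (dx w - v') + (dx chi - dx w)); last first.
  by apply/funext => x; rewrite !fctE; ring.
rewrite (ipDr lwv (L2B lc lw) lwv) (ipBr lc lw lwv).
by rewrite (ritz_ort vv rw Schi) (ritz_ort vv rw Sw) subrr addr0.
Qed.

Lemma ritz_error_le v v' w : wd v v' -> ritz v w -> L2norm (dx w - v') <= L2norm v'.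
Proof.
move=> vv rw; have Sw := rw.1; have ww := S_wd Sw; have lw := ww.1; have lv := vv.1.
have lwv : inL2 (dx w - v') := L2B lw lv.
rewrite -(L2normN lv); apply: (L2norm_le_ip lwv (L2N lv)).
by rewrite (ipNr lv lwv) (ipBr lw lv lwv) (ritz_ort vv rw Sw) sub0r.
Qed.

Lemma ritzK v c w : H1 v -> ritz v w -> ritz (K c * v) (K c * w).
Proof.
move=> [v' vv] [Sw wE]; split; first exact: S_K.
move=> phi Sphi; have ww := S_wd Sw; have pp := S_wd Sphi.
rewrite (bip_wd (wdK c ww) pp) (bip_wd (wdK c vv) pp).
rewrite (ipZl c ww.1 pp.1) (ipZl c vv.1 pp.1).
by have := wE _ Sphi; rewrite (bip_wd ww pp) (bip_wd vv pp) => ->.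
Qed.

Lemma ritzB v1 v2 w1 w2 : H1 v1 -> H1 v2 -> ritz v1 w1 -> ritz v2 w2 ->
  ritz (v1 - v2) (w1 - w2).
Proof.
move=> [v1' vv1] [v2' vv2] [Sw1 wE1] [Sw2 wE2]; split; first exact: S_B.
move=> phi Sphi; have pp := S_wd Sphi.
have ww1 := S_wd Sw1; have ww2 := S_wd Sw2.
rewrite (bip_wd (wdB ww1 ww2) pp) (bip_wd (wdB vv1 vv2) pp).
have h1 := wE1 _ Sphi; rewrite (bip_wd ww1 pp) (bip_wd vv1 pp) in h1.
have h2 := wE2 _ Sphi; rewrite (bip_wd ww2 pp) (bip_wd vv2 pp) in h2.
by rewrite (ipBl ww1.1 ww2.1 pp.1) (ipBl vv1.1 vv2.1 pp.1) h1 h2.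
Qed.

Section Approximation.
Variables (h CA : R) (r : nat).
Hypotheses (h_gt0 : 0 < h) (r_ge1 : (1 <= r)%N) (CA_ge0 : 0 <= CA).
Hypothesis approx : forall s, (s <= r)%N -> forall v, inHH s.+1 v ->
  inf [set L2norm (fun x => v x - chi x)
         + h * Hnorm 1 (fun x => v x - chi x) | chi in S]
  <= CA * h ^+ s.+1 * Hnorm s.+1 v.

(** The infimum in the approximation property need not be attained, hence the
    slack [e]. *)
Lemma approx_eps s v v' e : (s <= r)%N -> inHH s.+1 v -> wd v v' -> 0 < e ->
  exists2 chi, S chi & h * L2norm (dx chi - v') <= CA * h ^+ s.+1 * Hnorm s.+1 v + e.
Proof.
move=> sr hv vv e0; have := approx sr hv; set A := [set _ | _ in _] => infA.
have hA : has_inf A.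
  split; first by eexists; exists 0; [exact: S_zero|reflexivity].
  exists 0 => _ [chi _ <-].
  by rewrite addr_ge0 ?L2norm_ge0// mulr_ge0 ?Hnorm_ge0// ltW.
have [_ [chi Schi <-] lt_e] := inf_adherent e0 hA.
exists chi => //; apply: le_trans (lerD infA (lexx e)).
apply: le_trans (ltW lt_e).
have wvc : wd (v - chi) (v' - dx chi) by apply: wdB => //; exact: S_wd.
have [_ H] := Hnorm1_ge wvc.
rewrite -[leLHS]add0r; apply: lerD; first exact: L2norm_ge0.
apply: (ler_wpM2l (ltW h_gt0)).
rewrite -(L2normN (L2B (S_wd Schi).1 vv.1)) opprB; exact: H.
Qed.

Lemma ritz_error_H1 s v w : (s <= r)%N -> inHH s.+1 v -> wd v (dx v) -> ritz v w ->
  L2norm (dx w - dx v) <= CA * h ^+ s * Hnorm s.+1 v.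
Proof.
move=> sr hv vv rw; rewrite -(ler_pM2l h_gt0).
apply/ler_addgt0Pr => e e0; have [chi Schi Hc] := approx_eps sr hv vv e0.
apply: (@le_trans _ _ (h * L2norm (dx chi - dx v))).
  apply: (ler_wpM2l (ltW h_gt0)); exact: (ritz_best vv rw Schi).
by apply: le_trans Hc _; rewrite lerD2r; apply: le_of_eq; rewrite exprS; ring.
Qed.

(** The duality argument of Aubin and Nitsche. The dual problem
    [- psi'' = rho], [psi 0 = 0], [psi' 1 = 0] is solved by two integrations, so
    its regularity is immediate: Poincare's inequality for [psi'] and [psi] and
    [- psi'' = rho] itself give [Hnorm 2 psi <= 3 * L2norm rho]. Approximating
    [psi] gains the factor [h]. *)
Lemma ritz_error_L2 v v' w : wd v v' -> v 0 = 0 -> ritz v w ->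
  L2norm (w - v) <= 3 * CA * h * L2norm (dx w - v').
Proof.
move=> vv v0 rw; have Sw := rw.1; have ww := S_wd Sw.
pose rho := w - v; pose rho' := dx w - v'.
have rr : wd rho rho' by exact: wdB.
have r0 : rho 0 = 0 by rewrite /rho !fctE v0 (S_0 Sw) subr0.
have lr := wd_L2 rr; have lr' := rr.1.
pose q : V := fun x => cint `[0, 1] rho - cint `[0, x] rho.
have cint0 (f : V) : cint `[0, 0] f = 0.
  by rewrite /cint set_itv1 !Rintegral_set1.
have qq : wd q (- rho).
  have := wdN (v := fun x => - q x) (g := rho) _.
  have -> : - (fun x => - q x) = q by apply/funext => x; rewrite !fctE opprK.
  apply; split=> // x xb; rewrite /q cint0; ring.
have q1 : q 1 = 0 by rewrite /q subrr.
pose psi : V := fun x => cint `[0, x] q.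
have psi0 : psi 0 = 0 by rewrite /psi cint0.
have pp : wd psi q.
  by split; [exact: wd_L2 qq|move=> x xb; rewrite psi0 add0r].
have [rre rim] := (wdP _ _).1 rr; have [qre qim] := (wdP _ _).1 qq.
have [pre pim] := (wdP _ _).1 pp.
have crr := wdr_cont rre; have cri := wdr_cont rim.
have cont_oppr (f : R -> R) : {within `[0, 1], continuous f} ->
    {within `[0, 1], continuous (fun x => - f x)}.
  move=> /within_itvP H; apply/within_itvP => x xb e e0.
  have [d d0 Hd] := H x xb e e0; exists d => // y yb yx.
  by rewrite -opprD normrN; exact: Hd.
have cnr : {within `[0, 1], continuous (fun x => complex.Re ((- rho) x))}.
  rewrite (_ : (fun x => _) = fun x => - complex.Re (rho x)); first exact: cont_oppr.
  by apply/funext => x; rewrite ReN.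
have cni : {within `[0, 1], continuous (fun x => complex.Im ((- rho) x))}.
  rewrite (_ : (fun x => _) = fun x => - complex.Im (rho x)); first exact: cont_oppr.
  by apply/funext => x; rewrite ImN.
pose F l : V := if l is 0%N then psi else if l is 1%N then q else - rho.
have [hpsi psiE] : inH 2 psi /\
    forall l, (l <= 2)%N -> forall x, x \in `[0, 1] -> cderivn 1 l psi x = F l x.
  apply: chain_inH => //.
    case=> [|[|[|//]]] _ /=; split => //.
    - exact: wdr_cont pre.
    - exact: wdr_cont pim.
    - exact: wdr_cont qre.
    - exact: wdr_cont qim.
  case=> [|[|//]] _ x xb /=; split.
  - exact: wdr_rderiv pre (wdr_cont qre) x xb.
  - exact: wdr_rderiv pim (wdr_cont qim) x xb.
  - exact: wdr_rderiv qre cnr x xb.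
  - exact: wdr_rderiv qim cni x xb.
have nq : L2norm q <= L2norm rho.
  rewrite -(L2normN lr); apply: (wd_poincare qq _ q1).
  by rewrite in_itv/= lexx ler01.
have npsi : L2norm psi <= L2norm rho.
  apply: le_trans nq; apply: (wd_poincare pp _ psi0).
  by rewrite in_itv/= lexx ler01.
have nH : Hnorm 2 psi <= 3 * L2norm rho.
  apply: Hnorm_le; first exact: L2norm_ge0.
  move=> l l2; rewrite (eq_L2norm (f' := F l)); last first.
    by move=> x /sub_oo_cc xb; rewrite psiE.
  by case: l l2 => [|[|[|//]]] _ //=; rewrite L2normN.
have lq := wd_L2 qq.
have key : h * L2norm rho ^+ 2 <= 3 * CA * h ^+ 2 * L2norm rho' * L2norm rho.
  apply/ler_addgt0Pr => e e0.
  have e10 : 0 < e / (L2norm rho' + 1) by rewrite divr_gt0// ltr_wpDl ?L2norm_ge0.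
  have [chi Schi Hc] := approx_eps r_ge1 (conj hpsi psi0) pp e10.
  have lc := (S_wd Schi).1.
  have E : L2norm rho ^+ 2 = ip rho' (q - dx chi).
    rewrite (ipBr lq lc lr') (ritz_ort vv rw Schi) subr0 (wd_ibp rr qq r0 q1).
    by rewrite (ipNr lr lr) opprK L2norm_sq.
  have lqc : inL2 (q - dx chi) := L2B lq lc.
  have h1 := ip_CS lr' lqc.
  have h2 : h * L2norm (q - dx chi) <= CA * h ^+ 2 * (3 * L2norm rho) + e / (L2norm rho' + 1).
    rewrite -L2normN// opprB; apply: le_trans Hc _; rewrite lerD2r ler_wpM2l//.
    by rewrite mulr_ge0// exprn_ge0// ltW.
  have n0 := L2norm_ge0 rho'.
  have : h * L2norm rho ^+ 2 <= L2norm rho' * (h * L2norm (q - dx chi)).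
    by rewrite E mulrCA; apply: (ler_wpM2l (ltW h_gt0)).
  move=> /le_trans; apply.
  apply: le_trans (ler_wpM2l n0 h2) _; rewrite mulrDr lerD//.
    by apply: le_of_eq; ring.
  by rewrite mulrCA ger_pMr// ler_pdivrMr ?mul1r ?lerDl// ltr_wpDl.
have [z|z] := eqVneq (L2norm rho) 0.
  by rewrite -/rho z !mulr_ge0 ?L2norm_ge0// ltW.
have z0 : 0 < L2norm rho by rewrite lt_def z L2norm_ge0.
rewrite -/rho -/rho' -(ler_pM2r z0) -(ler_pM2l h_gt0).
by apply: le_trans key _; apply: le_of_eq; ring.
Qed.

Section Stability.
Variables (CI : R).
Hypothesis CI_ge0 : 0 <= CI.
Hypothesis inverse : forall phi, S phi -> H1semi phi <= CI * h^-1 * L2norm phi.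

(** The L^2 projection [p] of [v] is compared with the elliptic one [w], which is
    bounded in H^1. The difference [p - w] is the L^2 projection of [v - w],
    which is of order [h], and the inverse inequality loses only [h^-1]. *)
Lemma L2proj_H1_stable v v' p : wd v v' -> v 0 = 0 -> L2proj v p ->
  L2norm (dx p) <= (3 * CA * CI + 2) * L2norm v'.
Proof.
move=> vv v0 [Sp pE]; have [w rw] : exists w, ritz v w by apply: ritz_exists; exists v'.
have Sw := rw.1; have ww := S_wd Sw; have pp := S_wd Sp.
have lv := wd_L2 vv; have lw := wd_L2 ww; have lp := wd_L2 pp.
have lv' := vv.1; have lw' := ww.1; have lp' := pp.1.
have Spw := S_B Sp Sw.
have lpw : inL2 (p - w) := L2B lp lw.
have lvw : inL2 (v - w) := L2B lv lw.
have n1 : L2norm (p - w) <= L2norm (w - v).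
  rewrite -(L2normN (L2B lw lv)) opprB; apply: (L2norm_le_ip lpw lvw).
  by rewrite (ipBl lp lw lpw) (pE _ Spw) -(ipBl lv lw lpw) ip_sym.
have n2 := ritz_error_L2 vv v0 rw.
have n3 := ritz_error_le vv rw.
have n4 := inverse Spw; rewrite /H1semi (wd_L2norm (wdB pp ww)) in n4.
have n5 : L2norm (dx p - dx w) <= 3 * CA * CI * L2norm v'.
  apply: le_trans n4 _; rewrite -mulrA.
  apply: (@le_trans _ _ (CI * (h^-1 * (3 * CA * h * L2norm v')))).
    rewrite ler_wpM2l// ler_wpM2l ?invr_ge0 ?(ltW h_gt0)//.
    apply: le_trans n1 _; apply: le_trans n2 _; rewrite ler_wpM2l//.
    by rewrite !mulr_ge0// ltW.
  by apply: le_of_eq; field; rewrite gt_eqF.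
have lpw' : inL2 (dx p - dx w) := L2B lp' lw'.
have lwv' : inL2 (dx w - v') := L2B lw' lv'.
rewrite (_ : dx p = (dx p - dx w) + ((dx w - v') + v')); last first.
  by apply/funext => x; rewrite !fctE; ring.
apply: le_trans (L2normD lpw' (L2D lwv' lv')) _.
rewrite mulrDl; apply: lerD n5 _; apply: le_trans (L2normD lwv' lv') _.
by rewrite mulr_natl mulr2n; exact: lerD n3 (lexx _).
Qed.

End Stability.
End Approximation.
End Subspace.
End FiniteElementSpace.

(** * Smooth functions of time with values in L^2 *)

Section TwoVariables.
Context {R : realType}.
Variable T : R.
Implicit Type g : R -> R -> R.

Lemma within2P g :
  {within (`[0, T] `*` `[0, 1] : set (R * R)), continuous (fun p => g p.1 p.2)} ->
  forall t x, t \in `[0, T] -> x \in `[0, 1] -> forall e, 0 < e ->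
  exists2 d, 0 < d & forall s y, s \in `[0, T] -> y \in `[0, 1] ->
    `|s - t| < d -> `|y - x| < d -> `|g s y - g t x| <= e.
Proof.
move=> /subspace_continuousP gc t x tb xb e e0.
have /cvgrPdist_le /(_ e e0) := gc (t, x) (conj tb xb).
rewrite /within/= => -[[A B] /= [[d d0 dA] [d' d'0 dB]] AB].
exists (Num.min d d'); first by rewrite lt_min; apply/andP.
move=> s y sb yb; rewrite !lt_min => /andP[sd _] /andP[_ yd].
rewrite distrC; apply: (AB (s, y)) => //; split => /=.
  by apply: dA; rewrite /ball_/= distrC.
by apply: dB; rewrite /ball_/= distrC.
Qed.

Lemma within2_slice g t : t \in `[0, T] ->
  {within (`[0, T] `*` `[0, 1] : set (R * R)), continuous (fun p => g p.1 p.2)} ->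
  {within `[0, 1], continuous (g t)}.
Proof.
move=> tb gc; apply/within_itvP => x xb e e0.
have [d d0 H] := within2P gc tb xb e0; exists d => // y yb yx.
by apply: H => //; rewrite subrr normr0.
Qed.

Lemma within2_bounded g :
  {within (`[0, T] `*` `[0, 1] : set (R * R)), continuous (fun p => g p.1 p.2)} ->
  exists2 M, 0 <= M & forall t x, t \in `[0, T] -> x \in `[0, 1] -> `|g t x| <= M.
Proof.
move=> gc.
have cK : compact (`[0, T] `*` `[0, 1] : set (R * R)).
  by apply: compact_setX; exact: segment_compact.
have /compact_bounded[M [_ MH]] := continuous_compact gc cK.
exists (`|M| + 1); first by rewrite addr_ge0.
move=> t x tb xb; apply: (MH (`|M| + 1)).
  by rewrite (le_lt_trans (ler_norm M))// ltrDl.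
by exists (t, x).
Qed.

(** Uniformity in [x] comes from the compactness of [[0, 1]]. *)
Lemma within2_tube g t e : t \in `[0, T] -> 0 < e ->
  {within (`[0, T] `*` `[0, 1] : set (R * R)), continuous (fun p => g p.1 p.2)} ->
  exists2 d, 0 < d & forall s x, s \in `[0, T] -> x \in `[0, 1] -> `|s - t| < d ->
    `|g s x - g t x| <= e.
Proof.
move=> tb e0 gc.
have cK : compact (`[0, 1]%classic : set R) by exact: segment_compact.
have e20 : 0 < e / 2 by rewrite divr_gt0.
pose P (s x : R) := s \in `[0, T] -> x \in `[0, 1] -> `|g s x - g t x| <= e.
have := (compact_near_coveringP _).1 cK R (nbhs t) P _.
case.
  move=> x xb; have [d d0 H] := within2P gc tb xb e20.
  exists (ball x d, ball t d) => /=; first by split; exact: nbhsx_ballx.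
  move=> [y s] [/= xy ts] sb yb.
  have h1 : `|y - x| < d by rewrite distrC.
  have h2 : `|s - t| < d by rewrite distrC.
  rewrite [e]splitr -[X in `|X|](subrKA (g t x)).
  rewrite (le_trans (ler_normD _ _))// lerD ?H//.
  by rewrite distrC H// subrr normr0.
move=> d /= d0 H; exists d => // s x sb xb st.
by apply: H => //; rewrite /ball_/= distrC.
Qed.

End TwoVariables.

Section MeanValue.
Context {R : realType}.
Variable b : R.
Implicit Types f : R -> R.

Lemma rderiv_bound f f' M x y : x \in `[0, b] -> y \in `[0, b] ->
  (forall x, x \in `[0, b] -> is_rderiv b f x (f' x)) ->
  (forall c, c \in `[0, b] -> `|c - x| <= `|y - x| -> `|f' c| <= M) ->
  `|f y - f x| <= M * `|y - x|.
Proof.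
rewrite !in_itv/= => /andP[x0 xb] /andP[y0 yb] fd H.
have [xy|yx|<-] := ltgtP x y; last by rewrite !subrr normr0 mulr0.
  have [c] := rderiv_MVT x0 xy yb fd; rewrite in_itv/= => /andP[xc cy] ->.
  rewrite normrM ler_wpM2r// H//.
    by rewrite in_itv/=; apply/andP; split; lra.
  by rewrite !gtr0_norm ?subr_gt0//; lra.
have [c] := rderiv_MVT y0 yx xb fd; rewrite in_itv/= => /andP[xc cy] E.
rewrite distrC E normrM (distrC x) ler_wpM2r// H//.
  by rewrite in_itv/=; apply/andP; split; lra.
by rewrite !ltr0_norm ?subr_lt0//; lra.
Qed.

Lemma is_rderiv_lin c x : is_rderiv b (fun y => y - c) x 1.
Proof.
apply/rderivP => e e0; exists 1 => // y _ _.
by rewrite mul1r (_ : _ - _ = 0) ?normr0 ?mulr_ge0 ?(ltW e0)//; ring.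
Qed.

Lemma is_rderiv_quad c x : is_rderiv b (fun y => (y - c) ^+ 2 / 2) x (x - c).
Proof.
apply/rderivP => e e0; exists e => // y _ yx.
rewrite (_ : _ - _ = (y - x) * ((y - x) / 2)); last by field.
rewrite normrM mulrC ler_wpM2r// normrM normfV (ger0_norm (ler0n _ 2)).
by have := normr_ge0 (y - x); lra.
Qed.

Section Taylor.
Variables (f0 f1 f2 : R -> R) (M x y : R).
Hypotheses (xb : x \in `[0, b]) (yb : y \in `[0, b]).
Hypothesis d0 : forall x, x \in `[0, b] -> is_rderiv b f0 x (f1 x).

Lemma taylor1 : (forall x, x \in `[0, b] -> `|f1 x| <= M) ->
  `|f0 y - f0 x| <= M * `|y - x|.
Proof. by move=> H; apply: (rderiv_bound xb yb d0) => c cb _; exact: H. Qed.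

Hypothesis d1 : forall x, x \in `[0, b] -> is_rderiv b f1 x (f2 x).

Lemma taylor2 : (forall x, x \in `[0, b] -> `|f2 x| <= M) ->
  `|f0 y - f0 x - f1 x * (y - x)| <= M * `|y - x| ^+ 2.
Proof.
move=> H; pose g z := f0 z + - f1 x * (z - x).
have dg z : z \in `[0, b] -> is_rderiv b g z (f1 z + - f1 x * 1).
  by move=> zb; apply: is_rderivD; [exact: d0|apply: is_rderivZ; exact: is_rderiv_lin].
have -> : f0 y - f0 x - f1 x * (y - x) = g y - g x by rewrite /g; ring.
rewrite expr2 mulrA; apply: (rderiv_bound xb yb dg) => c cb cx.
rewrite mulr1; apply: (@le_trans _ _ (M * `|c - x|)).
  by apply: (rderiv_bound xb cb d1) => z zb _; exact: H.
by rewrite ler_wpM2l// (le_trans _ (H _ xb)).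
Qed.

End Taylor.

Lemma taylor3 (f0 f1 f2 f3 : R -> R) M x y :
  x \in `[0, b] -> y \in `[0, b] ->
  (forall x, x \in `[0, b] -> is_rderiv b f0 x (f1 x)) ->
  (forall x, x \in `[0, b] -> is_rderiv b f1 x (f2 x)) ->
  (forall x, x \in `[0, b] -> is_rderiv b f2 x (f3 x)) ->
  (forall x, x \in `[0, b] -> `|f3 x| <= M) ->
  `|f0 y - f0 x - f1 x * (y - x) - f2 x * ((y - x) ^+ 2 / 2)| <= M * `|y - x| ^+ 3.
Proof.
move=> xb yb d0 d1 d2 H.
pose g z := f0 z + (- f1 x * (z - x) + - f2 x * ((z - x) ^+ 2 / 2)).
have dg z : z \in `[0, b] ->
    is_rderiv b g z (f1 z + (- f1 x * 1 + - f2 x * (z - x))).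
  move=> zb; apply: is_rderivD; first exact: d0.
  apply: is_rderivD; apply: is_rderivZ; first exact: is_rderiv_lin.
  exact: is_rderiv_quad.
have -> : f0 y - f0 x - f1 x * (y - x) - f2 x * ((y - x) ^+ 2 / 2) = g y - g x.
  by rewrite /g; field.
rewrite exprS mulrCA mulrC; apply: (rderiv_bound xb yb dg) => c cb cx.
apply: (@le_trans _ _ (M * `|c - x| ^+ 2)).
  have := taylor2 xb cb d1 d2 H; congr (`|_| <= _); ring.
by rewrite ler_wpM2l// ?lerXn2r ?nnegrE// (le_trans _ (H _ xb)).
Qed.

End MeanValue.

Section TimeFamilies.
Context {R : realType}.
Variables (T : R) (T_gt0 : 0 < T).
Notation V := (R -> R[i]).
Notation D := (`]0, 1[%classic : set R).
Implicit Types (F G : R -> V).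

Lemma ccontinuous2_slice F t : ccontinuous2 T F -> t \in `[0, T] ->
  {within `[0, 1], continuous (fun x => complex.Re (F t x))} /\
  {within `[0, 1], continuous (fun x => complex.Im (F t x))}.
Proof.
move=> [cr ci] tb; split.
  exact: (@within2_slice _ _ (fun t x => complex.Re (F t x)) _ tb cr).
exact: (@within2_slice _ _ (fun t x => complex.Im (F t x)) _ tb ci).
Qed.

Lemma ccontinuous2_L2 F t : ccontinuous2 T F -> t \in `[0, T] -> inL2 (F t).
Proof. by move=> cF tb; have [? ?] := ccontinuous2_slice cF tb; exact: within_L2. Qed.

Lemma L2norm_sup (z : V) eta : inL2 z ->
  (forall x, D x -> `|complex.Re (z x)| <= eta /\ `|complex.Im (z x)| <= eta) ->
  L2norm z <= 2 * eta.
Proof.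
move=> lz H.
have e0 : 0 <= eta.
  have [|+ _] := H (1 / 2); first by rewrite /= in_itv/=; apply/andP; split; lra.
  exact: le_trans.
rewrite -(@ler_pXn2r _ 2%N) ?nnegrE ?L2norm_ge0 ?mulr_ge0// L2norm_sq.
rewrite -[leRHS]Rint_unit.
apply: le_Rintegral => //.
- exact: ip_intg.
- exact: (sqint_intg (sqint_cst _)).
move=> x /H[h1 h2]; rewrite -!expr2 -(real_normK (num_real (complex.Re _))).
rewrite -(real_normK (num_real (complex.Im _))).
have := normr_ge0 (complex.Re (z x)); have := normr_ge0 (complex.Im (z x)); nra.
Qed.

Lemma ccontinuous2_L2norm_bounded F : ccontinuous2 T F ->
  exists M, forall t, t \in `[0, T] -> L2norm (F t) <= M.
Proof.
move=> cF; have [M1 M10 H1] := within2_bounded (g := fun t x => complex.Re (F t x)) cF.1.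
have [M2 M20 H2] := within2_bounded (g := fun t x => complex.Im (F t x)) cF.2.
exists (2 * (M1 + M2)) => t tb; apply: L2norm_sup; first exact: ccontinuous2_L2.
move=> x /sub_oo_cc xb; have := H1 t x tb xb; have := H2 t x tb xb => h1 h2.
by split; lra.
Qed.

(** Time derivatives after pairing with a fixed function: in this form mean value
    and Taylor estimates for real functions apply to functions of time with
    values in L^2. *)
Definition sder F G := forall w, inL2 w -> forall t, t \in `[0, T] ->
  is_rderiv T (fun s => ip (F s) w) t (ip (G t) w).

(** Differentiation under the integral: the remainder is bounded uniformly in [x]
    by the mean value theorem and the uniform continuity of [G] near [t]. *)
Lemma ip_rderiv F G : ccontinuous2 T F -> ccontinuous2 T G ->
  (forall t x, t \in `[0, T] -> x \in `[0, 1] ->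
     is_cderiv T (fun s => F s x) t (G t x)) -> sder F G.
Proof.
move=> cF cG FG w lw t tb; apply/rderivP => e e0.
have c0 : 0 < 2 * (L2norm w + 1) by rewrite mulr_gt0// ltr_wpDl ?L2norm_ge0.
pose eta := e / (2 * (L2norm w + 1)).
have eta0 : 0 < eta by rewrite divr_gt0.
have [d1 d10 H1] := within2_tube (g := fun t x => complex.Re (G t x)) tb eta0 cG.1.
have [d2 d20 H2] := within2_tube (g := fun t x => complex.Im (G t x)) tb eta0 cG.2.
exists (Num.min d1 d2); first by rewrite lt_min d10.
move=> s sb; rewrite lt_min => /andP[sd1 sd2].
have lFs := ccontinuous2_L2 cF sb; have lFt := ccontinuous2_L2 cF tb.
have lGt := ccontinuous2_L2 cG tb.
pose z := F s - F t - K (s - t) * G t.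
have lKG : inL2 (K (s - t) * G t) by exact: L2K.
have lz : inL2 z by apply: L2B => //; exact: L2B.
have -> : ip (F s) w - ip (F t) w - ip (G t) w * (s - t) = ip z w.
  by rewrite /z !ipBl ?ipZl//; [ring|exact: L2B].
have key (f f' : R -> R) d : (forall s, s \in `[0, T] -> is_rderiv T f s (f' s)) ->
    `|s - t| < d -> (forall c, c \in `[0, T] -> `|c - t| < d -> `|f' c - f' t| <= eta) ->
    `|f s - f t - (s - t) * f' t| <= eta * `|s - t|.
  move=> fd sd H; pose g r := f r + - f' t * (r - t).
  have dg r : r \in `[0, T] -> is_rderiv T g r (f' r + - f' t * 1).
    by move=> rb; apply: is_rderivD; [exact: fd|apply: is_rderivZ; exact: is_rderiv_lin].
  have -> : f s - f t - (s - t) * f' t = g s - g t by rewrite /g; ring.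
  apply: (rderiv_bound tb sb dg) => c cb cs; rewrite mulr1; apply: H => //.
  exact: le_lt_trans sd.
apply: le_trans (ip_CSn lz lw) _.
apply: (@le_trans _ _ ((2 * (eta * `|s - t|)) * L2norm w)).
  rewrite ler_wpM2r ?L2norm_ge0//; apply: L2norm_sup => // x /sub_oo_cc xb.
  rewrite /z !fctE /K !ReD !ImD !ReN !ImN ReK ImK; split.
    apply: (key (fun s => complex.Re (F s x)) (fun s => complex.Re (G s x)) d1) => //.
      by move=> r rb; exact: (FG r x rb xb).1.
    by move=> c cb cd; exact: H1.
  apply: (key (fun s => complex.Im (F s x)) (fun s => complex.Im (G s x)) d2) => //.
    by move=> r rb; exact: (FG r x rb xb).2.
  by move=> c cb cd; exact: H2.
have <- : eta * (2 * (L2norm w + 1)) = e by rewrite /eta divfK// gt_eqF.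
have : 0 <= eta * `|s - t| by rewrite mulr_ge0// ltW.
clear => *; lra.
Qed.

Section Quadrature.
Variables (F0 F1 F2 F3 : R -> V).
Variable (M : R).
Hypotheses (l0 : forall t, t \in `[0, T] -> inL2 (F0 t))
  (l1 : forall t, t \in `[0, T] -> inL2 (F1 t)).
Hypotheses (s0 : sder F0 F1) (M0 : 0 <= M).

Let ipM (F : R -> V) (w : V) : inL2 w ->
  (forall t, t \in `[0, T] -> inL2 (F t)) ->
  (forall t, t \in `[0, T] -> L2norm (F t) <= M) ->
  forall t, t \in `[0, T] -> `|ip (F t) w| <= M * L2norm w.
Proof.
move=> lw lF FM t tb; apply: le_trans (ip_CSn (lF t tb) lw) _.
by rewrite ler_wpM2r ?L2norm_ge0// FM.
Qed.

Lemma L2norm_increment a b : a \in `[0, T] -> b \in `[0, T] ->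
  (forall t, t \in `[0, T] -> L2norm (F1 t) <= M) ->
  L2norm (F0 b - F0 a) <= M * `|b - a|.
Proof.
move=> ab bb FM; have la := l0 ab; have lb := l0 bb.
apply: L2norm_le_dual; [exact: L2B|by rewrite mulr_ge0|].
move=> w lw; rewrite ipBl// mulrAC (le_trans (ler_norm _))//.
by apply: (taylor1 ab bb (s0 lw)); exact: ipM.
Qed.

Let mid_in a b : a \in `[0, T] -> b \in `[0, T] -> (a + b) / 2 \in `[0, T].
Proof.
by rewrite !in_itv/= => /andP[? ?] /andP[? ?]; apply/andP; split; lra.
Qed.

Hypotheses (l2 : forall t, t \in `[0, T] -> inL2 (F2 t)) (s1 : sder F1 F2).

Lemma average_midpoint a b : a \in `[0, T] -> b \in `[0, T] -> 
  (forall t, t \in `[0, T] -> L2norm (F2 t) <= M) ->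
  L2norm (K (1 / 2) * (F0 b + F0 a) - F0 ((a + b) / 2)) <= M * `|b - a| ^+ 2.
Proof.
move=> ab bb FM; have mb := mid_in ab bb; set m := (a + b) / 2 in mb *.
have la := l0 ab; have lb := l0 bb; have lm := l0 mb.
have lab : inL2 (F0 b + F0 a) by exact: L2D.
have lK : inL2 (K (1 / 2) * (F0 b + F0 a)) by exact: L2K.
apply: L2norm_le_dual; [exact: L2B|by rewrite mulr_ge0// exprn_ge0|].
move=> w lw; rewrite ipBl// ipZl// ipDl// mulrAC.
have h1 := taylor2 mb bb (s0 lw) (s1 lw) (ipM lw l2 FM).
have h2 := taylor2 mb ab (s0 lw) (s1 lw) (ipM lw l2 FM).
have E1 : b - m = (b - a) / 2 by rewrite /m; field.
have E2 : a - m = - ((b - a) / 2) by rewrite /m; field.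
move: h1 h2; rewrite E1 E2 normrN !real_normK ?num_real//.
have Mw : 0 <= M * L2norm w * (b - a) ^+ 2.
  by rewrite mulr_ge0 ?sqr_ge0// mulr_ge0 ?L2norm_ge0.
rewrite !ler_norml => /andP[_ h1] /andP[_ h2]; rewrite expr_div_n in h1 h2; nra.
Qed.

Hypotheses (l3 : forall t, t \in `[0, T] -> inL2 (F3 t)) (s2 : sder F2 F3).

Lemma central_difference a b : a \in `[0, T] -> b \in `[0, T] -> a < b ->
  (forall t, t \in `[0, T] -> L2norm (F3 t) <= M) ->
  L2norm (K (b - a)^-1 * (F0 b - F0 a) - F1 ((a + b) / 2)) <= M * (b - a) ^+ 2.
Proof.
move=> ab bb altb FM; have mb := mid_in ab bb; set m := (a + b) / 2 in mb *.
have la := l0 ab; have lb := l0 bb; have lm := l1 mb.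
have lab : inL2 (F0 b - F0 a) by exact: L2B.
have lK : inL2 (K (b - a)^-1 * (F0 b - F0 a)) by exact: L2K.
have k0 : 0 < b - a by rewrite subr_gt0.
apply: L2norm_le_dual; [exact: L2B|by rewrite mulr_ge0// exprn_ge0// ltW|].
move=> w lw; rewrite ipBl// ipZl// ipBl//.
have h1 := taylor3 mb bb (s0 lw) (s1 lw) (s2 lw) (ipM lw l3 FM).
have h2 := taylor3 mb ab (s0 lw) (s1 lw) (s2 lw) (ipM lw l3 FM).
have E1 : b - m = (b - a) / 2 by rewrite /m; field.
have E2 : a - m = - ((b - a) / 2) by rewrite /m; field.
move: h1 h2; rewrite E1 E2 normrN sqrrN (ger0_norm (_ : 0 <= (b - a) / 2)) ?divr_ge0 ?(ltW k0)//.
move=> h1 h2.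
have Mw : 0 <= M * L2norm w by rewrite mulr_ge0 ?L2norm_ge0.
rewrite -(ler_pM2l k0).
rewrite (_ : (b - a) * ((b - a)^-1 * (ip (F0 b) w - ip (F0 a) w) - ip (F1 m) w)
  = ip (F0 b) w - ip (F0 a) w - (b - a) * ip (F1 m) w); last by field; rewrite gt_eqF.
have k3 : 0 <= (b - a) ^+ 3 by rewrite exprn_ge0// ltW.
have := mulr_ge0 Mw k3.
move=> p; move: h1 h2; rewrite !ler_norml => /andP[h1 h1'] /andP[h2 h2'].
rewrite expr_div_n in h1 h1' h2 h2'; nra.
Qed.

(** By Taylor's formula at the midpoints, the error on a step of length [k] is
    [k ^ 2 / 8] times the second derivative at the midpoint, up to [k ^ 3]. The
    leading terms of two consecutive steps nearly cancel: the second derivatives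
    at the two midpoints differ by [c - a], and the squares of the steps by
    [(c - a) * (Cs * kappa ^ 2)]. So a full factor [c - a] is gained over
    [average_midpoint], which makes the differences summable. *)
Lemma average_midpoint_diff a b c kappa Cs :
  a \in `[0, T] -> b \in `[0, T] -> c \in `[0, T] -> a < b -> b < c ->
  b - a <= kappa -> c - b <= kappa -> 0 <= Cs ->
  `|(c - b) - (b - a)| <= Cs * kappa ^+ 2 ->
  (forall t, t \in `[0, T] -> L2norm (F2 t) <= M) ->
  (forall t, t \in `[0, T] -> L2norm (F3 t) <= M) ->
  L2norm ((K (1 / 2) * (F0 c + F0 b) - F0 ((b + c) / 2))
          - (K (1 / 2) * (F0 b + F0 a) - F0 ((a + b) / 2)))
  <= (1 + Cs) * M * kappa ^+ 2 * (c - a).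
Proof.
move=> ab bb cb altb bltc kk kk' Cs0 mesh FM2 FM3.
have mb := mid_in ab bb; set m := (a + b) / 2 in mb *.
have mb' := mid_in bb cb; set m' := (b + c) / 2 in mb' *.
have la := l0 ab; have lb := l0 bb; have lm := l0 mb.
have lc := l0 cb; have lm' := l0 mb'.
have lab : inL2 (F0 b + F0 a) by exact: L2D.
have lK : inL2 (K (1 / 2) * (F0 b + F0 a)) by exact: L2K.
have lab' : inL2 (F0 c + F0 b) by exact: L2D.
have lK' : inL2 (K (1 / 2) * (F0 c + F0 b)) by exact: L2K.
have ld : inL2 (K (1 / 2) * (F0 b + F0 a) - F0 m) by exact: L2B.
have ld' : inL2 (K (1 / 2) * (F0 c + F0 b) - F0 m') by exact: L2B.
have ca0 : 0 <= c - a by lra.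
apply: L2norm_le_dual; [exact: L2B| |].
  by rewrite mulr_ge0// mulr_ge0 ?sqr_ge0// mulr_ge0// addr_ge0.
move=> w lw; rewrite ipBl// !(ipBl lK)// !(ipBl lK')// !ipZl// !ipDl//.
have h1 := taylor3 mb bb (s0 lw) (s1 lw) (s2 lw) (ipM lw l3 FM3).
have h2 := taylor3 mb ab (s0 lw) (s1 lw) (s2 lw) (ipM lw l3 FM3).
have h3 := taylor3 mb' cb (s0 lw) (s1 lw) (s2 lw) (ipM lw l3 FM3).
have h4 := taylor3 mb' bb (s0 lw) (s1 lw) (s2 lw) (ipM lw l3 FM3).
have h5 := taylor1 mb mb' (s2 lw) (ipM lw l3 FM3).
have h6 := ipM lw l2 FM2 mb'.
have E1 : b - m = (b - a) / 2 by rewrite /m; field.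
have E2 : a - m = - ((b - a) / 2) by rewrite /m; field.
have E3 : c - m' = (c - b) / 2 by rewrite /m'; field.
have E4 : b - m' = - ((c - b) / 2) by rewrite /m'; field.
have E5 : m' - m = (c - a) / 2 by rewrite /m /m'; field.
move: h1 h2 h3 h4 h5; rewrite E1 E2 E3 E4 E5.
rewrite !normrN !sqrrN !(ger0_norm (_ : 0 <= _ / 2)) ?divr_ge0//; [|lra..].
move: mesh h6; set k := b - a in kk *; set k' := c - b in kk' *.
have -> : c - a = k + k' by rewrite /k /k'; ring.
have k0 : 0 < k by rewrite subr_gt0.
have k'0 : 0 < k' by rewrite subr_gt0.
set W := L2norm w; have W0 : 0 <= W by exact: L2norm_ge0.
set fa := ip (F0 a) w; set fb := ip (F0 b) w; set fc := ip (F0 c) w.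
set fm := ip (F0 m) w; set fm' := ip (F0 m') w.
set gm := ip (F1 m) w; set gm' := ip (F1 m') w.
set pm := ip (F2 m) w; set pm' := ip (F2 m') w.
have MW : 0 <= M * W by rewrite mulr_ge0.
move=> mesh h6 h1 h2 h3 h4 h5.
clearbody k k'.
have kk0 : 0 <= k + k' by exact: addr_ge0 (ltW k0) (ltW k'0).
have A : (1 / 2 * (fc + fb) - fm') - (1 / 2 * (fb + fa) - fm) <=
   M * W * (k ^+ 3 + k' ^+ 3) / 8 + (k' ^+ 2 * pm' - k ^+ 2 * pm) / 8.
  move: h1 h2 h3 h4; rewrite !ler_norml => /andP[h1 _] /andP[h2 _] /andP[_ h3] /andP[_ h4].
  rewrite !expr_div_n in h1 h2 h3 h4; move: h1 h2 h3 h4; clear => *; lra.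
have B : (k' ^+ 2 - k ^+ 2) * pm' <= (k + k') * (Cs * kappa ^+ 2) * (M * W).
  rewrite (_ : (k' ^+ 2 - k ^+ 2) * pm' = (k + k') * ((k' - k) * pm')); last by ring.
  rewrite -[leRHS]mulrA ler_wpM2l//.
  by apply: le_trans (ler_norm _) _; rewrite normrM ler_pM.
have kappa0 : 0 <= kappa := le_trans (ltW k0) kk.
have k2 : k ^+ 2 <= kappa ^+ 2 by rewrite lerXn2r ?nnegrE// ltW.
have k'2 : k' ^+ 2 <= kappa ^+ 2 by rewrite lerXn2r ?nnegrE// ltW.
have C : k ^+ 2 * (pm' - pm) <= kappa ^+ 2 * (M * W * ((k + k') / 2)).
  apply: (@le_trans _ _ (k ^+ 2 * (M * W * ((k + k') / 2)))).
    by rewrite ler_wpM2l ?sqr_ge0//; apply: le_trans (ler_norm _) _.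
  by rewrite ler_wpM2r// mulr_ge0// divr_ge0.
have E : k ^+ 3 + k' ^+ 3 <= kappa ^+ 2 * (k + k').
  by rewrite [k ^+ 3]exprSr [k' ^+ 3]exprSr mulrDr lerD// ler_wpM2r// ltW.
have F : M * W * (k ^+ 3 + k' ^+ 3) <= M * W * (kappa ^+ 2 * (k + k')).
  by rewrite ler_wpM2l.
have P : 0 <= M * W * (kappa ^+ 2 * (k + k')).
  by rewrite mulr_ge0// mulr_ge0 ?sqr_ge0.
have P' : 0 <= Cs * (M * W * (kappa ^+ 2 * (k + k'))) by rewrite mulr_ge0.
apply: le_trans A _; move: B C F P P'; clear => *; lra.
Qed.

End Quadrature.

End TimeFamilies.

(** * The solution: derivatives, norms, boundary values *)

(** The maximal norms in the error bounds are written with iterated one-sided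
    derivatives, whereas the estimates use the family [D m l] of mixed
    derivatives. This part identifies the two. *)

Section SmoothSolutions.
Context {R : realType}.
Notation V := (R -> R[i]).
Variables (T : R) (T_gt0 : 0 < T).

Lemma max_time_ge (g : R -> R) M t : (forall t, t \in `[0, T] -> g t <= M) ->
  t \in `[0, T] -> g t <= max_time T g.
Proof.
move=> gM tb; apply: ub_le_sup; last by exists t.
by exists M => _ [s sb <-]; exact: gM.
Qed.

Lemma finite_bound (P : nat -> R -> Prop) s :
  (forall l M M', M <= M' -> P l M -> P l M') ->
  (forall l, (l <= s)%N -> exists M, P l M) ->
  exists M, forall l, (l <= s)%N -> P l M.
Proof.
move=> mono; elim: s => [H|s IH H].
  by have [M HM] := H 0%N isT; exists M => -[].
have [|M HM] := IH; first by move=> l ls; apply: H; exact: leqW.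
have [M' HM'] := H s.+1 (leqnn _); exists (Num.max M M') => l.
rewrite leq_eqVlt => /predU1P[->|ls].
  by apply: mono HM'; rewrite le_max lexx orbT.
by apply: mono (HM l ls); rewrite le_max lexx.
Qed.

Variables (I : nat -> nat -> bool) (u : R -> V) (D : nat -> nat -> R -> V).
Hypothesis I_down : forall m l m' l', (m' <= m)%N -> (l' <= l)%N -> I m l -> I m' l'.
Hypothesis D00 : forall t x, t \in `[0, T] -> x \in `[0, 1] -> D 0%N 0%N t x = u t x.
Hypothesis Dcont : forall m l, I m l -> ccontinuous2 T (D m l).
Hypothesis Dt : forall m l, I m.+1 l -> forall t x, t \in `[0, T] -> x \in `[0, 1] ->
  is_cderiv T (fun s => D m l s x) t (D m.+1 l t x).
Hypothesis Dx : forall m l, I m l.+1 -> forall t x, t \in `[0, T] -> x \in `[0, 1] ->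
  is_cderiv 1 (D m l t) x (D m l.+1 t x).

Lemma D_L2 m l t : I m l -> t \in `[0, T] -> inL2 (D m l t).
Proof. by move=> /Dcont Dc tb; exact: ccontinuous2_L2 tb. Qed.

Lemma D_wd m l t : I m l.+1 -> t \in `[0, T] -> wd (D m l t) (D m l.+1 t).
Proof.
move=> Il tb; have [c1 c2] := ccontinuous2_slice (Dcont Il) tb.
by apply: wd_classical => // x xb; exact: Dx.
Qed.

Lemma D_sder m l : I m.+1 l -> sder T (D m l) (D m.+1 l).
Proof.
move=> Il; apply: ip_rderiv; [|exact: Dcont|exact: Dt].
by apply: Dcont; exact: I_down Il.
Qed.

Lemma D_bounded m l : I m l -> exists M, forall t, t \in `[0, T] -> L2norm (D m l t) <= M.
Proof. by move=> /Dcont; exact: ccontinuous2_L2norm_bounded. Qed.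

Lemma dtE m t x : I m 0 -> t \in `[0, T] -> x \in `[0, 1] -> dt T m u t x = D m 0%N t x.
Proof.
move=> Im tb xb; rewrite /dt.
apply: (@cderivn_chain _ T (fun l s => D l 0%N s x) m) => //.
  by move=> l lm s sb; apply: Dt => //; exact: I_down Im.
by move=> s sb; rewrite D00.
Qed.

Lemma dxE l t x : I 0 l -> t \in `[0, T] -> x \in `[0, 1] -> dx l u t x = D 0%N l t x.
Proof.
move=> Il tb xb; rewrite /dx.
apply: (@cderivn_chain _ 1 (fun l => D 0%N l t) l) => //.
  by move=> k kl y yb; apply: Dx => //; exact: I_down Il.
by move=> y yb; rewrite D00.
Qed.

Lemma dtdxE m l t x : I m l -> t \in `[0, T] -> x \in `[0, 1] ->
  dt T m (dx l u) t x = D m l t x.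
Proof.
move=> Iml tb xb; rewrite /dt.
apply: (@cderivn_chain _ T (fun k s => D k l s x) m) => //.
  by move=> k km s sb; apply: Dt => //; exact: I_down Iml.
by move=> s sb; rewrite dxE//; exact: I_down Iml.
Qed.

Lemma dt_inH m s t : I m s -> t \in `[0, T] -> inH s (dt T m u t) /\
  forall l, (l <= s)%N -> forall x, x \in `[0, 1] -> cderivn 1 l (dt T m u t) x = D m l t x.
Proof.
move=> Ims tb; apply: (@chain_inH _ (fun l => D m l t)).
- by move=> l ls; apply: ccontinuous2_slice tb; apply: Dcont; exact: I_down Ims.
- by move=> l ls x xb; apply: Dx => //; exact: I_down Ims.
- by move=> x xb; rewrite dtE//; exact: I_down Ims.
Qed.

Lemma D_le_L2max m t : I m 0 -> t \in `[0, T] ->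
  L2norm (D m 0%N t) <= max_time T (fun t => L2norm (dt T m u t)).
Proof.
move=> Im tb; have [M HM] := D_bounded Im.
have E s : s \in `[0, T] -> L2norm (dt T m u s) = L2norm (D m 0%N s).
  by move=> sb; apply: eq_L2norm => x /sub_oo_cc xb; rewrite dtE.
rewrite -E//; apply: (@max_time_ge (fun t => L2norm (dt T m u t)) M) => // s sb.
by rewrite E// HM.
Qed.

Lemma L2max_ge0 m : I m 0 -> 0 <= max_time T (fun t => L2norm (dt T m u t)).
Proof.
move=> Im; have b0 : 0 \in `[0, T] by rewrite in_itv/= lexx ltW.
exact: le_trans (L2norm_ge0 _) (D_le_L2max Im b0).
Qed.

Lemma D_le_dxmax m l t : I m l -> t \in `[0, T] ->
  L2norm (D m l t) <= max_time T (fun t => L2norm (dt T m (dx l u) t)).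
Proof.
move=> Im tb; have [M HM] := D_bounded Im.
have E s : s \in `[0, T] -> L2norm (dt T m (dx l u) s) = L2norm (D m l s).
  by move=> sb; apply: eq_L2norm => x /sub_oo_cc xb; rewrite dtdxE.
rewrite -E//; apply: (@max_time_ge (fun t => L2norm (dt T m (dx l u) t)) M) => // s sb.
by rewrite E// HM.
Qed.

Lemma dxmax_ge0 m l : I m l -> 0 <= max_time T (fun t => L2norm (dt T m (dx l u) t)).
Proof.
move=> Im; have b0 : 0 \in `[0, T] by rewrite in_itv/= lexx ltW.
exact: le_trans (L2norm_ge0 _) (D_le_dxmax Im b0).
Qed.

Lemma Hnorm_le_Hmax m s t : I m s -> t \in `[0, T] ->
  Hnorm s (dt T m u t) <= max_time T (fun t => Hnorm s (dt T m u t)).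
Proof.
move=> Im tb.
have [M HM] : exists M, forall l, (l <= s)%N ->
    forall t, t \in `[0, T] -> L2norm (D m l t) <= M.
  apply: finite_bound => [l M M' MM H t' t'b|l ls].
    exact: le_trans (H _ t'b) MM.
  by apply: D_bounded; exact: I_down Im.
apply: (@max_time_ge (fun t => Hnorm s (dt T m u t)) (s.+1%:R * M)) => // t' t'b.
apply: Hnorm_le; first exact: le_trans (L2norm_ge0 _) (HM 0%N (leq0n s) t' t'b).
move=> l ls; rewrite (eq_L2norm (f' := D m l t')); first exact: HM.
by move=> x /sub_oo_cc xb; rewrite (dt_inH Im t'b).2.
Qed.

Lemma Hmax_ge0 m s : I m s -> 0 <= max_time T (fun t => Hnorm s (dt T m u t)).
Proof.
move=> Im; have b0 : 0 \in `[0, T] by rewrite in_itv/= lexx ltW.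
exact: le_trans (Hnorm_ge0 _ _) (Hnorm_le_Hmax Im b0).
Qed.

Lemma D_le_Hmax m s l t : (l <= s)%N -> I m s -> t \in `[0, T] ->
  L2norm (D m l t) <= max_time T (fun t => Hnorm s (dt T m u t)).
Proof.
move=> ls Im tb; apply: le_trans (Hnorm_le_Hmax Im tb).
apply: le_trans (L2norm_le_Hnorm _ ls).
rewrite (eq_L2norm (f' := D m l t))// => x /sub_oo_cc xb.
by rewrite (dt_inH Im tb).2.
Qed.

Lemma slice_inH s t : I 0 s -> t \in `[0, T] -> inH s (D 0%N 0%N t) /\
  Hnorm s (D 0%N 0%N t) <= s.+1%:R * max_time T (fun t => Hnorm s (dt T 0 u t)).
Proof.
move=> Is tb.
have [h hE] : inH s (D 0%N 0%N t) /\
    forall l, (l <= s)%N -> forall x, x \in `[0, 1] -> cderivn 1 l (D 0%N 0%N t) x = D 0%N l t x.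
  apply: (@chain_inH _ (fun l => D 0%N l t)) => //.
  - by move=> l ls; apply: ccontinuous2_slice tb; apply: Dcont; exact: I_down Is.
  - by move=> l ls x xb; apply: Dx => //; exact: I_down Is.
split=> //; apply: Hnorm_le; first exact: Hmax_ge0.
move=> l ls; rewrite (eq_L2norm (f' := D 0%N l t)); first exact: D_le_Hmax.
by move=> x /sub_oo_cc xb; rewrite hE.
Qed.

(** The elliptic projection commutes with difference quotients, so their
    projection error is controlled by the regularity of the quotients, which is
    that of the first time derivative. *)
Lemma increment_inH s a b : I 1 s -> a \in `[0, T] -> b \in `[0, T] -> a < b ->
  inH s (K (b - a)^-1 * (D 0%N 0%N b - D 0%N 0%N a)) /\
  Hnorm s (K (b - a)^-1 * (D 0%N 0%N b - D 0%N 0%N a))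
    <= s.+1%:R * max_time T (fun t => Hnorm s (dt T 1 u t)).
Proof.
move=> Is ab bb altb; pose k := b - a; have k0 : 0 < k by rewrite subr_gt0.
have I0 l : (l <= s)%N -> I 0 l by move=> ls; exact: I_down Is.
pose F l : V := K k^-1 * (D 0%N l b + K (-1) * D 0%N l a).
have FE l : F l = K k^-1 * (D 0%N l b - D 0%N l a) by rewrite /F -KN1.
have [h hE] : inH s (F 0%N) /\
    forall l, (l <= s)%N -> forall x, x \in `[0, 1] -> cderivn 1 l (F 0%N) x = F l x.
  apply: (@chain_inH _ F) => //.
    move=> l ls; have [c1 c2] := ccontinuous2_slice (Dcont (I0 _ ls)) ab.
    have [c3 c4] := ccontinuous2_slice (Dcont (I0 _ ls)) bb.
    have lin (p q : R -> R) c d : {within `[0, 1], continuous p} ->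
        {within `[0, 1], continuous q} ->
        {within `[0, 1], continuous (fun x => c * (p x + d * q x))}.
      move=> /subspace_continuousP pc /subspace_continuousP qc.
      apply/subspace_continuousP => x xb; apply: cvgM; first exact: cvg_cst.
      by apply: cvgD; [exact: pc|apply: cvgM; [exact: cvg_cst|exact: qc]].
    split.
      have -> : (fun x => complex.Re (F l x)) = (fun x =>
          k^-1 * (complex.Re (D 0%N l b x) + -1 * complex.Re (D 0%N l a x))).
        by apply/funext => x; rewrite /F !fctE /K ReK ReD ReK.
      exact: lin c3 c1.
    have -> : (fun x => complex.Im (F l x)) = (fun x =>
        k^-1 * (complex.Im (D 0%N l b x) + -1 * complex.Im (D 0%N l a x))).
      by apply/funext => x; rewrite /F !fctE /K ImK ImD ImK.
    exact: lin c4 c2.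
  move=> l ls x xb; have Il := I0 _ ls.
  by apply: is_cderivK; apply: is_cderivD; [exact: Dx|apply: is_cderivK; exact: Dx].
rewrite -FE; split=> //; apply: Hnorm_le; first exact: Hmax_ge0.
move=> l ls; rewrite (eq_L2norm (f' := F l)); last first.
  by move=> x /sub_oo_cc xb; rewrite hE.
have Il := I0 _ ls; have I1l : I 1 l by exact: I_down Is.
rewrite FE L2normK; last by apply: L2B; exact: D_L2.
rewrite normfV gtr0_norm// ler_pdivrMl// mulrC -[X in _ * X](gtr0_norm k0).
apply: (L2norm_increment (T := T) (F0 := D 0%N l) (F1 := D 1%N l)) => //.
- by move=> t tb; exact: D_L2.
- by move=> t tb; exact: D_L2.
- exact: (D_sder I1l).
- exact: Hmax_ge0.
- by move=> t tb; exact: D_le_Hmax.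
Qed.

(** What is constantly 0 in time has time derivatives 0. In this way the time
    derivatives inherit the boundary conditions of the solution. *)
Lemma D_boundary m l x : I m l -> x \in `[0, 1] ->
  (forall t, t \in `[0, T] -> D 0%N l t x = 0) ->
  forall t, t \in `[0, T] -> D m l t x = 0.
Proof.
move=> Iml xb H0; elim: m Iml => [//|m IH] Iml t tb.
have Im : I m l by exact: I_down Iml.
have [h1 h2] := Dt Iml tb xb.
have z (P : R[i] -> R) : P 0 = 0 -> is_rderiv T (fun s => P (D m l s x)) t 0.
  move=> P0; apply: is_rderiv_ext (is_rderiv_cst T t 0) => // s sb.
  by rewrite (IH Im).
apply/eqP; rewrite eq_complex; apply/andP; split; apply/eqP.
  exact: rderiv_unique T_gt0 tb h1 (z (@complex.Re R) erefl).
exact: rderiv_unique T_gt0 tb h2 (z (@complex.Im R) erefl).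
Qed.

End SmoothSolutions.

Lemma orders0_down r m l m' l' : (m' <= m)%N -> (l' <= l)%N ->
  orders0 r m l -> orders0 r m' l'.
Proof.
rewrite /orders0 => mm ll /or3P[/andP[a b]|/andP[a /eqP b]|/andP[a b]]; apply/or3P.
- by apply: Or31; rewrite (leq_trans mm a) (leq_trans ll b).
- by apply: Or32; rewrite (leq_trans mm a) -leqn0 -b.
- by apply: Or33; rewrite (leq_trans mm a) (leq_trans ll b).
Qed.

Lemma orders1_down r m l m' l' : (m' <= m)%N -> (l' <= l)%N ->
  orders1 r m l -> orders1 r m' l'.
Proof.
rewrite /orders1 => mm ll /or4P[a|/andP[a b]|/andP[a /eqP b]|/andP[a b]]; apply/or4P.
- by apply: Or41; exact: orders0_down a.
- by apply: Or42; rewrite (leq_trans mm a) (leq_trans ll b).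
- by apply: Or43; rewrite (leq_trans mm a) -leqn0 -b.
- by apply: Or44; rewrite (leq_trans mm a) (leq_trans ll b).
Qed.

(** * One step of the scheme *)

(** The inequality of squares is divided by [x1 + x0], and the term in [x1] on
    the right is absorbed thanks to [k * B <= 1]. *)
Lemma scalar_stability (R : realType) (k B x1 x0 A W : R) :
  0 < k -> 0 <= B -> k * B <= 1 -> 0 <= x1 -> 0 <= x0 -> 0 <= A -> 0 <= W ->
  2 * A <= x1 + x0 -> x1 ^+ 2 - x0 ^+ 2 <= 2 * k * ((B * A + W) * A) ->
  x1 <= (1 + 2 * k * B) * x0 + 2 * k * W.
Proof.
move=> k_gt0 B_ge0 kB p1 p0 pA pw n2 H.
have [s0|s0] := eqVneq (x1 + x0) 0.
  have -> : x1 = 0 by lra.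
  by rewrite addr_ge0// !mulr_ge0// ?addr_ge0// ?mulr_ge0// ltW.
have sp : 0 < x1 + x0 by rewrite lt_def s0 addr_ge0.
have h1 : x1 - x0 <= k * (B * ((x1 + x0) / 2) + W).
  rewrite -(ler_pM2r sp); apply: (@le_trans _ _ (x1 ^+ 2 - x0 ^+ 2)).
    by apply: le_of_eq; ring.
  apply: le_trans H _.
  have hA : A <= (x1 + x0) / 2 by lra.
  apply: (@le_trans _ _ (2 * k * ((B * ((x1 + x0) / 2) + W) * ((x1 + x0) / 2)))).
    apply: ler_wpM2l; first by rewrite mulr_ge0// ltW.
    apply: ler_pM => //; first by rewrite addr_ge0// mulr_ge0.
    by rewrite lerD2r ler_wpM2l.
  by apply: le_of_eq; field.
have kW : 0 <= k * W by rewrite mulr_ge0// ltW.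
have s00 : 0 <= k * B by rewrite mulr_ge0// ltW.
move: h1 kB; rewrite (_ : k * _ = (k * B) * ((x1 + x0) / 2) + k * W); last by ring.
rewrite -[2 * k * B]mulrA -[2 * k * W]mulrA.
move: kW s00; set s := k * B; set w := k * W; clearbody s w => kW s00 h1 kB.
have c1 : 0 <= s * (1 - s) * x0 by rewrite mulr_ge0// mulr_ge0// subr_ge0.
have c2 : 0 <= w * (1 - s) by rewrite mulr_ge0// subr_ge0.
have : 0 <= (1 - s / 2) * ((1 + 2 * s) * x0 + 2 * w - x1) by lra.
rewrite pmulr_rge0; first by move=> ?; lra.
lra.
Qed.

Section OneStep.
Context {R : realType}.
Notation V := (R -> R[i]).
Notation D := (`]0, 1[%classic : set R).
Notation dx := (cderiv 1).
Variable S : set V.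
Hypothesis Sfin : finite_dim_subspace S.
Hypothesis SH : forall v, S v -> inHH 1 v.

Let Swd := S_wd SH.

Variables (b : V) (B : R).
Hypotheses (mbr : measurable_fun D (fun x => complex.Re (b x)))
  (mbi : measurable_fun D (fun x => complex.Im (b x)))
  (B_ge0 : 0 <= B) (bB : forall x, D x -> Normc.normc (b x) <= B).

Let bL2 f : inL2 f -> inL2 (b * f).
Proof. exact: L2_bndM mbr mbi bB. Qed.

Let bnorm f : inL2 f -> L2norm (b * f) <= B * L2norm f.
Proof. exact: L2norm_bndM mbr mbi B_ge0 bB. Qed.

Definition avg (f g : V) : V := K (1 / 2) * (f + g).

Lemma avg_L2 f g : inL2 f -> inL2 g -> inL2 (avg f g).
Proof. by move=> lf lg; exact: L2K (L2D lf lg). Qed.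

Lemma avg_norm f g : inL2 f -> inL2 g -> 2 * L2norm (avg f g) <= L2norm f + L2norm g.
Proof.
move=> lf lg; rewrite /avg (L2normK _ (L2D lf lg)).
have -> : `|1 / 2| = 1 / 2 :> R by rewrite ger0_norm// divr_ge0.
have := L2normD lf lg; lra.
Qed.

Lemma wd_avg v g w k : wd v g -> wd w k -> wd (avg v w) (avg g k).
Proof. by move=> vg wk; exact: wdK (wdD vg wk). Qed.

Lemma ip_avg f g : inL2 f -> inL2 g ->
  2 * ip (avg f g) (f - g) = L2norm f ^+ 2 - L2norm g ^+ 2.
Proof.
move=> lf lg; have lfg := L2D lf lg; have lm := L2B lf lg.
rewrite /avg (ipZl _ lfg lm) (ipDl lf lg lm) (ipBr lf lg lf) (ipBr lf lg lg).
by rewrite (ip_sym g f) !L2norm_sq; field.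
Qed.

Section Step.
Variables (k a : R) (th1 th0 om : V).
Hypotheses (k_gt0 : 0 < k) (S1 : S th1) (S0 : S th0) (lom : inL2 om).

(** Scheme satisfied by the error in [S]: the one of the approximations, with the
    source [om]. *)
Definition cn_step := forall chi, S chi ->
  ip (K k^-1 * (th1 - th0)) chi =
  a * ip (- (J * avg (dx th1) (dx th0))) (dx chi)
  + ip (J * (b * avg th1 th0) + om) chi.

Hypothesis step_eq : cn_step.

Let w1 := Swd S1.
Let w0 := Swd S0.
Let l1 : inL2 th1 := wd_L2 w1.
Let l0 : inL2 th0 := wd_L2 w0.
Let d1 : inL2 (dx th1) := w1.1.
Let d0 : inL2 (dx th0) := w0.1.
Let wA : wd (avg th1 th0) (avg (dx th1) (dx th0)) := wd_avg w1 w0.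
Let lA : inL2 (avg th1 th0) := wd_L2 wA.
Let dA : inL2 (avg (dx th1) (dx th0)) := wA.1.
Let SA : S (avg th1 th0).
Proof. exact: S_K Sfin _ _ (S_D Sfin S1 S0). Qed.

(** Testing with the average of the two values: the second order term is the
    scalar product of a function with its own multiple by [J] and vanishes. *)
Lemma step_L2_stable : k * B <= 1 ->
  L2norm th1 <= (1 + 2 * k * B) * L2norm th0 + 2 * k * L2norm om.
Proof.
move=> kB; have := step_eq SA.
have lbA := bL2 lA; have lJ := L2J lbA; have lJo := L2D lJ lom.
have lm := L2B l1 l0; have ldJ := L2J dA.
have -> : ip (- (J * avg (dx th1) (dx th0))) (dx (avg th1 th0)) = 0.
  rewrite ip_sym (wd_ip _ wA) (ipNr ldJ dA) ip_sym.
  by rewrite (ipJ0 dA) oppr0.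
rewrite mulr0 add0r (ipZl _ lm lA) (ip_sym (th1 - th0)) => E.
have E2 := ip_avg l1 l0.
have E3 : L2norm th1 ^+ 2 - L2norm th0 ^+ 2 =
    2 * k * ip (J * (b * avg th1 th0) + om) (avg th1 th0).
  by rewrite -E2 -E; field; rewrite gt_eqF.
have n1 : ip (J * (b * avg th1 th0) + om) (avg th1 th0)
    <= (B * L2norm (avg th1 th0) + L2norm om) * L2norm (avg th1 th0).
  apply: le_trans (ip_CS lJo lA) _.
  apply: ler_wpM2r; first exact: L2norm_ge0.
  apply: le_trans (L2normD lJ lom) _; apply: lerD; last exact: lexx.
  by rewrite (L2normJ lbA); exact: bnorm.
have n2 := avg_norm l1 l0.
have p1 := L2norm_ge0 th1; have p0 := L2norm_ge0 th0.
have pA := L2norm_ge0 (avg th1 th0); have pw := L2norm_ge0 om.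
have : L2norm th1 ^+ 2 - L2norm th0 ^+ 2 <=
    2 * k * ((B * L2norm (avg th1 th0) + L2norm om) * L2norm (avg th1 th0)).
  rewrite E3; apply: ler_wpM2l n1; apply: mulr_ge0 => //; exact: ltW.
by move=> H; exact: (scalar_stability k_gt0 B_ge0 kB p1 p0 pA pw n2 H).
Qed.

(** Testing with [J * de], where [de] is the difference quotient of the error,
    yields the increment of the energy and the terms [ip g de] and
    [a * ip tau de]. The first one contains a time derivative of the error,
    which is eliminated: [g] may be replaced by its L^2 projection [p], and the
    scheme tested with [p] expresses [ip p de] by terms without time derivative,
    at the cost of the H^1 norm of [p]. The terms in [J * g] and [p] cancel since
    [p] is the projection of [g]. Everything then carries the factor [a], by
    which one divides; so no derivative of [a] occurs. *)
Lemma step_H1_energy g g' tau Cp : a != 0 -> wd g g' -> g 0 = 0 -> inL2 tau ->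
  J * (b * avg th1 th0) + om = J * (g + K a * tau) ->
  (forall p, L2proj S g p -> L2norm (dx p) <= Cp * L2norm g') ->
  L2norm (dx th1) ^+ 2 - L2norm (dx th0) ^+ 2 <=
  2 * k * ((L2norm (avg (dx th1) (dx th0)) + L2norm tau) * (Cp * L2norm g'))
  + 2 * ip tau (th1 - th0).
Proof.
move=> a0 gg g0 lt omE Cpg.
have lg := wd_L2 gg; have lat := L2K a lt; have lgt := L2D lg lat.
have lm := L2B l1 l0; have ldm := L2B d1 d0; have ldJ := L2J dA.
pose de := K k^-1 * (th1 - th0); pose dde := K k^-1 * (dx th1 - dx th0).
have Sde : S de by exact: S_K Sfin _ _ (S_B Sfin S1 S0).
have wde : wd de dde by exact: wdK (wdB w1 w0).
have lde := wd_L2 wde; have ldde := wde.1.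
have [p pp] := L2proj_exists Sfin SH lg; have [Sp pE] := pp.
have wp := Swd Sp; have lp := wd_L2 wp; have ldp := wp.1.
have E1 : a * ip (avg (dx th1) (dx th0)) dde = ip g de + a * ip tau de.
  have := step_eq (S_J Sfin Sde); rewrite omE (ip_sym _ (J * de)) (ipJ0 lde).
  rewrite ip_sym (wd_ip _ (wdJ wde)) ip_sym (ipNl ldJ (L2J ldde)) !ipJJ.
  rewrite (ipDl lg lat lde) (ipZl a lt lde); lra.
have E2 : ip g de = a * (ip (- (J * avg (dx th1) (dx th0))) (dx p) + ip (J * tau) p).
  rewrite -(pE _ Sde) (ip_sym p) (step_eq Sp) omE [RHS]mulrDr; congr (_ + _).
  have -> : J * (g + K a * tau) = J * g + K a * (J * tau) by ring.
  rewrite (ipDl (L2J lg) (L2K a (L2J lt)) lp) (ipZl a (L2J lt) lp) (ipJl g p).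
  rewrite (ipNr (L2J lp) lg) -(pE _ (S_J Sfin Sp)) (ip_sym p) (ipJ0 lp).
  by rewrite oppr0 add0r.
have E3 := ip_avg d1 d0.
have E4 : L2norm (dx th1) ^+ 2 - L2norm (dx th0) ^+ 2 =
    2 * k * (ip (- (J * avg (dx th1) (dx th0))) (dx p) + ip (J * tau) p)
    + 2 * ip tau (th1 - th0).
  move: E1; rewrite E2 -mulrDr => /(mulfI a0).
  rewrite (ipZr k^-1 ldm dA) (ipZr k^-1 lm lt) -E3 => E1.
  have k0 : k != 0 by rewrite gt_eqF.
  rewrite -[ip (avg _ _) _](mulVKf k0) E1; field; exact: k0.
rewrite E4 lerD2r; apply: ler_wpM2l; first by rewrite mulr_ge0// ltW.
rewrite mulrDl; apply: lerD.
  apply: le_trans (ip_CS (L2N ldJ) ldp) _.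
  rewrite (L2normN ldJ) (L2normJ dA).
  by apply: ler_wpM2l; [exact: L2norm_ge0|exact: Cpg].
apply: le_trans (ip_CS (L2J lt) lp) _; rewrite (L2normJ lt).
apply: ler_wpM2l; first exact: L2norm_ge0.
apply: le_trans (Cpg p pp).
apply: (wd_poincare wp _ (S_0 SH Sp)).
by rewrite in_itv/= lexx ler01.
Qed.

End Step.

Section ErrorEquation.
Variables (k a : R) (U1 U0 W1 W0 u1 u0 du1 du0 ddu1 ddu0 um ut uxx f : V).
Hypotheses (SU1 : S U1) (SU0 : S U0).
Hypotheses (rW1 : ritz S u1 W1) (rW0 : ritz S u0 W0).
Hypotheses (wu1 : wd u1 du1) (wu0 : wd u0 du0) (wdu1 : wd du1 ddu1) (wdu0 : wd du0 ddu0).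
Hypotheses (bc1 : du1 1 = 0) (bc0 : du0 1 = 0).
Hypotheses (lum : inL2 um) (lut : inL2 ut) (luxx : inL2 uxx).
Hypothesis fE : forall x, D x -> f x = (ut - K a * (J * uxx) - J * (b * um)) x.
Hypothesis cn : forall chi, S chi ->
  ip (K k^-1 * (U1 - U0)) chi =
  a * ip (- (J * avg (dx U1) (dx U0))) (dx chi)
  + ip (J * (b * avg U1 U0)) chi + ip f chi.

(** Consistency errors: [err_tau] is that of the second order term, and is kept
    apart because no boundary condition is known for it; [err_omega1] collects
    the projection error and the other consistency errors, which vanish at 0. *)
Definition err_tau : V := avg ddu1 ddu0 - uxx.

Definition err_omega1 : V :=
  J * (b * (avg (W1 - u1) (W0 - u0) + (avg u1 u0 - um)))
  - (K k^-1 * ((W1 - u1) - (W0 - u0)) + (K k^-1 * (u1 - u0) - ut)).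

(** The equation at the midpoint is subtracted from the scheme. For the second
    order term, the definition of the elliptic projection and an integration by
    parts, whose boundary terms vanish, give the average of the second
    derivatives at the end points of the step. *)
Lemma error_step :
  cn_step k a (U1 - W1) (U0 - W0) (err_omega1 + K a * (J * err_tau)).
Proof.
move=> chi Schi.
have SW1 := rW1.1; have SW0 := rW0.1.
have wU1 := Swd SU1; have wU0 := Swd SU0; have wW1 := Swd SW1; have wW0 := Swd SW0.
have wc := Swd Schi; have lc := wd_L2 wc; have ldc := wc.1.
have lU1 := wd_L2 wU1; have lU0 := wd_L2 wU0; have lW1 := wd_L2 wW1; have lW0 := wd_L2 wW0.
have ldU1 := wU1.1; have ldU0 := wU0.1; have ldW1 := wW1.1; have ldW0 := wW0.1.
have lu1 := wd_L2 wu1; have lu0 := wd_L2 wu0; have lddu1 := wdu1.1; have lddu0 := wdu0.1.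
have c0 := S_0 SH Schi.
(* the equations of the projection are used with J * chi, and integrated by
     parts with chi 0 = 0 and du 1 = 0 *)
have tr W u du ddu : ritz S u W -> wd u du -> wd du ddu -> du 1 = 0 ->
    ip (- (J * dx W)) (dx chi) = ip (J * ddu) chi.
  move=> rW wu wdu bc; have wW := Swd rW.1.
  have lJW := L2J wW.1; have ld := wdu.1.
  have E := rW.2 _ (S_J Sfin Schi).
  rewrite (bip_wd wW (wdJ wc)) (bip_wd wu (wdJ wc)) in E.
  rewrite (ipNl lJW ldc) (ipJl (dx W)) (ipNr (L2J ldc) wW.1) opprK E.
  have c0' : (J * chi) 0 = 0 by rewrite !fctE c0 mulr0.
  rewrite ip_sym (wd_ibp (wdJ wc) wdu c0' bc) (ipJl ddu) (ipNr (L2J lc) ld).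
  by rewrite ip_sym.
have t1 := tr _ _ _ _ rW1 wu1 wdu1 bc1; have t0 := tr _ _ _ _ rW0 wu0 wdu0 bc0.
have wth1 := wdB wU1 wW1; have wth0 := wdB wU0 wW0.
have eq1 : ip (- (J * avg (dx (U1 - W1)) (dx (U0 - W0)))) (dx chi) =
    ip (- (J * avg (dx U1) (dx U0))) (dx chi) - ip (J * avg ddu1 ddu0) chi.
  have lJ1 := L2J (L2D (Swd (S_B Sfin SU1 SW1)).1 (Swd (S_B Sfin SU0 SW0)).1).
  have J1 : - (J * avg (dx (U1 - W1)) (dx (U0 - W0))) =
     K (1 / 2) * (- (J * (dx (U1 - W1) + dx (U0 - W0)))) by rewrite /avg; ring.
  have J2 : - (J * avg (dx U1) (dx U0)) = K (1 / 2) * (- (J * dx U1) + - (J * dx U0)).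
    by rewrite /avg; ring.
  have J3 : J * avg ddu1 ddu0 = K (1 / 2) * (J * ddu1 + J * ddu0) by rewrite /avg; ring.
  have lN1 := L2N (L2J ldU1); have lN0 := L2N (L2J ldU0).
  rewrite J1 J2 J3 (ipZl _ (L2N lJ1) ldc) (ipZl _ (L2D lN1 lN0) ldc).
  rewrite (ipZl _ (L2D (L2J lddu1) (L2J lddu0)) lc).
  rewrite (ipDl lN1 lN0 ldc) (ipDl (L2J lddu1) (L2J lddu0) lc) -t1 -t0 -mulrBr.
  congr (_ * _).
  have d1 := (Swd (S_B Sfin SU1 SW1)).1; have d0 := (Swd (S_B Sfin SU0 SW0)).1.
  have J4 : - (J * (dx (U1 - W1) + dx (U0 - W0))) =
     - (J * dx (U1 - W1)) + - (J * dx (U0 - W0)) by ring.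
  rewrite J4 (ipDl (L2N (L2J d1)) (L2N (L2J d0)) ldc).
  have part U W : S U -> S W -> ip (- (J * dx (U - W))) (dx chi) =
      ip (- (J * dx U)) (dx chi) - ip (- (J * dx W)) (dx chi).
    move=> SU SW; have wU := Swd SU; have wW := Swd SW; have wUW := Swd (S_B Sfin SU SW).
    have lJc := L2J ldc.
    have swap v : inL2 v -> ip (- (J * v)) (dx chi) = ip v (J * dx chi).
      move=> lv; rewrite (ipNl (L2J lv) ldc) (ipJl v) (ipNr lJc lv) opprK; reflexivity.
    rewrite (swap _ wUW.1) (swap _ wU.1) (swap _ wW.1).
    by rewrite (wd_ip _ (wdB wU wW)) (ipBl wU.1 wW.1 lJc).
  rewrite (part _ _ SU1 SW1) (part _ _ SU0 SW0).
  move: (ip (- (J * dx U1)) (dx chi)) (ip (- (J * dx W1)) (dx chi))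
    (ip (- (J * dx U0)) (dx chi)) (ip (- (J * dx W0)) (dx chi)) => p1 p2 p3 p4.
  ring.
have lKU := L2K k^-1 (L2B lU1 lU0); have lKW := L2K k^-1 (L2B lW1 lW0).
have vec0 : K k^-1 * (U1 - W1 - (U0 - W0)) = K k^-1 * (U1 - U0) - K k^-1 * (W1 - W0).
  by ring.
rewrite vec0 (ipBl lKU lKW lc) (cn Schi) eq1.
pose F : V := ut - K a * (J * uxx) - J * (b * um).
have lF : inL2 F := L2B (L2B lut (L2K a (L2J luxx))) (L2J (bL2 lum)).
have -> : ip f chi = ip F chi by exact: eq_ip.
have lJa := L2J (avg_L2 lddu1 lddu0).
have lbU := L2J (bL2 (avg_L2 lU1 lU0)).
have -> : J * (b * avg (U1 - W1) (U0 - W0)) + (err_omega1 + K a * (J * err_tau)) =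
   J * (b * avg U1 U0) + F - K k^-1 * (W1 - W0) + K a * (J * avg ddu1 ddu0).
  by rewrite /err_omega1 /err_tau /F /avg; ring.
have l1 := L2D lbU lF; have l2 := L2B l1 lKW.
rewrite (ipDl l2 (L2K a lJa) lc) (ipBl l1 lKW lc) (ipDl lbU lF lc) (ipZl a lJa lc).
move: (ip _ (dx chi)) (ip (J * avg ddu1 ddu0) chi) (ip (J * (b * avg U1 U0)) chi)
  (ip F chi) (ip (K k^-1 * (W1 - W0)) chi) => p1 p2 p3 p4 p5.
ring.
Qed.

End ErrorEquation.
End OneStep.

(** * Discrete Gronwall inequality and absorption *)

Section Gronwall.
Variable R : realType.

Lemma discrete_gronwall (x kappa : nat -> R) (c : R) (N : nat) :
  (forall n, (n <= N)%N -> 0 <= x n) ->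
  (forall n, (n < N)%N -> 0 <= kappa n.+1) -> 0 <= c ->
  (forall n, (n < N)%N -> x n.+1 <= (1 + kappa n.+1) * x n + kappa n.+1 * c) ->
  forall n, (n <= N)%N ->
    x n <= expR (\sum_(1 <= j < n.+1) kappa j) * (x 0%N + c).
Proof.
move=> x0 k0 c0 H n nN.
suff: x n + c <= expR (\sum_(1 <= j < n.+1) kappa j) * (x 0%N + c).
  by apply: le_trans; rewrite lerDl.
elim: n nN => [_|n IH nN]; first by rewrite big_geq// expR0 mul1r.
rewrite big_nat_recr//= expRD mulrAC.
apply: (@le_trans _ _ ((x n + c) * (1 + kappa n.+1))).
  by have := H n nN; lra.
apply: ler_pM.
- exact: addr_ge0 (x0 n (ltnW nN)) c0.
- exact: addr_ge0 ler01 (k0 n nN).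
- exact: IH (ltnW nN).
- exact: expR_ge1Dx.
Qed.

(** Absorption of the new energy in the H^1 estimate. Here [e0] and [e1] stand
    for the H^1 seminorm of the error before and after a step of length [k], [d]
    for the sum of this step and the previous one, [q] for the size of the
    consistency errors, and [s0], [s1] for the scalar products of the
    consistency error of the second order term with the error. Summation by parts
    in time moves [s1 - s0] into the modified energy [e ^ 2 - 2 s + 2 q ^ 2],
    which is comparable with [e ^ 2 + q ^ 2] since [s] is at most [q * e]. *)
Lemma energy_step (k d C Cp B q e1 e0 A tq G P s1 s0 dd : R) :
  0 <= k -> k <= d -> 0 <= B -> 0 <= Cp -> C = Cp * (2 * B + 1) -> 4 * k * C <= 1 / 2 ->
  0 <= q -> 0 <= e1 -> 0 <= e0 -> 0 <= A -> 2 * A <= e1 + e0 -> 0 <= tq -> tq <= q ->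
  0 <= G -> G <= 2 * B * A + q ->
  e1 ^+ 2 - e0 ^+ 2 <= 2 * k * ((A + tq) * (Cp * G)) + 2 * P ->
  P = s1 - s0 - dd -> s1 <= q * e1 -> s0 <= q * e0 -> - dd <= d * q * e0 ->
  e1 ^+ 2 - 2 * s1 + 2 * q ^+ 2 <=
  (1 + (16 * C + 4) * d) * (e0 ^+ 2 - 2 * s0 + 2 * q ^+ 2) + (16 * C + 4) * d * q ^+ 2.
Proof.
move=> k0 kd B0 Cp0 CE kC q0 e10 e00 A0 Ae tq0 tqq G0 GA En PE h1 h0 hd; rewrite PE in En.
have C0 : 0 <= C by rewrite CE mulr_ge0// addr_ge0// mulr_ge0.
have d0 : 0 <= d by exact: le_trans kd.
have a1 : (A + tq) * (Cp * G) <= C * (A + q) ^+ 2.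
  apply: (@le_trans _ _ ((A + q) * (Cp * ((2 * B + 1) * (A + q))))).
    apply: ler_pM; [by rewrite addr_ge0|by rewrite mulr_ge0|by rewrite lerD2l|].
    apply: ler_wpM2l => //; apply: le_trans GA _.
    have : 0 <= B * q by rewrite mulr_ge0.
    lra.
  by rewrite CE; apply: le_of_eq; ring.
have a2 : (A + q) ^+ 2 <= e1 ^+ 2 + e0 ^+ 2 + 2 * q ^+ 2.
  have := sqr_ge0 (A - q); have := sqr_ge0 (e1 - e0).
  have : A ^+ 2 <= ((e1 + e0) / 2) ^+ 2.
    by rewrite lerXn2r ?nnegrE ?divr_ge0 ?addr_ge0//; lra.
  rewrite expr_div_n; lra.
have a3 : 2 * k * ((A + tq) * (Cp * G)) <= 2 * k * (C * (e1 ^+ 2 + e0 ^+ 2 + 2 * q ^+ 2)).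
  apply: ler_wpM2l; first by rewrite mulr_ge0.
  by apply: le_trans a1 _; exact: ler_wpM2l.
have a4 : 2 * (d * q * e0) <= d * (q ^+ 2 + e0 ^+ 2).
  rewrite (_ : 2 * (d * q * e0) = d * (2 * q * e0)); last by ring.
  by apply: ler_wpM2l => //; have := sqr_ge0 (q - e0); lra.
set F1 := e1 ^+ 2 - 2 * s1 + 2 * q ^+ 2; set F0 := e0 ^+ 2 - 2 * s0 + 2 * q ^+ 2.
have b1 : e1 ^+ 2 <= 2 * F1 by rewrite /F1; have := sqr_ge0 (e1 - 2 * q); lra.
have b0 : e0 ^+ 2 <= 2 * F0 by rewrite /F0; have := sqr_ge0 (e0 - 2 * q); lra.
have F00 : 0 <= F0 by have := sqr_ge0 e0; lra.
have step1 : F1 - F0 <= 2 * k * C * (e1 ^+ 2 + e0 ^+ 2 + 2 * q ^+ 2) + d * (q ^+ 2 + e0 ^+ 2).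
  by rewrite /F1 /F0; lra.
have kC0 : 0 <= 2 * k * C by rewrite mulr_ge0// mulr_ge0.
have step2 : F1 - F0 <= 2 * k * C * (2 * F1 + 2 * F0 + 2 * q ^+ 2) + d * (q ^+ 2 + 2 * F0).
  apply: le_trans step1 _; apply: lerD.
    by apply: ler_wpM2l => //; rewrite lerD2r lerD.
  by apply: ler_wpM2l => //; rewrite lerD2l.
have Q0 := sqr_ge0 q.
move: kC kC0 step2 F00 Q0; rewrite (_ : 4 * k * C = 2 * (2 * k * C)); last by ring.
clear b1 b0 step1 a4 a3 a2 a1 h1 h0 hd En.
set s := 2 * k * C; set Q := q ^+ 2.
have sd : s <= 2 * C * d by rewrite /s -mulrA (mulrC k) mulrA ler_wpM2l// mulr_ge0.
clearbody s Q F1 F0 => kC kC0 step2 F00 Q0; clear -kC kC0 step2 F00 Q0 sd d0.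
have c1 : (1 - 2 * s) * F1 <= (1 + 2 * s + 2 * d) * F0 + (2 * s + d) * Q by lra.
have c2 : F1 <= (1 + 8 * s + 4 * d) * F0 + (4 * s + 2 * d) * Q.
  have g1 : 0 <= (s + d) * (1 - 4 * s) * F0.
    by apply: mulr_ge0 => //; apply: mulr_ge0; [rewrite addr_ge0//; lra|lra].
  have g2 : 0 <= s * (1 - 4 * s) * F0.
    by apply: mulr_ge0 => //; apply: mulr_ge0; lra.
  have g3 : 0 <= (2 * s + d) * (1 - 4 * s) * Q.
    by apply: mulr_ge0 => //; apply: mulr_ge0; [rewrite addr_ge0//; lra|lra].
  have : 0 <= (1 - 2 * s) * ((1 + 8 * s + 4 * d) * F0 + (4 * s + 2 * d) * Q - F1) by lra.
  rewrite pmulr_rge0; first by move=> ?; lra.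
  lra.
apply: le_trans c2 _; apply: lerD; (apply: ler_wpM2r; first by []); lra.
Qed.

End Gronwall.

Lemma le_max_step (R : realType) (N : nat) (t : nat -> R) n : (n < N)%N ->
  step t n.+1 <= max_step N t.
Proof.
move=> nN; apply: (@le_bigmax_seq _ R nat _ 0 n.+1 xpredT (step t)) => //.
by rewrite mem_index_iota ltnS.
Qed.

(** * Partitions of the time interval *)

Section Partition.
Context {R : realType}.
Variables (T : R) (N : nat) (t : nat -> R).
Hypothesis tP : is_partition T N t.

Lemma partition_le n m : (n <= m)%N -> (m <= N)%N -> t n <= t m.
Proof.
have [_ _ tlt] := tP.
elim: m => [|m IH]; first by rewrite leqn0 => /eqP ->.
rewrite leq_eqVlt => /predU1P[->//|nm] mN.
exact: le_trans (IH nm (ltnW mN)) (ltW (tlt m mN)).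
Qed.

Lemma partition_in n : (n <= N)%N -> t n \in `[0, T].
Proof.
move=> nN; have [t0 tN _] := tP; rewrite in_itv/= -{1}t0 -tN.
by rewrite !partition_le.
Qed.

Lemma midpoint_in n : (n < N)%N -> midpoint t n.+1 \in `[0, T].
Proof.
move=> nN; have := partition_in (ltnW nN); have := partition_in nN.
by rewrite /midpoint /= !in_itv/= => /andP[? ?] /andP[? ?]; apply/andP; split; lra.
Qed.

Lemma step_gt0 n : (n < N)%N -> 0 < step t n.+1.
Proof. by have [_ _ tlt] := tP => nN; rewrite /step /= subr_gt0 tlt. Qed.

Lemma step_ge0 n : (n <= N)%N -> 0 <= step t n.
Proof.
case: n => [|n nN]; first by rewrite /step /= subrr.
exact: ltW (step_gt0 nN).
Qed.

Lemma max_step_ge0 : 0 <= max_step N t.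
Proof. by rewrite /max_step; exact: bigmax_ge_id. Qed.

Lemma sum_step n : \sum_(1 <= j < n.+1) step t j = t n - t 0.
Proof.
elim: n => [|n IH]; first by rewrite big_geq// subrr.
by rewrite big_nat_recr//= IH /step /=; ring.
Qed.

Lemma sum_step2 n : \sum_(1 <= j < n.+1) (step t j + step t j.-1) = t n + t n.-1 - 2 * t 0.
Proof.
elim: n => [|n IH]; first by rewrite big_geq//=; ring.
by rewrite big_nat_recr//= IH /step /=; ring.
Qed.

End Partition.

Lemma scaled_difference (R : realType) (c p1 q1 p0 q0 : R -> R[i]) :
  c * ((p1 - q1) - (p0 - q0)) = c * (p1 - p0) - c * (q1 - q0).
Proof. ring. Qed.

Lemma average_bound (R : realType) (x y z c : R) :
  2 * x <= y + z -> y <= c -> z <= c -> x <= c.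
Proof. by move=> *; lra. Qed.

Lemma sum_of_rates (R : realType) (c p s x : R) : 0 <= c -> 0 <= p * x -> 0 <= s * x ->
  c * (s * x) + p * x <= (c + 1) * ((p + s) * x).
Proof. by move=> c0 p0 s0; have := mulr_ge0 c0 p0; lra. Qed.

Lemma difference_via (R : realType) (x y z : R) : x - y = x - z - (y - z).
Proof. ring. Qed.

Lemma square_le_energy (R : realType) (e s q : R) : s <= q * e ->
  e ^+ 2 <= 2 * (e ^+ 2 - 2 * s + 2 * q ^+ 2).
Proof. by move=> h; have := sqr_ge0 (e - 2 * q); lra. Qed.

Lemma energy_le_square (R : realType) (e s q : R) : 0 <= e -> 0 <= q -> - s <= q * e ->
  e ^+ 2 - 2 * s + 2 * q ^+ 2 + q ^+ 2 <= 4 * (e + q) ^+ 2.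
Proof.
move=> e0 q0 h; have := mulr_ge0 q0 e0; have := sqr_ge0 e; have := sqr_ge0 q; lra.
Qed.

Lemma one_le_8M (R : realType) (x : R) : 1 <= x -> 1 <= 8 * x.
Proof. by move=> h; lra. Qed.

Lemma double_bound (R : realType) (x y z : R) : x <= y -> y <= z -> x + y <= 2 * z.
Proof. by move=> *; lra. Qed.

(** * Error estimates *)

Section Scheme.
Context {R : realType}.
Notation V := (R -> R[i]).
Notation D01 := (`]0, 1[%classic : set R).
Notation dx := (cderiv 1).

Variables (S : set V) (h CA : R) (r : nat).
Hypothesis Sfin : finite_dim_subspace S.
Hypothesis SH : forall v, S v -> inHH 1 v.
Hypotheses (h_gt0 : 0 < h) (r_ge1 : (1 <= r)%N) (CA_ge0 : 0 <= CA).
Hypothesis approx : forall s, (s <= r)%N -> forall v, inHH s.+1 v ->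
  inf [set L2norm (fun x => v x - chi x)
         + h * Hnorm 1 (fun x => v x - chi x) | chi in S]
  <= CA * h ^+ s.+1 * Hnorm s.+1 v.

Variables (T : R) (T_gt0 : 0 < T).
Variables (a : R -> R) (Amax : R) (beta beta' : R -> V) (B : R).
Hypothesis a_le : forall t, t \in `[0, T] -> `|a t| <= Amax.
Hypothesis B_ge0 : 0 <= B.
Hypothesis beta_wd : forall t, t \in `[0, T] -> wd (beta t) (beta' t).
Hypothesis beta_mr : forall t, t \in `[0, T] ->
  measurable_fun D01 (fun x => complex.Re (beta t x)).
Hypothesis beta_mi : forall t, t \in `[0, T] ->
  measurable_fun D01 (fun x => complex.Im (beta t x)).
Hypothesis beta_le : forall t, t \in `[0, T] -> forall x, D01 x -> Normc.normc (beta t x) <= B.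

Variables (I : nat -> nat -> bool) (u f : R -> V) (u0 : V) (D : nat -> nat -> R -> V) (X : R).
Hypothesis I_down : forall m l m' l', (m' <= m)%N -> (l' <= l)%N -> I m l -> I m' l'.
Hypothesis D00 : forall t x, t \in `[0, T] -> x \in `[0, 1] -> D 0%N 0%N t x = u t x.
Hypothesis Dcont : forall m l, I m l -> ccontinuous2 T (D m l).
Hypothesis Dt : forall m l, I m.+1 l -> forall t x, t \in `[0, T] -> x \in `[0, 1] ->
  is_cderiv T (fun s => D m l s x) t (D m.+1 l t x).
Hypothesis Dx : forall m l, I m l.+1 -> forall t x, t \in `[0, T] -> x \in `[0, 1] ->
  is_cderiv 1 (D m l t) x (D m l.+1 t x).
Hypothesis I1r : I 1 r.+1.
Hypothesis I30 : I 3 0.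
Hypothesis I22 : I 2 2.
Hypothesis X_ge0 : 0 <= X.
Hypothesis H0max : max_time T (fun t => Hnorm r.+1 (dt T 0 u t)) <= X.
Hypothesis H1max : max_time T (fun t => Hnorm r.+1 (dt T 1 u t)) <= X.
Hypothesis D20X : forall t, t \in `[0, T] -> L2norm (D 2 0 t) <= X.
Hypothesis D30X : forall t, t \in `[0, T] -> L2norm (D 3 0 t) <= X.
Hypothesis D22X : forall t, t \in `[0, T] -> L2norm (D 2 2 t) <= X.
Hypothesis sol : AK_solution T a beta f u0 u.

Variables (N : nat) (t : nat -> R) (uh0 : V) (U : nat -> V).
Hypothesis tP : is_partition T N t.
Hypothesis CN : crank_nicolson a beta f N t S uh0 U.

Let Dl2 m l s := D_L2 Dcont (m := m) (l := l) (t := s).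
Let Dwd m l s := D_wd Dcont Dx (m := m) (l := l) (t := s).
Let Dsd m l := D_sder I_down Dcont Dt (m := m) (l := l).

Let I01 : I 0 1. Proof. by apply: I_down I1r. Qed.
Let I02 : I 0 2. Proof. by apply: I_down I22. Qed.
Let I11 : I 1 1. Proof. by apply: I_down I22. Qed.
Let I12 : I 1 2. Proof. by apply: I_down I22. Qed.
Let I10 : I 1 0. Proof. by apply: I_down I22. Qed.
Let I20 : I 2 0. Proof. by apply: I_down I22. Qed.
Let I21 : I 2 1. Proof. by apply: I_down I22. Qed.
Let I00 : I 0 0. Proof. by apply: I_down I22. Qed.
Let I0r : I 0 r.+1. Proof. by apply: I_down I1r. Qed.

Let tin n : (n <= N)%N -> t n \in `[0, T] := @partition_in _ _ _ _ tP n.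
Let min n : (n < N)%N -> midpoint t n.+1 \in `[0, T] := @midpoint_in _ _ _ _ tP n.

Let b0 : (0 : R) \in `[0, 1]. Proof. by rewrite in_itv/= lexx ler01. Qed.
Let b1 : (1 : R) \in `[0, 1]. Proof. by rewrite in_itv/= lexx ler01. Qed.

Let bc0 m s : I m 0 -> s \in `[0, T] -> D m 0%N s 0 = 0.
Proof.
move=> Im; apply: (D_boundary T_gt0 I_down Dt Im b0) => s' s'b.
by rewrite D00//; have [_ H _ _] := sol; exact: H.
Qed.

Let bc1 m s : I m 1 -> s \in `[0, T] -> D m 1%N s 1 = 0.
Proof.
move=> Im; apply: (D_boundary T_gt0 I_down Dt Im b1) => s' s'b.
by rewrite -(dxE I_down D00 Dx I01 s'b b1); have [_ _ H _] := sol; exact: H.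
Qed.

(** The initial value [u0] agrees with [u 0] only on [[0, 1]], so it is kept as
    the argument of the projection that occurs in the error bounds. *)
Definition proj n : V := elliptic_projection S (if n is 0%N then u0 else u (t n)).

Lemma proj_ritz n : (n <= N)%N -> ritz S (D 0%N 0%N (t n)) (proj n).
Proof.
move=> nN; have tb := tin nN.
have wD := Dwd I01 tb.
have E x : x \in `[0, 1] -> D 0%N 0%N (t n) x = (if n is 0%N then u0 else u (t n)) x.
  move=> xb; rewrite D00//; case: n nN tb {wD} => [_ tb|//].
  by have [t0 _ _] := tP; rewrite t0; have [_ _ _ ->] := sol.
have wD' : wd (if n is 0%N then u0 else u (t n)) (D 0%N 1%N (t n)).
  by apply: wd_ext wD _ _ => // x xb; exact: E.
have [|Sw wE] := @elliptic_projection_ritz _ S Sfin SH (if n is 0%N then u0 else u (t n)).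
  by eexists; exact: wD'.
split; first exact: Sw.
move=> phi Sphi; have wp := S_wd SH Sphi.
by rewrite (bip_wd wD wp) -(bip_wd wD' wp); exact: wE.
Qed.

Definition theta n : V := U n - proj n.
Definition rho n : V := proj n - D 0%N 0%N (t n).
Definition drho n : V := dx (proj n) - D 0%N 1%N (t n).

Let SU n : (n <= N)%N -> S (U n). Proof. by have [H _ _] := CN; exact: H. Qed.

Let Stheta n : (n <= N)%N -> S (theta n).
Proof. by move=> nN; exact: (S_B Sfin (SU nN) (proj_ritz nN).1). Qed.

Lemma rho_wd n : (n <= N)%N -> wd (rho n) (drho n).
Proof. by move=> nN; exact: (wdB (S_wd SH (proj_ritz nN).1) (Dwd I01 (tin nN))). Qed.

Definition CR : R := CA * r.+2%:R.

Let CR_ge0 : 0 <= CR. Proof. exact: mulr_ge0. Qed.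

Let hr0 : 0 <= h ^+ r. Proof. exact: exprn_ge0 (ltW h_gt0). Qed.

Lemma drho_le n : (n <= N)%N -> L2norm (drho n) <= CR * h ^+ r * X.
Proof.
move=> nN; have tb := tin nN; have rw := proj_ritz nN; have wD := Dwd I01 tb.
have [hu nu] := slice_inH T_gt0 I_down D00 Dcont Dt Dx I0r tb.
have hh : inHH r.+1 (D 0%N 0%N (t n)) by split; [exact: hu|exact: bc0].
have wD' : wd (D 0%N 0%N (t n)) (dx (D 0%N 0%N (t n))).
  split; first exact: (hh.1.1 1%N).
  exact: (hh.1.2 0%N).
have := ritz_error_H1 Sfin SH h_gt0 approx (leqnn r) hh wD' rw.
have -> : L2norm (dx (proj n) - dx (D 0%N 0%N (t n))) = L2norm (drho n).
  have wW := S_wd SH rw.1.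
  by rewrite -(wd_L2norm (wdB wW wD')) (wd_L2norm (wdB wW wD)).
move=> /le_trans; apply.
apply: (@le_trans _ _ (CA * h ^+ r * (r.+2%:R * X))).
  exact: (ler_wpM2l (mulr_ge0 CA_ge0 hr0) (le_trans nu (ler_wpM2l (ler0n _ _) H0max))).
by apply: le_of_eq; rewrite /CR; ring.
Qed.

Lemma rho_le n : (n <= N)%N -> L2norm (rho n) <= 3 * CA * CR * (h ^+ r.+1 * X).
Proof.
move=> nN; have tb := tin nN; have rw := proj_ritz nN; have wD := Dwd I01 tb.
have := ritz_error_L2 Sfin SH h_gt0 r_ge1 CA_ge0 approx wD (bc0 I00 tb) rw.
move=> /le_trans; apply.
apply: (@le_trans _ _ (3 * CA * h * (CR * h ^+ r * X))).
  exact: (ler_wpM2l (mulr_ge0 (mulr_ge0 (ler0n _ _) CA_ge0) (ltW h_gt0)) (drho_le nN)).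
by apply: le_of_eq; rewrite exprS; ring.
Qed.

Let k n := step t n.+1.
Let m n := midpoint t n.+1.
Let kmax := max_step N t.

Definition drift n : V := K (k n)^-1 * (rho n.+1 - rho n).
Definition ddrift n : V := K (k n)^-1 * (drho n.+1 - drho n).

Lemma drift_wd n : (n < N)%N -> wd (drift n) (ddrift n).
Proof. by move=> nN; exact: wdK (wdB (rho_wd nN) (rho_wd (ltnW nN))). Qed.

Lemma ddrift_le n : (n < N)%N -> L2norm (ddrift n) <= CR * h ^+ r * X /\
  L2norm (drift n) <= 3 * CA * CR * (h ^+ r.+1 * X).
Proof.
move=> nN; have tb := tin nN; have tb' := tin (ltnW nN).
have rw1 := proj_ritz nN; have rw0 := proj_ritz (ltnW nN).
have wD1 := Dwd I01 tb; have wD0 := Dwd I01 tb'.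
have lt01 : t n < t n.+1 by have [_ _ H] := tP; exact: H.
have [hu nu] := increment_inH T_gt0 I_down D00 Dcont Dt Dx I1r tb' tb lt01.
set v := K (t n.+1 - t n)^-1 * (D 0%N 0%N (t n.+1) - D 0%N 0%N (t n)) in hu nu.
pose v' := K (t n.+1 - t n)^-1 * (D 0%N 1%N (t n.+1) - D 0%N 1%N (t n)).
have wv : wd v v' by exact: wdK (wdB wD1 wD0).
have v0 : v 0 = 0 by rewrite /v !fctE (bc0 I00 tb) (bc0 I00 tb') subrr mulr0.
pose w := K (t n.+1 - t n)^-1 * (proj n.+1 - proj n).
have rw : ritz S v w.
  apply: (ritzK Sfin SH); first by eexists; exact: wdB wD1 wD0.
  by apply: (ritzB Sfin SH) => //; eexists; [exact: wD1|exact: wD0].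
have ww := S_wd SH rw.1.
pose w' := K (t n.+1 - t n)^-1 * (dx (proj n.+1) - dx (proj n)).
have ww' : wd w w' by exact: wdK (wdB (S_wd SH rw1.1) (S_wd SH rw0.1)).
have hh : inHH r.+1 v by split.
have wD' : wd v (dx v).
  split; first exact: (hh.1.1 1%N).
  exact: (hh.1.2 0%N).
have E1 : L2norm (ddrift n) = L2norm (dx w - v').
  rewrite -(wd_L2norm (wdB ww wv)) (wd_L2norm (wdB ww' wv)).
  by rewrite -scaled_difference.
have E2 : L2norm (ddrift n) = L2norm (dx w - dx v).
  by rewrite E1 -(wd_L2norm (wdB ww wv)) (wd_L2norm (wdB ww wD')).
have E3 : drift n = w - v by rewrite /w /v -scaled_difference.
have H1 : L2norm (ddrift n) <= CR * h ^+ r * X.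
  rewrite E2; apply: le_trans (ritz_error_H1 Sfin SH h_gt0 approx (leqnn r) hh wD' rw) _.
  apply: (@le_trans _ _ (CA * h ^+ r * (r.+2%:R * X))).
    exact: (ler_wpM2l (mulr_ge0 CA_ge0 hr0) (le_trans nu (ler_wpM2l (ler0n _ _) H1max))).
  by apply: le_of_eq; rewrite /CR; ring.
split=> //; rewrite E3.
apply: le_trans (ritz_error_L2 Sfin SH h_gt0 r_ge1 CA_ge0 approx wv v0 rw) _.
rewrite -E1; apply: (@le_trans _ _ (3 * CA * h * (CR * h ^+ r * X))).
  exact: (ler_wpM2l (mulr_ge0 (mulr_ge0 (ler0n _ _) CA_ge0) (ltW h_gt0)) H1).
by apply: le_of_eq; rewrite exprS; ring.
Qed.

(** Below, [k n] and [m n] are the length and the midpoint of the step from [t n]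
    to [t n.+1], and the quantities of that step are indexed by [n]. *)
Definition tau n : V :=
  err_tau (D 0 2 (t n.+1)) (D 0 2 (t n)) (D 0 2 (m n)).

Let ksq n M : (n < N)%N -> 0 <= M -> M * (t n.+1 - t n) ^+ 2 <= kmax ^+ 2 * M.
Proof.
move=> nN M0; rewrite mulrC; apply: ler_wpM2r => //.
have := le_max_step t nN; have := ltW (step_gt0 tP nN); rewrite /step /= => k0 kk.
by rewrite lerXn2r ?nnegrE// (le_trans k0).
Qed.

Let ksqn n M : (n < N)%N -> 0 <= M -> M * `|t n.+1 - t n| ^+ 2 <= kmax ^+ 2 * M.
Proof. by move=> nN M0; rewrite real_normK ?num_real//; exact: ksq. Qed.

Lemma tau_L2 n : (n < N)%N -> inL2 (tau n).
Proof.
move=> nN; apply: L2B; last exact: Dl2 I02 (min nN).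
by apply: avg_L2; [exact: Dl2 I02 (tin nN)|exact: Dl2 I02 (tin (ltnW nN))].
Qed.

Lemma tau_le n : (n < N)%N -> L2norm (tau n) <= kmax ^+ 2 * X.
Proof.
move=> nN; apply: le_trans (ksqn nN X_ge0).
exact: (average_midpoint (fun s sb => Dl2 I02 sb) (Dsd I12) X_ge0
  (fun s sb => Dl2 I22 sb) (Dsd I22) (tin (ltnW nN)) (tin nN) D22X).
Qed.

Definition ucorr n : V := avg (D 0 0 (t n.+1)) (D 0 0 (t n)) - D 0 0 (m n).
Definition utcorr n : V :=
  K (k n)^-1 * (D 0 0 (t n.+1) - D 0 0 (t n)) - D 1 0 (m n).

Lemma ucorr_le n : (n < N)%N -> L2norm (ucorr n) <= kmax ^+ 2 * X.
Proof.
move=> nN; apply: le_trans (ksqn nN X_ge0).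
exact: (average_midpoint (fun s sb => Dl2 I00 sb) (Dsd I10) X_ge0
  (fun s sb => Dl2 I20 sb) (Dsd I20) (tin (ltnW nN)) (tin nN) D20X).
Qed.

Lemma utcorr_le n : (n < N)%N -> L2norm (utcorr n) <= kmax ^+ 2 * X.
Proof.
move=> nN; apply: le_trans (ksq nN X_ge0).
have lt01 : t n < t n.+1 by have [_ _ H] := tP; exact: H.
exact: (central_difference (fun s sb => Dl2 I00 sb) (fun s sb => Dl2 I10 sb)
  (Dsd I10) X_ge0 (Dsd I20)
  (fun s sb => Dl2 I30 sb) (Dsd I30) (tin (ltnW nN)) (tin nN) lt01 D30X).
Qed.

Definition omega1 n : V := err_omega1 (beta (m n)) (k n) (proj n.+1) (proj n)
  (D 0 0 (t n.+1)) (D 0 0 (t n)) (D 0 0 (m n)) (D 1 0 (m n)).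

Lemma omega1E n : omega1 n =
  J * (beta (m n) * (avg (rho n.+1) (rho n) + ucorr n)) - (drift n + utcorr n).
Proof. by []. Qed.

(** The real part of the scheme, in the form required by [error_step]. *)
Lemma theta_step n : (n < N)%N ->
  cn_step S (beta (m n)) (k n) (a (m n)) (theta n.+1) (theta n)
    (omega1 n + K (a (m n)) * (J * tau n)).
Proof.
move=> nN; have tb1 := tin nN; have tb0 := tin (ltnW nN); have mb := min nN.
apply: (error_step Sfin SH (beta_mr mb) (beta_mi mb) (beta_le mb)
  (SU nN) (SU (ltnW nN)) (proj_ritz nN) (proj_ritz (ltnW nN))
  (Dwd I01 tb1) (Dwd I01 tb0) (Dwd I02 tb1) (Dwd I02 tb0)
  (bc1 I01 tb1) (bc1 I01 tb0) (Dl2 I00 mb) (Dl2 I10 mb) (Dl2 I02 mb)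
  (f := f (m n))).
  move=> x /sub_oo_cc xb; have [+ _ _ _] := sol => /(_ _ _ mb xb).
  rewrite (dtE T_gt0 I_down D00 Dt I10 mb xb) (dxE I_down D00 Dx I02 mb xb).
  by rewrite -D00// !fctE /K /J => ->; ring.
move=> chi Schi; have [_ _ /(_ n.+1)] := CN; rewrite /= nN => /(_ isT chi Schi).
set AU := (fun x => (U n.+1 x + U n x) / 2).
have AUE : AU = avg (U n.+1) (U n).
  by apply/funext => x; rewrite /AU /avg !fctE /K; rewrite rmorphM rmorph1 /= fmorphV rmorph_nat; field.
have dE : (fun x => (U n.+1 x - U n x) / (step t n.+1)%:C) =
    K (k n)^-1 * (U n.+1 - U n).
  by apply/funext => x; rewrite !fctE /K fmorphV mulrC.
have bE : (fun x => beta (midpoint t n.+1) x * ((U n.+1 x + U n x) / 2)) =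
    beta (m n) * avg (U n.+1) (U n) by rewrite -AUE.
rewrite dE bE AUE => /(congr1 (@complex.Re R)).
have wc := S_wd SH Schi; have w1 := S_wd SH (SU nN); have w0 := S_wd SH (SU (ltnW nN)).
have wA := wd_avg w1 w0.
have Rei (c : R) (z : R[i]) : complex.Re (- 'i%C * c%:C * z) = c * complex.Im z.
  by case: z => ? ? /=; ring.
have Rei' (z : R[i]) : complex.Re ('i%C * z) = - complex.Im z.
  by case: z => ? ? /=; ring.
rewrite !ReD Rei Rei' (Re_inner_ip (K (k n)^-1 * (U n.+1 - U n)) chi).
rewrite (Re_inner_ip (f (m n)) chi) (Im_inner (beta (m n) * avg (U n.+1) (U n)) chi).
rewrite /Bform (Im_inner (dx (avg (U n.+1) (U n))) (dx chi)) (wd_ip _ wA).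
have lbA : inL2 (beta (m n) * avg (U n.+1) (U n)).
  by exact: (L2_bndM (beta_mr mb) (beta_mi mb) (beta_le mb) (wd_L2 wA)).
have sw (v w : V) : inL2 v -> inL2 w -> ip v (J * w) = - ip (J * v) w.
  by move=> lv lw; rewrite (ipJl v) (ipNr (L2J lw) lv) opprK.
rewrite (sw _ _ wA.1 wc.1) -(ipNl (L2J wA.1) wc.1).
by rewrite (sw (beta (m n) * avg (U n.+1) (U n)) _ lbA (wd_L2 wc)) opprK.
Qed.

Let betaM n z : (n < N)%N -> inL2 z -> inL2 (beta (m n) * z).
Proof. by move=> nN; have mb := min nN; exact: L2_bndM (beta_mr mb) (beta_mi mb) (beta_le mb). Qed.

Let betaMn n z : (n < N)%N -> inL2 z -> L2norm (beta (m n) * z) <= B * L2norm z.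
Proof.
by move=> nN; have mb := min nN; exact: L2norm_bndM (beta_mr mb) (beta_mi mb) B_ge0 (beta_le mb).
Qed.

Let ucorr_L2 n : (n < N)%N -> inL2 (ucorr n).
Proof.
move=> nN; apply: L2B; last exact: Dl2 I00 (min nN).
by apply: avg_L2; [exact: Dl2 I00 (tin nN)|exact: Dl2 I00 (tin (ltnW nN))].
Qed.

Let utcorr_L2 n : (n < N)%N -> inL2 (utcorr n).
Proof.
move=> nN; apply: L2B; last exact: Dl2 I10 (min nN).
by apply/L2K/L2B; [exact: Dl2 I00 (tin nN)|exact: Dl2 I00 (tin (ltnW nN))].
Qed.

Lemma omega1_L2 n : (n < N)%N -> inL2 (omega1 n).
Proof.
move=> nN; rewrite omega1E; apply: L2B.
  apply: (L2J (betaM nN (L2D _ (ucorr_L2 nN)))).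
  exact: (avg_L2 (wd_L2 (rho_wd nN)) (wd_L2 (rho_wd (ltnW nN)))).
exact: (L2D (wd_L2 (drift_wd nN)) (utcorr_L2 nN)).
Qed.

(** The rate of convergence in L^2; [Q1] below is the one in H^1. *)
Definition Q0 : R := (kmax ^+ 2 + h ^+ r.+1) * X.
Definition C1 : R := (B + 1) * (3 * CA * CR + 1).

Let kX : 0 <= kmax ^+ 2 * X. Proof. by rewrite mulr_ge0// sqr_ge0. Qed.
Let hX : 0 <= h ^+ r.+1 * X. Proof. by rewrite mulr_ge0// exprn_ge0// ltW. Qed.

Lemma omega1_le n : (n < N)%N -> L2norm (omega1 n) <= C1 * Q0.
Proof.
move=> nN; have lr1 := wd_L2 (rho_wd nN); have lr0 := wd_L2 (rho_wd (ltnW nN)).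
have lA := avg_L2 lr1 lr0; have lz := L2D lA (ucorr_L2 nN).
have lbz := betaM nN lz.
have ld := wd_L2 (drift_wd nN); have ly := L2D ld (utcorr_L2 nN).
have n1 := avg_norm lr1 lr0; have n2 := rho_le nN; have n3 := rho_le (ltnW nN).
have n4 := (ddrift_le nN).2; have n5 := ucorr_le nN; have n6 := utcorr_le nN.
have n7 := L2normD lA (ucorr_L2 nN); have n8 := L2normD ld (utcorr_L2 nN).
have n9 := betaMn nN lz.
rewrite omega1E; apply: le_trans (L2normB (L2J lbz) ly) _; rewrite (L2normJ lbz).
have c0 : 0 <= 3 * CA * CR by rewrite !mulr_ge0.
have n10 : L2norm (avg (rho n.+1) (rho n) + ucorr n) <= 3 * CA * CR * (h ^+ r.+1 * X) + kmax ^+ 2 * X.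
  by apply: le_trans n7 _; apply: lerD n5; exact: (average_bound n1 n2 n3).
have n11 : L2norm (drift n + utcorr n) <= 3 * CA * CR * (h ^+ r.+1 * X) + kmax ^+ 2 * X.
  by apply: le_trans n8 _; apply: lerD.
apply: (@le_trans _ _ ((B + 1) * (3 * CA * CR * (h ^+ r.+1 * X) + kmax ^+ 2 * X))).
  rewrite mulrDl mul1r; apply: lerD n11; apply: le_trans n9 _.
  exact: ler_wpM2l B_ge0 _ _ n10.
rewrite /C1 /Q0 -[leRHS]mulrA.
apply: (ler_wpM2l (addr_ge0 B_ge0 ler01)).
exact: (sum_of_rates c0 kX hX).
Qed.

(** [B + 1] instead of [B] makes the Gronwall coefficient of a step dominate
    [2 * k n], so that the source fits into the form of [discrete_gronwall]. *)
Lemma L2_error n : (n <= N)%N -> kmax * (B + 1) <= 1 ->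
  L2norm (fun x => U n x - u (t n) x) <=
  (expR (2 * (B + 1) * T) * (1 + (C1 + Amax)) + 3 * CA * CR)
  * (L2norm (fun x => uh0 x - elliptic_projection S u0 x) + Q0).
Proof.
move=> nN kB.
have A0 : 0 <= Amax.
  by apply: le_trans (a_le (tin (leq0n N))); exact: normr_ge0.
have Q00 : 0 <= Q0 by rewrite /Q0 mulrDl; exact: addr_ge0.
have C10 : 0 <= C1 by rewrite /C1 mulr_ge0// ?addr_ge0// !mulr_ge0.
have om_le j : (j < N)%N ->
    L2norm (omega1 j + K (a (m j)) * (J * tau j)) <= (C1 + Amax) * Q0.
  move=> jN; have lt := tau_L2 jN.
  apply: le_trans (L2normD (omega1_L2 jN) (L2K _ (L2J lt))) _.
  rewrite mulrDl; apply: lerD; first exact: omega1_le.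
  rewrite (L2normK _ (L2J lt)) (L2normJ lt).
  apply: ler_pM => //; first exact: L2norm_ge0.
    exact: a_le (min jN).
  by apply: le_trans (tau_le jN) _; rewrite /Q0 mulrDl lerDl.
have B10 : 0 <= B + 1 by exact: addr_ge0.
have rec j : (j < N)%N -> L2norm (theta j.+1) <=
    (1 + 2 * (B + 1) * k j) * L2norm (theta j) + 2 * (B + 1) * k j * ((C1 + Amax) * Q0).
  move=> jN; have mb := min jN; have k0 := step_gt0 tP jN.
  have bB x : D01 x -> Normc.normc (beta (m j) x) <= B + 1.
    by move=> Dx1; apply: le_trans (beta_le mb Dx1) _; rewrite lerDl.
  have kB1 : k j * (B + 1) <= 1.
    by apply: le_trans kB; apply: ler_wpM2r => //; exact: le_max_step.
  have lom := L2D (omega1_L2 jN) (L2K (a (m j)) (L2J (tau_L2 jN))).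
  have := step_L2_stable Sfin SH (beta_mr mb) (beta_mi mb) B10 bB k0
    (Stheta jN) (Stheta (ltnW jN)) lom (theta_step jN) kB1.
  have sc (b' k' : R) : 2 * k' * b' = 2 * b' * k' by ring.
  move=> /le_trans; apply; rewrite sc; apply: lerD; first exact: lexx.
  rewrite -(sc (B + 1)) -[leRHS]mulrA.
  apply: (ler_wpM2l (mulr_ge0 (ler0n _ _) (ltW k0))).
  apply: le_trans (om_le _ jN) _; rewrite -[leLHS]mul1r.
  apply: ler_wpM2r; last by rewrite lerDr.
  by rewrite mulr_ge0// addr_ge0.
have CQ0 : 0 <= (C1 + Amax) * Q0 by rewrite mulr_ge0// addr_ge0.
have kap j : (j < N)%N -> 0 <= 2 * (B + 1) * step t j.+1.
  by move=> jN; rewrite mulr_ge0 ?mulr_ge0// ltW// (step_gt0 tP).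
have := discrete_gronwall (x := fun j => L2norm (theta j))
  (kappa := fun j => 2 * (B + 1) * step t j) (fun j _ => L2norm_ge0 _) kap CQ0 rec nN.
rewrite -mulr_sumr sum_step => th_le.
have [t0 tN _] := tP.
have ex : expR (2 * (B + 1) * (t n - t 0)) <= expR (2 * (B + 1) * T).
  rewrite ler_expR; apply: ler_wpM2l; first by rewrite mulr_ge0.
  by have := tin nN; rewrite in_itv/= t0 subr0 => /andP[].
have U0 : U 0%N = uh0 by have [_ ->] := CN.
have lth := wd_L2 (S_wd SH (Stheta nN)); have lr := wd_L2 (rho_wd nN).
have eqn : L2norm (fun x => U n x - u (t n) x) = L2norm (theta n + rho n).
  apply: eq_L2norm => x /sub_oo_cc xb; rewrite /theta /rho !fctE (D00 (tin nN) xb).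
  by rewrite addrA subrK.
apply: (le_trans (le_of_eq eqn)); apply: le_trans (L2normD lth lr) _.
have n1 := rho_le nN.
suff main : L2norm (theta n) + L2norm (rho n) <=
   (expR (2 * (B + 1) * T) * (1 + (C1 + Amax)) + 3 * CA * CR) * (L2norm (theta 0) + Q0).
  by move: main; rewrite {2}/theta U0.
have e0 := expR_ge0 (2 * (B + 1) * T).
have tt0 := L2norm_ge0 (theta 0).
have th_le' : L2norm (theta n) <= expR (2 * (B + 1) * T) * (L2norm (theta 0) + (C1 + Amax) * Q0).
  by apply: le_trans th_le _; apply: ler_wpM2r => //; exact: addr_ge0.
rewrite [leRHS]mulrDl; apply: lerD.
  apply: le_trans th_le' _; rewrite -[leRHS]mulrA; apply: (ler_wpM2l e0).
  rewrite [leRHS]mulrDl mul1r; apply: lerD; first by rewrite lerDl.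
  by apply: ler_wpM2l; [exact: addr_ge0|rewrite lerDr].
have hQ : h ^+ r.+1 * X <= Q0 by rewrite /Q0 mulrDl lerDr.
apply: le_trans n1 _; apply: ler_wpM2l; first by rewrite !mulr_ge0.
by apply: le_trans hQ _; rewrite lerDr.
Qed.

Section EnergyEstimate.
Variables (CI Cstar : R).
Hypothesis CI_ge0 : 0 <= CI.
Hypothesis inverse : forall phi, S phi -> H1semi phi <= CI * h^-1 * L2norm phi.
Hypothesis a_neq0 : forall t, t \in `[0, T] -> a t != 0.
Hypothesis beta'_mr : forall t, t \in `[0, T] ->
  measurable_fun D01 (fun x => complex.Re (beta' t x)).
Hypothesis beta'_mi : forall t, t \in `[0, T] ->
  measurable_fun D01 (fun x => complex.Im (beta' t x)).
Hypothesis beta'_le : forall t, t \in `[0, T] -> forall x, D01 x -> Normc.normc (beta' t x) <= B.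
Hypothesis I32 : I 3 2.
Hypothesis D32X : forall t, t \in `[0, T] -> L2norm (D 3 2 t) <= X.
Hypothesis Cstar_ge0 : 0 <= Cstar.
Hypothesis mesh : time_mesh_condition Cstar N t.

Let I31 : I 3 1. Proof. by apply: I_down I32. Qed.

(** The first space derivative of the solution vanishes at 1, and so do its time
    derivatives: their norms are bounded by those of one more space derivative. *)
Let D21X s : s \in `[0, T] -> L2norm (D 2 1 s) <= X.
Proof.
move=> sb; apply: le_trans (D22X sb).
exact: (wd_poincare (Dwd I22 sb) b1 (bc1 I21 sb)).
Qed.

Let D31X s : s \in `[0, T] -> L2norm (D 3 1 s) <= X.
Proof.
move=> sb; apply: le_trans (D32X sb).
exact: (wd_poincare (Dwd I32 sb) b1 (bc1 I31 sb)).
Qed.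

Definition ducorr n : V := avg (D 0 1 (t n.+1)) (D 0 1 (t n)) - D 0 1 (m n).
Definition dutcorr n : V :=
  K (k n)^-1 * (D 0 1 (t n.+1) - D 0 1 (t n)) - D 1 1 (m n).

Lemma ducorr_le n : (n < N)%N -> L2norm (ducorr n) <= kmax ^+ 2 * X.
Proof.
move=> nN; apply: le_trans (ksqn nN X_ge0).
exact: (average_midpoint (fun s sb => Dl2 I01 sb) (Dsd I11) X_ge0
  (fun s sb => Dl2 I21 sb) (Dsd I21) (tin (ltnW nN)) (tin nN) D21X).
Qed.

Lemma dutcorr_le n : (n < N)%N -> L2norm (dutcorr n) <= kmax ^+ 2 * X.
Proof.
move=> nN; apply: le_trans (ksq nN X_ge0).
have lt01 : t n < t n.+1 by have [_ _ H] := tP; exact: H.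
exact: (central_difference (fun s sb => Dl2 I01 sb) (fun s sb => Dl2 I11 sb)
  (Dsd I11) X_ge0 (Dsd I21)
  (fun s sb => Dl2 I31 sb) (Dsd I31) (tin (ltnW nN)) (tin nN) lt01 D31X).
Qed.

Lemma ucorr_wd n : (n < N)%N -> wd (ucorr n) (ducorr n).
Proof.
move=> nN; have tb1 := tin nN; have tb0 := tin (ltnW nN); have mb := min nN.
exact: (wdB (wd_avg (Dwd I01 tb1) (Dwd I01 tb0)) (Dwd I01 mb)).
Qed.

Lemma utcorr_wd n : (n < N)%N -> wd (utcorr n) (dutcorr n).
Proof.
move=> nN; have tb1 := tin nN; have tb0 := tin (ltnW nN); have mb := min nN.
exact: (wdB (wdK _ (wdB (Dwd I01 tb1) (Dwd I01 tb0))) (Dwd I11 mb)).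
Qed.

(** Poincare's inequality absorbs the lower order term of the product rule. *)
Lemma beta_product_le n z z' : (n < N)%N -> wd z z' -> z 0 = 0 ->
  L2norm (beta' (m n) * z + beta (m n) * z') <= 2 * B * L2norm z'.
Proof.
move=> nN zz z0; have mb := min nN; have lz := wd_L2 zz; have lz' := zz.1.
have l1 := L2_bndM (beta'_mr mb) (beta'_mi mb) (beta'_le mb) lz.
have l2 := betaM nN lz'.
apply: le_trans (L2normD l1 l2) _.
rewrite (_ : 2 * B = B + B); last by ring.
rewrite mulrDl; apply: lerD; last exact: betaMn.
apply: le_trans (L2norm_bndM (beta'_mr mb) (beta'_mi mb) B_ge0 (beta'_le mb) lz) _.
exact: (ler_wpM2l B_ge0 (wd_poincare zz b0 z0)).
Qed.

Let rho0 n : (n <= N)%N -> rho n 0 = 0.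
Proof.
move=> nN; rewrite /rho !fctE (bc0 I00 (tin nN)) (S_0 SH (proj_ritz nN).1).
exact: subrr.
Qed.

(** The deviation of the average of the elliptic projections from the solution at
    the midpoint. *)
Definition zc n : V := avg (rho n.+1) (rho n) + ucorr n.
Definition dzc n : V := avg (drho n.+1) (drho n) + ducorr n.

Lemma zc_wd n : (n < N)%N -> wd (zc n) (dzc n).
Proof.
by move=> nN; exact: (wdD (wd_avg (rho_wd nN) (rho_wd (ltnW nN))) (ucorr_wd nN)).
Qed.

Let avg0 (v w : V) : v 0 = 0 -> w 0 = 0 -> avg v w 0 = 0.
Proof. by move=> v0 w0; rewrite /avg !fctE v0 w0 addr0 mulr0. Qed.

Lemma zc0 n : (n < N)%N -> zc n 0 = 0.
Proof.
move=> nN; have tb1 := tin nN; have tb0 := tin (ltnW nN); have mb := min nN.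
rewrite /zc /ucorr !fctE (avg0 (rho0 nN) (rho0 (ltnW nN))).
by rewrite (avg0 (bc0 I00 tb1) (bc0 I00 tb0)) (bc0 I00 mb) subr0 addr0.
Qed.

Definition domega1 n : V :=
  J * (beta' (m n) * zc n + beta (m n) * dzc n) - (ddrift n + dutcorr n).

Lemma omega1_wd n : (n < N)%N -> wd (omega1 n) (domega1 n).
Proof.
move=> nN; have mb := min nN.
exact: (wdB (wdJ (wdM (beta_wd mb) (zc_wd nN))) (wdD (drift_wd nN) (utcorr_wd nN))).
Qed.

Lemma omega10 n : (n < N)%N -> omega1 n 0 = 0.
Proof.
move=> nN; have tb1 := tin nN; have tb0 := tin (ltnW nN); have mb := min nN.
have z0 := zc0 nN; rewrite omega1E -/(zc n) !fctE z0 !mulr0 sub0r.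
rewrite /drift /utcorr !fctE (rho0 nN) (rho0 (ltnW nN)) (bc0 I00 tb1) (bc0 I00 tb0).
by rewrite (bc0 I10 mb) !subr0 !mulr0 addr0 oppr0.
Qed.

Definition Q1 : R := (kmax ^+ 2 + h ^+ r) * X.
Definition CQ : R := (2 * B + 1) * (CR + 1) + (1 + Cstar).

Let hX1 : 0 <= h ^+ r * X. Proof. exact: mulr_ge0. Qed.
Let Q1_ge0 : 0 <= Q1. Proof. by rewrite /Q1 mulrDl; exact: addr_ge0. Qed.
Let kQ1 : kmax ^+ 2 * X <= Q1. Proof. by rewrite /Q1 mulrDl lerDl. Qed.
Let c2B : 0 <= 2 * B + 1. Proof. by rewrite addr_ge0// mulr_ge0. Qed.
Let CQ_ge1 : 1 <= CQ.
Proof.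
have : 0 <= (2 * B + 1) * (CR + 1) by rewrite mulr_ge0// addr_ge0.
by rewrite /CQ; move: Cstar_ge0; lra.
Qed.

(** A common bound for [tau], for the derivative of [omega1] and, up to the length
    of the steps, for the increments of [tau]. *)
Definition q : R := CQ * Q1.

Let q_ge0 : 0 <= q. Proof. by rewrite mulr_ge0// (le_trans ler01). Qed.

Lemma domega1_le n : (n < N)%N -> L2norm (domega1 n) <= q.
Proof.
move=> nN; have mb := min nN.
have lr1 := (rho_wd nN).1; have lr0 := (rho_wd (ltnW nN)).1.
have lA := avg_L2 lr1 lr0; have ldu := (ucorr_wd nN).1.
have n1 := avg_norm lr1 lr0; have n2 := drho_le nN; have n3 := drho_le (ltnW nN).
have n4 := (ddrift_le nN).1; have n5 := ducorr_le nN; have n6 := dutcorr_le nN.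
have n7 := L2normD lA ldu.
have ld := (drift_wd nN).1; have lt := (utcorr_wd nN).1; have n8 := L2normD ld lt.
have n9 := beta_product_le nN (zc_wd nN) (zc0 nN).
have lb := (wdM (beta_wd mb) (zc_wd nN)).1.
have n10 : L2norm (dzc n) <= CR * h ^+ r * X + kmax ^+ 2 * X.
  apply: le_trans n7 _; apply: lerD n5.
  exact: (average_bound n1 n2 n3).
have n11 : L2norm (ddrift n + dutcorr n) <= CR * h ^+ r * X + kmax ^+ 2 * X.
  by apply: le_trans n8 _; apply: lerD.
have n12 : CR * h ^+ r * X + kmax ^+ 2 * X <= (CR + 1) * Q1.
  by rewrite -mulrA; exact: (sum_of_rates CR_ge0 kX hX1).
apply: le_trans (L2normB (L2J lb) (L2D ld lt)) _; rewrite (L2normJ lb).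
apply: (@le_trans _ _ ((2 * B + 1) * ((CR + 1) * Q1))).
  rewrite [leRHS]mulrDl mul1r; apply: lerD; last exact: le_trans n11 n12.
  apply: le_trans n9 _; apply: (ler_wpM2l (mulr_ge0 (ler0n _ _) B_ge0)).
  exact: le_trans n10 n12.
rewrite /q /CQ [leRHS]mulrDl -[in leRHS]mulrA lerDl; apply: mulr_ge0 => //.
exact: addr_ge0.
Qed.

Lemma tau_q n : (n < N)%N -> L2norm (tau n) <= q.
Proof.
move=> nN; apply: le_trans (tau_le nN) _; apply: le_trans kQ1 _.
by rewrite /q -[leLHS]mul1r; apply: ler_wpM2r.
Qed.

(** For [n = 0] both terms belong to the first step. Otherwise this is
    [average_midpoint_diff], whose condition on consecutive steps is the mesh
    condition. *)
Lemma tau_diff n : (n < N)%N ->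
  L2norm (tau n - tau n.-1) <= (step t n.+1 + step t n) * q.
Proof.
move=> nN; have k0 := step_ge0 tP nN; have k0' := step_ge0 tP (ltnW nN).
case: n nN k0 k0' => [|n] nN k0 k0'.
  have E : L2norm (tau 0 - tau 0) = 0.
    rewrite subrr; have := L2normK 0 (@L20 R); rewrite normr0 [RHS]mul0r => <-.
    by congr L2norm; apply/funext => x; rewrite !fctE mulr0.
  apply: (le_trans (le_of_eq E)); exact: mulr_ge0 (addr_ge0 k0 k0') q_ge0.
have [_ _ tlt] := tP.
have nN' := ltnW nN; have nN'' := ltnW nN'.
have lt01 := tlt n nN'; have lt12 := tlt n.+1 nN.
have kk := le_max_step t nN'; have kk' := le_max_step t nN.
have kmesh : `|(t n.+2 - t n.+1) - (t n.+1 - t n)| <= Cstar * kmax ^+ 2.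
  have := @mesh n.+1; rewrite /= nN => /(_ isT).
  rewrite /step /= => /le_trans; apply; apply: (ler_wpM2l Cstar_ge0).
  have s1 := ltW (step_gt0 tP nN'); have s2 := ltW (step_gt0 tP nN).
  rewrite /step /= in kk kk' s1 s2; rewrite ge_max; apply/andP; split.
    by rewrite lerXn2r ?nnegrE ?(le_trans s1 kk).
  by rewrite lerXn2r ?nnegrE ?(le_trans s2 kk').
have := average_midpoint_diff (fun s sb => Dl2 I02 sb) (Dsd I12) X_ge0
  (fun s sb => Dl2 I22 sb) (Dsd I22) (fun s sb => Dl2 I32 sb) (Dsd I32)
  (tin nN'') (tin nN') (tin nN) lt01 lt12 kk kk' Cstar_ge0 kmesh D22X D32X.
move=> /le_trans; apply.
have E : t n.+2 - t n = step t n.+2 + step t n.+1 by rewrite /step /=; ring.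
rewrite E mulrC; apply: (ler_wpM2l (addr_ge0 k0 k0')).
rewrite -mulrA (mulrC X); apply: le_trans (_ : (1 + Cstar) * Q1 <= _).
  exact: (ler_wpM2l (addr_ge0 ler01 Cstar_ge0) kQ1).
apply: ler_wpM2r => //; rewrite /CQ lerDr; apply: mulr_ge0 => //.
exact: addr_ge0.
Qed.

Definition CP : R := 3 * CA * CI + 2.
Definition CE : R := CP * (2 * B + 1).

Let CP_ge0 : 0 <= CP. Proof. by rewrite addr_ge0// !mulr_ge0. Qed.
Let CE_ge0 : 0 <= CE. Proof. exact: mulr_ge0. Qed.

Definition en n : R := L2norm (dx (theta n)).
(** The modified energy. It pairs the error at [t n] with the consistency error
    of the step that ends there; at the initial time, where there is none, with
    that of the first step. *)
Definition Fn n : R := en n ^+ 2 - 2 * ip (tau n.-1) (theta n) + 2 * q ^+ 2.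

Let theta_wd n : (n <= N)%N -> wd (theta n) (dx (theta n)).
Proof. by move=> nN; exact: (S_wd SH (Stheta nN)). Qed.

Let theta0 n : (n <= N)%N -> theta n 0 = 0.
Proof. by move=> nN; exact: (S_0 SH (Stheta nN)). Qed.

Let ip_tau j n : (j < N)%N -> (n <= N)%N -> ip (tau j) (theta n) <= q * en n.
Proof.
move=> jN nN; have lth := wd_L2 (theta_wd nN).
apply: le_trans (ip_CS (tau_L2 jN) lth) _.
apply: ler_pM (L2norm_ge0 _) (L2norm_ge0 _) (tau_q jN) _.
exact: (wd_poincare (theta_wd nN) b0 (theta0 nN)).
Qed.

(** One step of the energy argument: [step_H1_energy] is applied to
    [g = beta * A - J * omega1], with [A] the average of the error. The new
    energy is absorbed by [energy_step], after the summation by parts [P]. *)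
Lemma energy_rec n : (n < N)%N -> 4 * kmax * CE <= 1 / 2 ->
  Fn n.+1 <= (1 + (16 * CE + 4) * (step t n.+1 + step t n)) * Fn n
    + (16 * CE + 4) * (step t n.+1 + step t n) * q ^+ 2.
Proof.
move=> nN small; have mb := min nN; have nN' : (n.-1 < N)%N.
  by case: (n) nN => [//|j] /ltnW.
have k0 := step_gt0 tP nN; have k0' := step_ge0 tP (ltnW nN).
have w1 := theta_wd nN; have w0 := theta_wd (ltnW nN).
have l1 := wd_L2 w1; have l0 := wd_L2 w0.
have lt1 := tau_L2 nN; have lt0 := tau_L2 nN'.
pose A := avg (theta n.+1) (theta n); pose dA := avg (dx (theta n.+1)) (dx (theta n)).
have wA : wd A dA by exact: wd_avg.
have A0 : A 0 = 0 by exact: avg0 (theta0 nN) (theta0 (ltnW nN)).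
pose g : V := beta (m n) * A - J * omega1 n.
pose dg : V := (beta' (m n) * A + beta (m n) * dA) - J * domega1 n.
have wg : wd g dg by exact: (wdB (wdM (beta_wd mb) wA) (wdJ (omega1_wd nN))).
have g0 : g 0 = 0 by rewrite /g !fctE A0 (omega10 nN) !mulr0 subr0.
have JJ : J * J = -1 :> V.
  by apply/funext => x; rewrite !fctE /J -expr2 sqr_i.
have omE : J * (beta (m n) * A) + (omega1 n + K (a (m n)) * (J * tau n)) =
    J * (g + K (a (m n)) * tau n).
  have alg (b A' w c y : V) : J * (b * A') + (w + c * (J * y)) =
     J * ((b * A' - J * w) + c * y).
    have -> : J * ((b * A' - J * w) + c * y) = J * (b * A') - (J * J) * w + c * (J * y).
      by ring.
    by rewrite JJ; ring.
  exact: alg.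
have Cpg p : L2proj S g p -> L2norm (dx p) <= CP * L2norm dg.
  exact: (L2proj_H1_stable Sfin SH h_gt0 r_ge1 CA_ge0 approx CI_ge0 inverse wg g0).
have en_le := step_H1_energy Sfin SH k0 (Stheta nN) (Stheta (ltnW nN)) (theta_step nN)
  (a_neq0 mb) wg g0 lt1 omE Cpg.
have dg_le : L2norm dg <= 2 * B * L2norm dA + q.
  have lb := (wdM (beta_wd mb) wA).1; have lo := (omega1_wd nN).1.
  apply: le_trans (L2normB lb (L2J lo)) _; apply: lerD.
    exact: beta_product_le.
  by rewrite (L2normJ lo); exact: domega1_le.
have ldiff := L2B lt1 lt0.
have P : ip (tau n) (theta n.+1 - theta n) =
   ip (tau n) (theta n.+1) - ip (tau n.-1) (theta n) - ip (tau n - tau n.-1) (theta n).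
  rewrite (ipBr l1 l0 lt1) (ipBl lt1 lt0 l0).
  exact: difference_via.
have hd : - ip (tau n - tau n.-1) (theta n) <= (step t n.+1 + step t n) * q * en n.
  apply: le_trans (_ : `|ip (tau n - tau n.-1) (theta n)| <= _).
    by rewrite -normrN ler_norm.
  apply: le_trans (ip_CSn ldiff l0) _.
  apply: ler_pM (L2norm_ge0 _) (L2norm_ge0 _) (tau_diff nN) _.
  exact: (wd_poincare w0 b0 (theta0 (ltnW nN))).
have small' : 4 * k n * CE <= 1 / 2.
  apply: le_trans small; apply: (ler_wpM2r CE_ge0).
  exact: (ler_wpM2l (ler0n _ _) (le_max_step t nN)).
have kd : k n <= step t n.+1 + step t n by rewrite lerDl.
exact: (energy_step (ltW k0) kd B_ge0 CP_ge0 (erefl CE) small' q_ge0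
  (L2norm_ge0 _) (L2norm_ge0 _) (L2norm_ge0 dA) (avg_norm w1.1 w0.1)
  (L2norm_ge0 _) (tau_q nN) (L2norm_ge0 dg) dg_le en_le P
  (ip_tau nN nN) (ip_tau nN' (ltnW nN)) hd).
Qed.

Definition CG : R := 8 * expR ((16 * CE + 4) * (2 * T)).

Lemma energy_bound n : (n <= N)%N -> 4 * kmax * CE <= 1 / 2 ->
  en n <= CG * (en 0 + q).
Proof.
move=> nN small; have [t0 tN _] := tP.
have N0 : (0 < N)%N.
  rewrite lt0n; apply/negP => /eqP N0.
  by move: T_gt0; rewrite -tN N0 t0 ltxx.
have pred_lt j : (j <= N)%N -> (j.-1 < N)%N by case: j => [//|j] /=.
have E_le j : (j <= N)%N -> en j ^+ 2 <= 2 * Fn j.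
  by move=> jN; exact: (square_le_energy (ip_tau (pred_lt j jN) jN)).
have F0 j : (j <= N)%N -> 0 <= Fn j.
  move=> jN; rewrite -(pmulr_rge0 _ (ltr0n R 2)).
  exact: le_trans (sqr_ge0 (en j)) (E_le j jN).
have CE4 : 0 <= 16 * CE + 4 by rewrite addr_ge0// mulr_ge0.
have kap j : (j < N)%N -> 0 <= (16 * CE + 4) * (step t j.+1 + step t j.+1.-1).
  move=> jN; apply: mulr_ge0 => //.
  exact: addr_ge0 (step_ge0 tP jN) (step_ge0 tP (ltnW jN)).
have := discrete_gronwall (x := Fn)
  (kappa := fun j => (16 * CE + 4) * (step t j + step t j.-1)) F0 kap (sqr_ge0 q)
  (fun j jN => energy_rec jN small) nN.
rewrite -mulr_sumr sum_step2 t0 mulr0 subr0 => Fle.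
have ex : expR ((16 * CE + 4) * (t n + t n.-1)) <= expR ((16 * CE + 4) * (2 * T)).
  rewrite ler_expR; apply: ler_wpM2l => //.
  have := tin nN; have := tin (ltnW (pred_lt n nN)).
  rewrite !in_itv/= => /andP[_ h1] /andP[_ h2].
  by rewrite mulr_natl mulr2n addrC; exact: lerD.
have e00 : 0 <= en 0 by exact: L2norm_ge0.
have F00 : Fn 0 + q ^+ 2 <= 4 * (en 0 + q) ^+ 2.
  have : - ip (tau 0) (theta 0) <= q * en 0.
    have lth := wd_L2 (theta_wd (leq0n N)).
    apply: le_trans (_ : `|ip (tau 0) (theta 0)| <= _).
      by rewrite -normrN ler_norm.
    apply: le_trans (ip_CSn (tau_L2 N0) lth) _.
    apply: ler_pM (L2norm_ge0 _) (L2norm_ge0 _) (tau_q N0) _.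
    exact: (wd_poincare (theta_wd (leq0n N)) b0 (theta0 (leq0n N))).
  exact: (energy_le_square e00 q_ge0).
have G0 := expR_ge0 ((16 * CE + 4) * (2 * T)).
have CG1 : 1 <= CG.
  have : 1 <= expR ((16 * CE + 4) * (2 * T)).
    apply: le_trans (expR_ge1Dx _); rewrite lerDl; apply: mulr_ge0 => //.
    by rewrite mulr_ge0// ltW.
  exact: one_le_8M.
have eq0 : 0 <= en 0 + q by exact: addr_ge0.
have CG0 : 0 <= CG by exact: le_trans CG1.
have en0 : 0 <= en n by exact: L2norm_ge0.
rewrite -(@ler_pXn2r _ 2%N) ?nnegrE//; last exact: mulr_ge0.
apply: le_trans (E_le n nN) _.
have step1 : 2 * Fn n <= CG * (en 0 + q) ^+ 2.
  have s1 : Fn n <= expR ((16 * CE + 4) * (2 * T)) * (4 * (en 0 + q) ^+ 2).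
    apply: le_trans Fle _.
    exact: (ler_pM (expR_ge0 _) (addr_ge0 (F0 0%N (leq0n N)) (sqr_ge0 q)) ex F00).
  apply: le_trans (ler_wpM2l (ler0n R 2) s1) _; apply: le_of_eq.
  by rewrite /CG; move: (expR _) (_ ^+ 2) => p1 p2; ring.
apply: le_trans step1 _; rewrite exprMn; apply: ler_wpM2r; first exact: sqr_ge0.
by rewrite expr2 ler_peMr.
Qed.

Lemma H1_error n : (n <= N)%N -> 4 * kmax * CE <= 1 / 2 ->
  Hnorm 1 (fun x => U n x - u (t n) x) <=
  2 * (CG * (1 + CQ) + CR)
  * (Hnorm 1 (fun x => uh0 x - elliptic_projection S u0 x) + Q1).
Proof.
move=> nN small; have U0 : U 0%N = uh0 by have [_ ->] := CN.
have wth := theta_wd nN; have wr := rho_wd nN; have ws := wdD wth wr.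
have tb := tin nN.
have wU : wd (fun x => U n x - u (t n) x) (dx (theta n) + drho n).
  apply: wd_ext ws _ _ => // x xb.
  by rewrite /theta /rho !fctE (D00 tb xb) addrA subrK.
have s0 : (fun x => U n x - u (t n) x) 0 = 0.
  by rewrite /= (S_0 SH (SU nN)) -(D00 tb b0) (bc0 I00 tb) subr0.
apply: le_trans (Hnorm1_le wU) _.
have n1 := wd_poincare wU b0 s0; have n2 := L2normD wth.1 wr.1.
have n3 := drho_le nN; have n4 := energy_bound nN small.
have n5 : en 0 <= Hnorm 1 (fun x => uh0 x - elliptic_projection S u0 x).
  have := (Hnorm1_ge (theta_wd (leq0n N))).2.
  by rewrite {2}/theta U0.
have Hge0 := Hnorm_ge0 1 (fun x => uh0 x - elliptic_projection S u0 x).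
move: n1 n2 n3 n4 n5 Hge0; rewrite -/(en n).
move: (L2norm (fun x => U n x - u (t n) x)) (L2norm (dx (theta n) + drho n))
  (L2norm (drho n)) (en n) (en 0) (Hnorm 1 _) => y1 y2 y3 y4 y5 y6.
move=> n1 n2 n3 n4 n5 y60.
have G0 : 0 <= CG by rewrite /CG mulr_ge0// expR_ge0.
have CQ0 : 0 <= CQ by exact: le_trans CQ_ge1.
have c1 : y4 <= CG * (1 + CQ) * (y6 + Q1).
  apply: le_trans n4 _; rewrite -[leRHS]mulrA; apply: (ler_wpM2l G0).
  rewrite mulrDl mul1r /q; apply: lerD; first by apply: le_trans n5 _; rewrite lerDl.
  by apply: (ler_wpM2l CQ0); rewrite lerDr.
have c2 : y3 <= CR * (y6 + Q1).
  apply: le_trans n3 _; rewrite -mulrA; apply: (ler_wpM2l CR_ge0).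
  by rewrite /Q1 mulrDl addrA lerDr addr_ge0.
have c3 : y1 + y2 <= 2 * (y4 + y3) by exact: double_bound.
apply: le_trans c3 _; rewrite -mulrA; apply: (ler_wpM2l (ler0n _ _)).
by rewrite mulrDl; apply: lerD.
Qed.

End EnergyEstimate.

End Scheme.

(** * Conclusion *)

Lemma sum_two (R : realType) (F : nat -> R) j : \sum_(j <= i < j.+2) F i = F j + F j.+1.
Proof. by rewrite big_nat_recr//= big_nat1. Qed.

Section XiBounds.
Context {R : realType}.
Notation V := (R -> R[i]).
Variables (T : R) (T_gt0 : 0 < T) (r : nat).
Variables (I : nat -> nat -> bool) (u : R -> V) (D : nat -> nat -> R -> V).
Hypothesis I_down : forall m l m' l', (m' <= m)%N -> (l' <= l)%N -> I m l -> I m' l'.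
Hypothesis D00 : forall t x, t \in `[0, T] -> x \in `[0, 1] -> D 0%N 0%N t x = u t x.
Hypothesis Dcont : forall m l, I m l -> ccontinuous2 T (D m l).
Hypothesis Dt : forall m l, I m.+1 l -> forall t x, t \in `[0, T] -> x \in `[0, 1] ->
  is_cderiv T (fun s => D m l s x) t (D m.+1 l t x).
Hypothesis Dx : forall m l, I m l.+1 -> forall t x, t \in `[0, T] -> x \in `[0, 1] ->
  is_cderiv 1 (D m l t) x (D m l.+1 t x).

Lemma Xi0E : Xi0 T r u =
  max_time T (fun t => Hnorm r.+1 (dt T 0 u t))
  + max_time T (fun t => Hnorm r.+1 (dt T 1 u t))
  + (max_time T (fun t => L2norm (dt T 2 u t))
     + max_time T (fun t => L2norm (dt T 3 u t)))
  + max_time T (fun t => L2norm (dt T 2 (dx 2 u) t)).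
Proof. by congr (_ + _ + _); exact: sum_two. Qed.

Lemma sum5_ge (a b c d e : R) : 0 <= a -> 0 <= b -> 0 <= c -> 0 <= d -> 0 <= e ->
  [/\ 0 <= a + b + (c + d) + e, a <= a + b + (c + d) + e, b <= a + b + (c + d) + e,
      c <= a + b + (c + d) + e & d <= a + b + (c + d) + e /\ e <= a + b + (c + d) + e].
Proof. by move=> *; split; [lra..|split; lra]. Qed.

Hypotheses (I1r : I 1 r.+1) (I30 : I 3 0) (I22 : I 2 2).

Lemma Xi0_bounds :
  [/\ 0 <= Xi0 T r u,
      max_time T (fun t => Hnorm r.+1 (dt T 0 u t)) <= Xi0 T r u,
      max_time T (fun t => Hnorm r.+1 (dt T 1 u t)) <= Xi0 T r u,
      (forall t, t \in `[0, T] -> L2norm (D 2 0 t) <= Xi0 T r u) &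
      (forall t, t \in `[0, T] -> L2norm (D 3 0 t) <= Xi0 T r u) /\
      (forall t, t \in `[0, T] -> L2norm (D 2 2 t) <= Xi0 T r u)].
Proof.
have I0r : I 0 r.+1 by apply: I_down I1r.
have I20 : I 2 0 by apply: I_down I22.
have h0 := Hmax_ge0 T_gt0 I_down D00 Dcont Dt Dx I0r.
have h1 := Hmax_ge0 T_gt0 I_down D00 Dcont Dt Dx I1r.
have h2 := L2max_ge0 T_gt0 I_down D00 Dcont Dt I20.
have h3 := L2max_ge0 T_gt0 I_down D00 Dcont Dt I30.
have h4 := dxmax_ge0 T_gt0 I_down D00 Dcont Dt Dx I22.
have [s0 s1 s2 s3 [s4 s5]] := sum5_ge h0 h1 h2 h3 h4.
rewrite -Xi0E in s0 s1 s2 s3 s4 s5.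
split; [exact: s0|exact: s1|exact: s2| |split] => t tb.
- exact: le_trans (D_le_L2max T_gt0 I_down D00 Dcont Dt I20 tb) s3.
- exact: le_trans (D_le_L2max T_gt0 I_down D00 Dcont Dt I30 tb) s4.
- exact: le_trans (D_le_dxmax T_gt0 I_down D00 Dcont Dt Dx I22 tb) s5.
Qed.

Hypotheses (I2r : I 2 r.+1) (I40 : I 4 0) (I32 : I 3 2).

Lemma sum4_ge (a b c d : R) : 0 <= b -> 0 <= c -> 0 <= d ->
  a <= a + b + c + d /\ (0 <= a -> d <= a + b + c + d).
Proof. by move=> *; split; [lra|move=> *; lra]. Qed.

Lemma Xi1_bounds : Xi0 T r u <= Xi1 T r u /\
  (forall t, t \in `[0, T] -> L2norm (D 3 2 t) <= Xi1 T r u).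
Proof.
have h1 := Hmax_ge0 T_gt0 I_down D00 Dcont Dt Dx I2r.
have h2 := L2max_ge0 T_gt0 I_down D00 Dcont Dt I40.
have h3 := dxmax_ge0 T_gt0 I_down D00 Dcont Dt Dx I32.
have [x0 _ _ _ _] := Xi0_bounds.
have [s1 /(_ x0) s2] := sum4_ge (Xi0 T r u) h1 h2 h3.
split; first exact: s1.
move=> t tb.
exact: le_trans (D_le_dxmax T_gt0 I_down D00 Dcont Dt Dx I32 tb) s2.
Qed.

End XiBounds.

(** The regularity of [beta] enters the estimates in this form: at each time it
    is a bounded multiplier of L^2 with a bounded weak derivative. *)
Lemma coefficient_bounds (R : realType) (T : R) (beta : R -> R -> R[i]) :
  smooth2 T (fun m l => m + l <= 1)%N beta ->
  exists (beta' : R -> R -> R[i]) (B : R), [/\ 0 <= B,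
   (forall t, t \in `[0, T] -> wd (beta t) (beta' t)),
   (forall t, t \in `[0, T] ->
      measurable_fun (`]0, 1[%classic : set R) (fun x => complex.Re (beta t x)) /\
      measurable_fun (`]0, 1[%classic : set R) (fun x => complex.Im (beta t x))),
   (forall t, t \in `[0, T] ->
      measurable_fun (`]0, 1[%classic : set R) (fun x => complex.Re (beta' t x)) /\
      measurable_fun (`]0, 1[%classic : set R) (fun x => complex.Im (beta' t x))) &
   (forall t, t \in `[0, T] -> forall x, (`]0, 1[%classic : set R) x ->
      Normc.normc (beta t x) <= B /\ Normc.normc (beta' t x) <= B)].
Proof.
move=> [D [D00 Dcont _ Dx]].
have c0 := Dcont 0%N 0%N isT; have c1 := Dcont 0%N 1%N isT.
have nb (z : R[i]) : Normc.normc z <= `|complex.Re z| + `|complex.Im z|.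
  case: z => p s /=; rewrite -[leRHS]ger0_norm ?addr_ge0// -sqrtr_sqr ler_wsqrtr//.
  rewrite sqrrD !real_normK ?num_real// addrAC lerDl.
  by rewrite mulrn_wge0// mulr_ge0.
have [M1 M10 H1] := within2_bounded (g := fun t x => complex.Re (D 0%N 0%N t x)) c0.1.
have [M2 M20 H2] := within2_bounded (g := fun t x => complex.Im (D 0%N 0%N t x)) c0.2.
have [M3 M30 H3] := within2_bounded (g := fun t x => complex.Re (D 0%N 1%N t x)) c1.1.
have [M4 M40 H4] := within2_bounded (g := fun t x => complex.Im (D 0%N 1%N t x)) c1.2.
exists (D 0%N 1%N), (M1 + M2 + (M3 + M4)); split.
- by rewrite !addr_ge0.
- move=> t tb; have [p1 p2] := ccontinuous2_slice c1 tb.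
  have w := wd_classical p1 p2 (Dx 0%N 0%N isT t ^~ tb).
  by apply: wd_ext w _ _ => // x xb; exact: D00.
- move=> t tb; have [p1 p2] := ccontinuous2_slice c0 tb; split.
    apply: eq_measurable_fun (within_meas p1) => x /set_mem /sub_oo_cc xb.
    by rewrite D00.
  apply: eq_measurable_fun (within_meas p2) => x /set_mem /sub_oo_cc xb.
  by rewrite D00.
- move=> t tb; have [p1 p2] := ccontinuous2_slice c1 tb.
  by split; [exact: within_meas p1|exact: within_meas p2].
- move=> t tb x /sub_oo_cc xb; rewrite -D00//; split.
    apply: le_trans (nb _) _; apply: (@le_trans _ _ (M1 + M2)).
      by apply: lerD; [exact: H1|exact: H2].
    by rewrite lerDl addr_ge0.
  apply: le_trans (nb _) _; apply: (@le_trans _ _ (M3 + M4)).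
    by apply: lerD; [exact: H3|exact: H4].
  by rewrite lerDr addr_ge0.
Qed.

Lemma small_step_half (R : realType) (k c : R) :
  0 <= k -> 0 <= c -> k <= (8 * (c + 1))^-1 -> 4 * k * c <= 1 / 2.
Proof.
move=> k0 c0; have c1 : 0 < 8 * (c + 1) by rewrite mulr_gt0// ltr_wpDl.
rewrite -[(8 * _)^-1]mul1r ler_pdivlMr// => small; lra.
Qed.

Theorem theorem2p14 (R : realType) (r : nat) (hstar : R)
    (Sh : R -> set (R -> R[i])) (T : R) (a : R -> R) (beta : R -> R -> R[i])
    (r_ge1 : (1 <= r)%N) (hstar_gt0 : 0 < hstar)
    (Sh_fe : forall h, 0 < h <= hstar -> fe_space r h (Sh h))
    (Sh_approx : approximation_property r hstar Sh)
    (T_gt0 : 0 < T)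
    (a_neq0 : forall t, t \in `[0, T] -> a t != 0)
    (a_smooth : C1_time T a)
    (beta_smooth : smooth2 T (fun m l => m + l <= 1)%N beta) :
  (exists C delta : R, 0 < delta /\
    forall (f : R -> R -> R[i]) (u0 : R -> R[i]) (u : R -> R -> R[i]),
      AK_solution T a beta f u0 u -> smooth2 T (orders0 r) u ->
    forall (N : nat) (t : nat -> R),
      is_partition T N t -> max_step N t <= delta ->
    forall h, 0 < h <= hstar ->
    forall (uh0 : R -> R[i]) (U : nat -> R -> R[i]),
      Sh h uh0 -> crank_nicolson a beta f N t (Sh h) uh0 U ->
      \big[Num.max/0]_(0 <= n < N.+1) L2norm (fun x => U n x - u (t n) x)
      <= C * (L2norm (fun x => uh0 x - elliptic_projection (Sh h) u0 x)
              + (max_step N t ^+ 2 + h ^+ r.+1) * Xi0 T r u))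
  /\
  (inverse_inequality hstar Sh ->
   forall Cstar : R, 0 <= Cstar ->
   exists C delta : R, 0 < delta /\
    forall (f : R -> R -> R[i]) (u0 : R -> R[i]) (u : R -> R -> R[i]),
      AK_solution T a beta f u0 u -> smooth2 T (orders1 r) u ->
    forall (N : nat) (t : nat -> R),
      is_partition T N t -> time_mesh_condition Cstar N t ->
      max_step N t <= delta ->
    forall h, 0 < h <= hstar ->
    forall (uh0 : R -> R[i]) (U : nat -> R -> R[i]),
      Sh h uh0 -> crank_nicolson a beta f N t (Sh h) uh0 U ->
      \big[Num.max/0]_(0 <= n < N.+1) Hnorm 1 (fun x => U n x - u (t n) x)
      <= C * (Hnorm 1 (fun x => uh0 x - elliptic_projection (Sh h) u0 x)
              + (max_step N t ^+ 2 + h ^+ r) * Xi1 T r u)).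
Proof.
have [CA0 HCA] := Sh_approx; pose CA := `|CA0|.
have CA_ge0 : 0 <= CA by exact: normr_ge0.
have approx h : 0 < h <= hstar -> forall s, (s <= r)%N -> forall v, inHH s.+1 v ->
    inf [set L2norm (fun x => v x - chi x)
         + h * Hnorm 1 (fun x => v x - chi x) | chi in Sh h]
    <= CA * h ^+ s.+1 * Hnorm s.+1 v.
  move=> hb s sr v hv; apply: le_trans (HCA h hb s sr v hv) _.
  apply: ler_wpM2r; first exact: Hnorm_ge0.
  apply: ler_wpM2r; last exact: ler_norm.
  by have /andP[h0 _] := hb; rewrite exprn_ge0// ltW.
have [beta' [B [B_ge0 bwd bm b'm bB]]] := coefficient_bounds beta_smooth.
have [a' [_ a'd]] := a_smooth.
have [Amax _ aM] := within_bounded (ltW T_gt0) (rderiv_within (lexx 0) (lexx T) a'd).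
have bmr t (tb : t \in `[0, T]) := (bm t tb).1.
have bmi t (tb : t \in `[0, T]) := (bm t tb).2.
have b'mr t (tb : t \in `[0, T]) := (b'm t tb).1.
have b'mi t (tb : t \in `[0, T]) := (b'm t tb).2.
have bB0 t tb x xb := (bB t tb x xb).1; have bB1 t tb x xb := (bB t tb x xb).2.
split.
  exists (expR (2 * (B + 1) * T) * (1 + (C1 CA r B + Amax)) + 3 * CA * CR CA r).
  have B10 : 0 < B + 1 by rewrite ltr_wpDl.
  exists (B + 1)^-1; split; first by rewrite invr_gt0.
  move=> f u0 u sol [D [D00 Dcont Dt Dx]] N t tP small h hb uh0 U Suh0 CN.
  have [Sfin SH _] := Sh_fe h hb; have /andP[h0 _] := hb.
  have I1r : orders0 r 1 r.+1 by rewrite /orders0 !leqnn.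
  have I30 : orders0 r 3 0 by rewrite /orders0 orbT.
  have I22 : orders0 r 2 2 by rewrite /orders0 !orbT.
  have [X0 X1 X2 X3 [X4 X5]] :=
    Xi0_bounds T_gt0 (@orders0_down r) D00 Dcont Dt Dx I1r I30 I22.
  have kB : max_step N t * (B + 1) <= 1 by rewrite -ler_pdivlMr// mul1r.
  have main n (nN : (n <= N)%N) := L2_error Sfin SH h0 r_ge1 CA_ge0 (approx h hb) T_gt0
    aM B_ge0 bmr bmi bB0 (@orders0_down r) D00 Dcont Dt Dx I1r I30 I22 X0 X1 X2
    X3 X4 X5 sol tP CN nN kB.
  rewrite big_seq; apply: bigmax_le.
    exact: le_trans (L2norm_ge0 _) (main 0%N (leq0n N)).
  by move=> n; rewrite mem_index_iota ltnS => /andP[_ nN]; exact: main.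
move=> [CI0 HCI] Cstar Cstar_ge0; pose CI := `|CI0|.
have CI_ge0 : 0 <= CI by exact: normr_ge0.
pose c := CE CA B CI.
have c_ge0 : 0 <= c.
  exact: (mulr_ge0 (addr_ge0 (mulr_ge0 (mulr_ge0 (ler0n _ _) CA_ge0) CI_ge0) (ler0n _ _))
    (addr_ge0 (mulr_ge0 (ler0n _ _) B_ge0) ler01)).
exists (2 * (CG CA T B CI * (1 + CQ CA r B Cstar) + CR CA r)).
have c10 : 0 < 8 * (c + 1) by rewrite mulr_gt0// ltr_wpDl.
exists (8 * (c + 1))^-1; split; first by rewrite invr_gt0.
move=> f u0 u sol [D [D00 Dcont Dt Dx]] N t tP mesh small h hb uh0 U Suh0 CN.
have [Sfin SH _] := Sh_fe h hb; have /andP[h0 _] := hb.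
have I1r : orders1 r 1 r.+1 by rewrite /orders1 /orders0 !leqnn.
have I30 : orders1 r 3 0 by rewrite /orders1 /orders0 orbT.
have I22 : orders1 r 2 2 by rewrite /orders1 /orders0 !orbT.
have I2r : orders1 r 2 r.+1 by rewrite /orders1 /orders0 !leqnn !orbT.
have I40 : orders1 r 4 0 by rewrite /orders1 /orders0 !orbT.
have I32 : orders1 r 3 2 by rewrite /orders1 /orders0 !orbT.
have [X0 X1 X2 X3 [X4 X5]] :=
  Xi0_bounds T_gt0 (@orders1_down r) D00 Dcont Dt Dx I1r I30 I22.
have [Y0 Y1] := Xi1_bounds T_gt0 (@orders1_down r) D00 Dcont Dt Dx I1r I30 I22 I2r I40 I32.
have inv phi : Sh h phi -> H1semi phi <= CI * h^-1 * L2norm phi.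
  move=> Sphi; apply: le_trans (HCI h hb phi Sphi) _.
  apply: ler_wpM2r; first exact: L2norm_ge0.
  by apply: ler_wpM2r; [rewrite invr_ge0 ltW|exact: ler_norm].
have kB : 4 * max_step N t * c <= 1 / 2.
  have k0 : 0 <= max_step N t by exact: max_step_ge0.
  exact: (small_step_half k0 c_ge0 small).
have main n (nN : (n <= N)%N) := H1_error Sfin SH h0 r_ge1 CA_ge0 (approx h hb) T_gt0
  B_ge0 bwd bmr bmi bB0 (@orders1_down r) D00 Dcont Dt Dx I1r I22
  (le_trans X0 Y0) (le_trans X1 Y0) (le_trans X2 Y0)
  (fun s sb => le_trans (X5 s sb) Y0) sol tP CN CI_ge0 inv a_neq0
  b'mr b'mi bB1 I32 Y1 Cstar_ge0 mesh nN kB.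
rewrite big_seq; apply: bigmax_le.
  exact: le_trans (Hnorm_ge0 _ _) (main 0%N (leq0n N)).
by move=> n; rewrite mem_index_iota ltnS => /andP[_ nN]; exact: main.
Qed.
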